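(* Let $q$ be an odd prime power. The elliptic curve $\mathcal C_1: y^2=x^3-x$ over $\mathbb{F}_q$ contains an $\mathbb{F}_q$-primitive point if and only if $q\notin\{3,7,13,17,25,49,121\}$. The elliptic curve $\mathcal C_{-1}: y^2=x^3+x$ over $\mathbb{F}_q$ contains an $\mathbb{F}_q$-primitive point if and only if $q\notin\{5,9,17,41,49\}$.
   Context: A primitive element of $\mathbb{F}_q$ is a generator of the cyclic group $\mathbb{F}_q^*$. An $\mathbb{F}_q$-primitive point on a curve defined over $\mathbb{F}_q$ is an $\mathbb{F}_q$-rational point $(x,y)\in\mathbb{F}_q^2$ of the curve such that both coordinates $x$ and $y$ are primitive elements of $\mathbb{F}_q$. *)

(* Defs.v *)
From mathcomp Require Import all_boot all_algebra all_field.
Set Implicit Arguments. Unset Strict Implicit. Unset Printing Implicit Defensive.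
Import GRing.Theory.
Local Open Scope ring_scope.

Definition primitive_elt (F : finFieldType) (x : F) : Prop :=
  x != 0 /\ forall y : F, y != 0 -> exists k : nat, y = x ^+ k.

Definition has_primitive_point (F : finFieldType) (a : F) : Prop :=
  exists x y : F, y ^+ 2 = x ^+ 3 + a * x /\ primitive_elt x /\ primitive_elt y.

(* Main.v *)
(** Write [n = q - 1].  A pair of elements of the curve [y^2 = x^3 + a x] is
    primitive when neither [x] nor [y] is an [l]-th power for any prime [l]
    dividing [n], so primitive points are counted by the sums of
    [chi(x) psi(y)] over the curve, for multiplicative characters [chi] and
    [psi].  These curves are special: since [y^2 = x (x^2 + a)], such a sum
    vanishes or becomes, in the variable [t = x^2], a combination of at most
    four Jacobi sums, each bounded by [sqrt q] by an elementary second moment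
    computation.  Sieving only by some of the primes and bounding the rest
    trivially (the prime sieve) yields a primitive point unless [q] is small
    in comparison with the small prime factors of [n].  A tree search over the
    set of small primes dividing [n] lists the remaining [q]; each of them is
    composite, or carries an explicit primitive point, or is one of the
    exceptions, where all powers of a generator are tried. *)

From Stdlib Require Import PArith NArith PeanoNat.
From HB Require Import structures.
Require Import Defs.
From mathcomp Require Import all_boot all_order all_algebra all_field.
From mathcomp Require Import cyclic ring zify.
Set Implicit Arguments. Unset Strict Implicit. Unset Printing Implicit Defensive.

(** * The computations *)

(** The length of the search depends on the constant in front of [sqrt q] in the error term. To keep
    it small, the prime 2 is not sieved: the condition that both coordinates are nonsquares enters
    as an exact weight, which splits each twisted sum into four. The symmetries [x -> -x] and
    [y -> -y] kill some of these when [q] is 3 modulo 4 or 5 modulo 8. Hence the factors 1, 2, 4 and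
    the three separate searches.

    Results of trial division and of searches are only hints that are checked afterwards. Primality
    of a large [q] is not tested by itself: a prime power [q > 2] is prime once the integers modulo
    [q] contain an element of order [q - 1]. Polynomials defining extension fields are not tested
    for irreducibility either: a root [z] in a splitting field with [z ^ (q - 1) = 1] already lies
    in the field of [q] elements. The sieve estimates are inequalities between integers, with
    inverses of primes rounded up in units of [1 / 65536]. *)

Section OrderList.
Variables (A : Type) (mul : A -> A -> A).

Fixpoint powp (z : A) (e : positive) : A :=
  match e with
  | xH => z
  | xO e => powp (mul z z) e
  | xI e => mul z (powp (mul z z) e)
  end.

Fixpoint prodp (ls : seq positive) : positive :=
  if ls is l :: ls then Pos.mul l (prodp ls) else xH.

(* [z ^ prod ls], and the powers [z ^ (prod ls / l)] that must differ from 1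
   for [z] to have order [prod ls]. *)
Fixpoint ordlist (z : A) (ls : seq positive) : A * seq A :=
  match ls with
  | [::] => (z, [::])
  | l :: ls => let (f, ws) := ordlist (powp z l) ls in (f, powp z (prodp ls) :: ws)
  end.
End OrderList.

(* Montgomery arithmetic modulo the odd number 2 m + 1 *)
Definition halve (m : positive) (acc : N) : N :=
  match acc with
  | N0 => N0
  | Npos xH => Npos (Pos.succ m)
  | Npos (xO p) => Npos p
  | Npos (xI p) => Npos (Pos.add_carry p m)
  end.

Definition addp (b : positive) (acc : N) : N :=
  match acc with N0 => Npos b | Npos p => Npos (Pos.add p b) end.

Fixpoint halves (k : nat) (m : positive) (acc : N) : N :=
  if k is k.+1 then halves k m (halve m acc) else acc.

(* [(acc + a b) / 2 ^ k] modulo [2 m + 1]. The case [k = 0] is correct without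
   any bound on [a], so the specification needs none. *)
Fixpoint montp (k : nat) (m b a : positive) (acc : N) : N :=
  match k with
  | 0 => N.add acc (Npos (Pos.mul a b))
  | k.+1 =>
    match a with
    | xH => halves k m (halve m (addp b acc))
    | xO a => montp k m b a (halve m acc)
    | xI a => montp k m b a (halve m (addp b acc))
    end
  end.

Definition montgomery k m (a b : N) : N :=
  match a, b with Npos a, Npos b => montp k m b a N0 | _, _ => N0 end.

Definition hasdiv (d n : N) : bool := if N.modulo n d is N0 then true else false.

Definition reduce_once (q : positive) (w : N) : N :=
  if N.leb (Npos q) w then N.sub w (Npos q) else w.

(** All powers [z ^ (N / l)] are powers of [z ^ c] with [c = N / prod ls], which is computed once.
    The size of a Montgomery product is not bounded by a proof: the test itself checks that [w']
    lies below [q], where being different from [one] means being different modulo [q]. *)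
Definition order_test k m (q : positive) (one : N) (z : N) (N : positive) (ls : seq positive) : bool :=
  let r := prodp ls in
  match N.div_eucl (Npos N) (Npos r) with
  | (Npos c, N0) =>
    let (f, ws) := ordlist (montgomery k m) (powp (montgomery k m) z c) ls in
    N.eqb (reduce_once q f) one && all (fun w => let w' := reduce_once q w in N.ltb w' (Npos q) && ~~ N.eqb w' one) ws
  | _ => false
  end.

(* ls: the odd primes dividing q - 1, largest first *)
Definition prime_test (q : positive) (ls : seq positive) (x : N) : bool :=
  match q with
  | xI m =>
    let k := (Pos.size_nat q).+2 in
    let one := N.modulo (N.pow 2 (N.of_nat k)) (Npos q) in
    let conv z := N.modulo (N.mul z one) (Npos q) in
    let x3 := N.mul x (N.mul x x) in
    let test z N ls := order_test k m q one (conv z) N ls in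
    let ls2 := match m with xO _ => ls ++ [:: 2%positive] | _ => ls end in
    [&& test x (Pos.mul 2 m) (ls ++ [:: 2%positive]),
        test (N.add x3 x) m ls2 & test (N.sub x3 x) m ls2]
  | _ => false
  end.

Definition scale : N := 65536.
(** Rounded up, so that sums of these values overestimate [scale] times the sum of the inverses,
    which is the safe direction for the sieve. *)
Definition inv_up (l : N) : N := N.succ (N.div scale l).
Definition sumN (s : seq N) : N := foldr N.add 0%num s.
Definition lenN (s : seq N) : N := foldr (fun _ => N.succ) 0%num s.

(* The sieve criterion for [k] core primes and [s] sieving primes whose inverses
   sum to at most [a / scale], with [Ck = C 4 ^ k]. It is squared to avoid
   [sqrt q], and [q - 6] is a lower bound of [(q - 3) ^ 2 / q]. *)
Definition crit_at (Ck q s a : N) : bool :=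
  let d := N.sub scale (N.mul 2 a) in
  let V := N.mul Ck (N.add d (N.mul 2 (N.sub (N.mul s scale) a))) in
  N.ltb 0 d && N.ltb (N.mul V V) (N.mul (N.sub q 6) (N.mul d d)).

(** Every prefix of the list is tried as the core. The search supplies the primes in increasing
    order, so the core collects the smallest ones, whose inverses would cost most on the sieving
    side. *)
Fixpoint crit (Ck q : N) (invs : seq N) : bool :=
  crit_at Ck q (lenN invs) (sumN invs) ||
  (if invs is _ :: invs' then crit (N.mul 4 Ck) q invs' else false).

(** Solves the inequality of [crit_at] for [q]: if [q] is at least 7 plus the integer part of
    [V ^ 2 / d ^ 2], then [q - 6] exceeds [V ^ 2 / d ^ 2]. There is no threshold when the bound on
    the sum of inverses reaches one half. *)
Definition threshold_at (Ck s a : N) : option N :=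
  let d := N.sub scale (N.mul 2 a) in
  let V := N.mul Ck (N.add d (N.mul 2 (N.sub (N.mul s scale) a))) in
  if N.eqb d 0 then None else Some (N.add 7 (N.div (N.mul V V) (N.mul d d))).

Definition omin (a b : option N) : option N :=
  match a, b with
  | Some x, Some y => Some (N.min x y)
  | None, b => b
  | a, None => a
  end.

(** Here [s] further primes are known only through a bound [a] on their inverses; they always stay
    on the sieving side, and only the splitting of the known primes varies. *)
Fixpoint threshold (Ck : N) (invs : seq N) (s a : N) : option N :=
  omin (threshold_at Ck (N.add (lenN invs) s) (N.add (sumN invs) a))
    (if invs is _ :: invs' then threshold (N.mul 4 Ck) invs' s a else None).

(* A bound [B] such that the sieve succeeds for all [q >= B] when [q - 1] is a
   multiple of [M] with odd prime divisors [ch] and [r], [r + 1], ... more, all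
   at least [p]. Here [Q = M p ^ r] and [K = C ^ 2 16 ^ (size ch + r)]; once
   [5 + K < Q], sieving by no prime at all is enough, for [r] and, as
   [p >= 16], for all larger values. *)
Fixpoint leaf_bound (fuel : nat) (C : N) (invs : seq N) (ip p : N) (r Q K B : N) : option N :=
  if N.ltb (N.add 5 K) Q then Some B else
  if fuel is fuel.+1 then
    if threshold C invs r (N.mul r ip) is Some t then
      leaf_bound fuel C invs ip p (N.succ r) (N.mul Q p) (N.mul 16 K)
        (if N.ltb (N.succ Q) t then N.max B t else B)
    else None
  else None.

Fixpoint strip (fuel : nat) (d n : N) : N :=
  if fuel is fuel.+1 then
    match N.div_eucl n d with (Npos q, N0) => strip fuel d (Npos q) | _ => n end
  else n.

(** Exhausted fuel leaves a [0] in the list. In an extension field test [pos_of] turns it into 1,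
    which the primality check of [prime_cover] rejects. *)
Fixpoint odd_primes (fuel : nat) (d n : N) : seq N :=
  if N.ltb n (N.mul d d) then (if N.leb n 1 then [::] else [:: n]) else
  if fuel is fuel.+1 then
    if hasdiv d n then d :: odd_primes fuel (N.add 2 d) (strip 20 d n)
    else odd_primes fuel (N.add 2 d) n
  else [:: 0%num].

Definition odd_primes_small (j : N) : seq N := odd_primes 30 3 (strip 20 2 j).

Fixpoint jtable (k : nat) (j : N) : seq (N * seq N) :=
  if k is k.+1 then (j, odd_primes_small j) :: jtable k (N.succ j) else [::].

Definition memN (x : N) (s : seq N) : bool := has (N.eqb x) s.

Definition split_at (q c : N) : bool :=
  let e := N.div q c in
  [&& N.ltb 1 c, N.ltb 1 e, N.eqb (N.mul c e) q & N.eqb (N.gcd c e) 1].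

(** The quotient of [q] by its stripped part is the power of [d] in [q], coprime to its cofactor;
    [split_at] verifies this again. Two coprime factors above 1 show that no field has [q]
    elements. *)
Definition small_split (q : N) : bool :=
  has (fun d => if hasdiv d q then split_at q (N.div q (strip 30 d q)) else false)
    [:: 3; 5; 7; 11; 13; 17; 19; 23; 29; 31; 37]%num.

Definition pos_of (n : N) : positive := if n is Npos p then p else xH.

Definition candidate (pl : seq N) (C q : N) (ls : seq N) (certs : seq N) : option (seq N) :=
  if small_split q then Some certs else
  if crit C q (map inv_up ls) then Some certs else
  if certs is c :: certs then
    if c is N0 then (if memN q pl then Some certs else None)
    else if hasdiv c q then (if split_at q c then Some certs else None)
    else if prime_test (pos_of q) (rev (map pos_of ls)) c then Some certs else None
  else None.

(* [skip_even] is for the classes of [q] modulo 8 where the cofactor [j] is odd. *)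
Fixpoint leaf_run (pl : seq N) (C TM J p : N) (skip_even : bool) (ch : seq N) (tab : seq (N * seq N)) (certs : seq N) : option (seq N) :=
  if tab is (j, js) :: tab then
    if N.ltb J j then Some certs
    else
      let new := filter (fun l => ~~ memN l ch) js in
      if (skip_even && ~~ N.odd j) || has (fun l => N.ltb l p) new
      then leaf_run pl C TM J p skip_even ch tab certs
      else if candidate pl C (N.succ (N.mul TM j)) (ch ++ new) certs is Some certs
        then leaf_run pl C TM J p skip_even ch tab certs
        else None
  else None.

(** A filter that may let composite numbers through: branching on a composite [p] is still sound,
    because the branch without [p] then covers the case. *)
Definition has_proper_factor (p : N) : bool :=
  has (fun d => [&& N.ltb 1 d, N.ltb d p & hasdiv d p]) [:: 3; 5; 7; 11; 13; 17; 19; 23; 29; 31; 37; 41; 43; 47]%num.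

(* The odd prime divisors of [q - 1] below [p] are those in [ch], and [M] is [T]
   times their product. *)
Fixpoint node (tab : seq (N * seq N)) (pl : seq N) (C T : N) (fuel : nat) (p : N) (ch : seq N) (M : N) (certs : seq N) : option (seq N) :=
  if fuel is fuel.+1 then
    if has_proper_factor p then node tab pl C T fuel (N.add 2 p) ch M certs else
    let bound := if N.ltb p 17 then None else
      leaf_bound 30 C (map inv_up ch) (inv_up p) p 0 M (N.mul (N.mul C C) (N.pow 16 (lenN ch))) 0 in
    let J := if bound is Some B then N.div B M else 1501%num in
    if N.leb J 1500 then leaf_run pl C M J p (N.ltb T 8) ch tab certs
    else
      if node tab pl C T fuel (N.add 2 p) (ch ++ [:: p]) (N.mul M p) certs is Some certs
      then node tab pl C T fuel (N.add 2 p) ch M certs else None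
  else None.

(* The constant [C] depends on the class of [q]: 1 mod 8, 5 mod 8 and 3 mod 4. *)
Definition run (k fuel : nat) pl certs : bool :=
  let tab := jtable k 1 in
  if node tab pl 16 8 fuel 3 [::] 8 certs is Some certs then
  if node tab pl 8 4 fuel 3 [::] 4 certs is Some certs then
  if node tab pl 4 2 fuel 3 [::] 2 certs is Some certs then true
  else false else false else false.

(* A list of coefficients stands for the value of a polynomial at [tau], where
   [tau ^ size h] is the value of [h], in characteristic [p]. *)
Section ListPoly.
Variables (p : N) (h : seq N).

Fixpoint addl (u v : seq N) : seq N :=
  match u, v with
  | x :: u, y :: v => N.add x y :: addl u v
  | [::], v => v
  | u, [::] => u
  end.

Definition scalel (c : N) (v : seq N) : seq N := map (N.mul c) v.

Definition mulx (v : seq N) : seq N :=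
  if size v == size h then addl (belast 0%num v) (scalel (last 0%num v) h) else 0%num :: v.

Definition mull (u v : seq N) : seq N :=
  map (fun x => N.modulo x p) (foldr (fun c acc => addl (scalel c v) (mulx acc)) [::] u).

Definition is_const (c : N) (v : seq N) : bool :=
  if v is x :: s then N.eqb x c && all (N.eqb 0) s else false.

(** Formed by [mulx], so that for [size h = 1] the relation applies at once and [tau] is a constant;
    prime fields are thus treated like the others. *)
Definition gen_elt : seq N := mulx (1%num :: nseq (size h).-1 0%num).

Definition cubic_elt (s : bool) (z : seq N) : seq N :=
  mull z (addl (mull z z) [:: if s then 1%num else N.pred p]).

Definition order_list (z : seq N) (e : positive) (ls : seq positive) : option (seq (seq N)) :=
  match N.div_eucl (Npos e) (Npos (prodp ls)) with
  | (Npos c, N0) =>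
    let (f, ws) := ordlist mull (powp mull z c) ls in
    if is_const 1 f then Some ws else None
  | _ => None
  end.

(* The product of all [w - 1] is invertible. *)
Definition no_ones (e : positive) (ws : seq (seq N)) : bool :=
  is_const 1 (powp mull (foldr (fun w acc => mull (addl w [:: N.pred p]) acc)
    (1%num :: nseq (size h).-1 0%num) ws) e).

(** Checks a list of primes against [e] without factoring: if [e] divides a power of their product,
    every prime divisor of [e] is in the list. The exponent 30 exceeds the multiplicities that
    occur. *)
Definition prime_cover (e : positive) (ls : seq positive) : bool :=
  all prime (map Pos.to_nat ls) && hasdiv (Npos e) (N.pow (Npos (prodp ls)) 30).

Definition ext_card : N := N.pow p (lenN h).
Definition ext_exp : positive := pos_of (N.pred ext_card).
Definition ext_primes : seq positive :=
  rev (map pos_of (odd_primes 3000 3 (strip 40 2 (Npos ext_exp)))).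

(** The powers [tau ^ ((q - 1) / l)] are returned rather than compared with 1, so that a single call
    of [no_ones] can treat them together with those of the cubic. *)
Definition gen_test : option (seq (seq N)) :=
  let ls := ext_primes ++ [:: 2%positive] in
  if [&& prime (N.to_nat p), 0 < size h, N.ltb 1 ext_card & prime_cover ext_exp ls]
  then order_list gen_elt ext_exp ls else None.

(** The cubic must have order [m = (q - 1) / 2], and 2 is a prime divisor of [m] exactly when 4
    divides [q - 1]. *)
Definition point_test (s : bool) : bool :=
  let m := Pos.div2 ext_exp in
  let ls := if hasdiv 4 (Npos ext_exp) then ext_primes ++ [:: 2%positive] else ext_primes in
  if gen_test is Some ws then
    if order_list (cubic_elt s gen_elt) m ls is Some ws' then
      [&& Pos.eqb (Pos.mul 2 m) ext_exp, prime_cover m ls & no_ones ext_exp (ws ++ ws')]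
    else false
  else false.

Definition pow_is_one (e : positive) (w : seq N) (l : positive) : bool :=
  match N.div_eucl (Npos e) (Npos l) with
  | (Npos c, N0) => is_const 1 (powp mull w c)
  | _ => false
  end.

(* Either [z] is not primitive, or [z ^ 3 +- z] is not the square of a primitive
   element. *)
Definition excluded (e : positive) (ls : seq positive) (s : bool) (z : seq N) : bool :=
  [|| has (pow_is_one e z) (ls ++ [:: 2%positive]), is_const 0 (cubic_elt s z),
      is_const (N.pred p) (powp mull (cubic_elt s z) (Pos.div2 e)) |
      has (fun l => Pos.leb 3 l && pow_is_one e (cubic_elt s z) l) (4%positive :: ls)].

Fixpoint all_powers (k : nat) (test : seq N -> bool) (z : seq N) : bool :=
  if k is k.+1 then test z && all_powers k test (mull gen_elt z) else true.

Definition no_point_test (s : bool) : bool :=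
  if gen_test is Some ws then
    [&& Pos.eqb (Pos.mul 2 (Pos.div2 ext_exp)) ext_exp, no_ones ext_exp ws &
        all_powers (Pos.to_nat ext_exp) (excluded ext_exp ext_primes s) (1%num :: nseq (size h).-1 0%num)]
  else false.

End ListPoly.

Definition no_point_cards (s : bool) : seq N :=
  if s then [:: 5; 9; 17; 41; 49]%num else [:: 3; 7; 13; 17; 25; 49; 121]%num.

(* The characteristic, and the relations for the curves with [+ x] and [- x]. *)
Definition entry := (N * seq N * seq N)%type.

Definition entry_card (e : entry) : N := ext_card e.1.1 e.1.2.

Definition entry_test (e : entry) : bool :=
  let: (p, h1, h2) := e in
  let test s h := if memN (ext_card p h) (no_point_cards s) then no_point_test p h s else point_test p h s in
  [&& size h1 == size h2, test true h1 & test false h2].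

Import Order.TTheory GRing.Theory Num.Theory.
Local Open Scope ring_scope.

(** * Character sums over the curve *)

Lemma expf_card_pred (F : finFieldType) (x : F) : x != 0 -> x ^+ #|F|.-1 = 1.
Proof.
move=> x0; apply: (mulfI x0); rewrite mulr1 -exprS prednK ?expf_card //.
by apply/card_gt0P; exists 0.
Qed.

Lemma card_pred_gt0 (F : finFieldType) : (0 < #|F|.-1)%N.
Proof. by have := finNzRing_gt1 F; case: #|F| => [|[]]. Qed.

Lemma primitive_root_exists (F : finFieldType) :
  exists g : F, #|F|.-1.-primitive_root g.
Proof.
have /hasP[g _ gP] : has #|F|.-1.-primitive_root (enum (predC1 (0 : F))); last by exists g.
apply: has_prim_root; rewrite ?card_pred_gt0 ?enum_uniq -?cardE ?cardC1 //.
apply/allP => x; rewrite mem_enum => x0.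
by apply/unity_rootP/expf_card_pred.
Qed.

Lemma primitive_rootN1 (R : idomainType) (x : R) h : (0 < h)%N ->
  h.*2.-primitive_root x -> x ^+ h = -1.
Proof.
move=> h0 px; have : x ^+ h ^+ 2 == 1 by rewrite -exprM muln2 (prim_expr_order px).
rewrite sqrf_eq1 => /orP[|/eqP//]; rewrite -(prim_order_dvd px) => /dvdn_leq -/(_ h0).
by rewrite -addnn -{3}[h]addn0 leq_add2l leqn0 (gtn_eqF h0).
Qed.

Section Characters.

Variables (F : finFieldType) (g : F) (w : algC).
Let n := #|F|.-1.
Hypothesis g_prim : n.-primitive_root g.
Hypothesis w_prim : n.-primitive_root w.

Definition dlog (x : F) : nat := if [pick i : 'I_n | x == g ^+ i] is Some i then i else 0%N.

(** Indices range over all naturals, so that products of characters are sums of indices; the trivial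
    characters are those with [n %| i]. All of them, even the trivial ones, vanish at 0. *)
Definition chi (i : nat) (x : F) : algC := if x == 0 then 0 else w ^+ (i * dlog x).

Let n_gt0 : (0 < n)%N := card_pred_gt0 F.

Lemma dlogK x : x != 0 -> g ^+ dlog x = x.
Proof.
move=> x0; rewrite /dlog; case: pickP => [i /eqP // | no].
have /(prim_rootP g_prim)[i xi] := expf_card_pred x0.
by have := no i; rewrite -xi eqxx.
Qed.

Lemma gen_neq0 k : g ^+ k != 0.
Proof.
apply: expf_neq0; apply/eqP => g0; have := prim_expr_order g_prim.
by rewrite g0 expr0n (gtn_eqF n_gt0) => /esym/eqP; rewrite oner_eq0.
Qed.

Lemma dlogX k : dlog (g ^+ k) = k %[mod n].
Proof. by apply/eqP; rewrite -(eq_prim_root_expr g_prim) dlogK ?gen_neq0. Qed.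

Lemma chi0 i : chi i 0 = 0. Proof. by rewrite /chi eqxx. Qed.

Lemma chiX i k : chi i (g ^+ k) = w ^+ (i * k).
Proof.
rewrite /chi (negPf (gen_neq0 k)); apply/eqP; rewrite (eq_prim_root_expr w_prim).
by rewrite -modnMmr dlogX modnMmr.
Qed.

Lemma chiM i x y : chi i (x * y) = chi i x * chi i y.
Proof.
have [->|x0] := eqVneq x 0; first by rewrite mul0r chi0 mul0r.
have [->|y0] := eqVneq y 0; first by rewrite mulr0 chi0 mulr0.
by rewrite -(dlogK x0) -(dlogK y0) -exprD !chiX mulnDr exprD.
Qed.

Lemma chiD i j x : chi (i + j) x = chi i x * chi j x.
Proof. by rewrite /chi; case: ifP => _; rewrite ?mul0r // mulnDl exprD. Qed.

Lemma chi1 i : chi i 1 = 1.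
Proof. by rewrite -(expr0 g) chiX muln0. Qed.

Lemma chi_triv i x : (n %| i)%N -> chi i x = (x != 0)%:R.
Proof.
move=> ni; rewrite /chi; case: eqP => // _ /=; apply/eqP.
by rewrite -(prim_order_dvd w_prim) dvdn_mulr.
Qed.

Lemma norm_chi i x : `|chi i x| = (x != 0)%:R.
Proof.
rewrite /chi; case: eqP => [|_] /=; first by rewrite normr0.
have /eqP := congr1 Num.norm (prim_expr_order w_prim).
by rewrite normrX normr1 pexpr_eq1 // => /eqP w1; rewrite normrX w1 expr1n.
Qed.

Lemma conj_chi i x : (chi i x)^* = chi i x^-1.
Proof.
have [->|x0] := eqVneq x 0; first by rewrite invr0 chi0 conjC0.
have cx : chi i x != 0 by rewrite -normr_eq0 norm_chi x0 oner_eq0.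
apply: (mulfI cx); rewrite -normCK norm_chi x0 expr1n -chiM divff ?chi1 //.
Qed.

Lemma sum_neq0 (R : zmodType) (f : F -> R) : f 0 = 0 -> \sum_x f x = \sum_(x | x != 0) f x.
Proof. by move=> f0; rewrite (bigD1 0) //= f0 add0r. Qed.

Lemma sum_chi i : \sum_x chi i x = if (n %| i)%N then n%:R else 0.
Proof.
case: ifP => ni.
  rewrite sum_neq0 ?chi0 // (eq_bigr (fun=> 1)) => [|x x0]; last first.
    by rewrite chi_triv // x0.
  by rewrite sumr_const /n -(cardC1 (0 : F)).
have cg : chi i g != 1.
  by rewrite -[g]expr1 chiX muln1 -(prim_order_dvd w_prim) ni.
apply/eqP; have : (chi i g - 1) * \sum_x chi i x == 0.
  rewrite mulrBl mul1r mulr_sumr subr_eq0; apply/eqP.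
  rewrite [RHS](reindex_inj (mulfI (gen_neq0 1))).
  by apply: eq_bigr => x _; rewrite chiM expr1.
by rewrite mulf_eq0 subr_eq0 (negPf cg).
Qed.

(** * Jacobi sums and their square root bound *)

Definition jacobi (i j : nat) (b : F) : algC := \sum_t chi i t * chi j (t + b).

Lemma jacobi_scale i j b : b != 0 -> jacobi i j b = chi i b * chi j b * jacobi i j 1.
Proof.
move=> b0; rewrite /jacobi (reindex_inj (mulfI b0)) mulr_sumr; apply: eq_bigr => t _.
have -> : b * t + b = b * (t + 1) by rewrite mulrDr mulr1.
by rewrite !chiM /=; ring.
Qed.

(** With [c = s + b] the quotient is [1 + (t - s) / c]. Under the convention [0^-1 = 0] this is, for
    [t != s], a bijection of the whole field, so its character sum is 0; the value 1 which it takes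
    at [c = 0] does not occur in the original sum, whence the [- 1]. *)
Lemma sum_chi_quotient j s t : ~~ (n %| j)%N ->
  \sum_b chi j ((t + b) / (s + b)) = (t == s)%:R * #|F|%:R - 1.
Proof.
move=> nj.
rewrite (reindex_inj (addrI (- s))) /=.
under eq_bigr => c _ do rewrite addrA [s + _]addrA subrr add0r.
have q1 : #|F|%:R = n%:R + 1 :> algC.
  by rewrite natr1 /n prednK //; apply/card_gt0P; exists 0.
have [->|ts] := eqVneq t s.
  rewrite mul1r q1 addrK subrr; have <- : \sum_t chi 0 t = n%:R by rewrite sum_chi dvdn0.
  apply: eq_bigr => c _.
  rewrite add0r [chi 0 c]chi_triv //; have [->|c0] := eqVneq c 0; first by rewrite mul0r chi0.
  by rewrite divff // chi1.
rewrite mul0r sub0r.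
transitivity (\sum_c chi j (1 + (t - s) * c^-1) - 1).
  rewrite [in LHS](bigD1 0) //= [in RHS](bigD1 0) //= invr0 !mulr0 chi0 addr0 chi1.
  rewrite add0r [1 + _]addrC addrK; apply: eq_bigr => c c0; congr (chi _ _).
  by rewrite mulrDl divff // [RHS]addrC.
have d0 : t - s != 0 by rewrite subr_eq0.
have inj : injective (fun c : F => 1 + (t - s) * c^-1).
  by move=> c c' /addrI /(mulfI d0) /invr_inj.
transitivity (\sum_u chi j u - 1); last by rewrite sum_chi (negPf nj) sub0r.
by congr (_ - 1); rewrite [RHS](reindex_inj inj).
Qed.

(** Second moment over the shift [b]: the [n] sums with [b != 0] all have the same modulus, and the
    sum of squares over all [b] is [n * q - |sum_t chi i t| ^ 2], obtained by expanding the square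
    and summing over [b] first. *)
Lemma jacobi_bound_nontriv i j : ~~ (n %| j)%N -> `|jacobi i j 1| ^+ 2 <= #|F|%:R.
Proof.
move=> nj; have n0 : 0 < n%:R :> algC by rewrite ltr0n.
rewrite -(ler_pM2l n0).
have -> : n%:R * `|jacobi i j 1| ^+ 2 = \sum_(b | b != 0) `|jacobi i j b| ^+ 2.
  rewrite (eq_bigr (fun=> `|jacobi i j 1| ^+ 2)) => [|b b0]; last first.
    by rewrite jacobi_scale // !normrM !norm_chi b0 !mul1r.
  by rewrite sumr_const /n -(cardC1 (0 : F)) -[RHS]mulr_natl.
apply: (@le_trans _ _ (\sum_b `|jacobi i j b| ^+ 2)).
  by rewrite [leRHS](bigD1 0) //= lerDr exprn_ge0.
have -> : \sum_b `|jacobi i j b| ^+ 2 =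
    n%:R * #|F|%:R - `|\sum_t chi i t| ^+ 2.
  transitivity (\sum_t \sum_s chi i t * chi i s^-1 * \sum_b chi j ((t + b) / (s + b))).
    under eq_bigr => b _ do
      rewrite normCK /jacobi rmorph_sum mulr_suml.
    rewrite exchange_big; apply: eq_bigr => t _ /=.
    under eq_bigr => b _ do rewrite mulr_sumr.
    rewrite exchange_big; apply: eq_bigr => s _ /=.
    rewrite mulr_sumr; apply: eq_bigr => b _.
    by rewrite rmorphM /= !conj_chi chiM; ring.
  have normE : `|\sum_t chi i t| ^+ 2 = \sum_t \sum_s chi i t * chi i s^-1.
    rewrite normCK rmorph_sum mulr_suml; apply: eq_bigr => t _.
    by rewrite mulr_sumr; apply: eq_bigr => s _ /=; rewrite conj_chi.
  have -> : n%:R * #|F|%:R = \sum_t \sum_s chi i t * chi i s^-1 * ((t == s)%:R * #|F|%:R).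
    have <- : \sum_t chi 0 t = n%:R by rewrite sum_chi dvdn0.
    rewrite mulr_suml; apply: eq_bigr => t _.
    rewrite (bigD1 t) //= eqxx mul1r big1 ?addr0 => [|s]; last first.
      by rewrite eq_sym => /negPf ->; rewrite mul0r mulr0.
    have [->|t0] := eqVneq t 0; first by rewrite !chi0 !mul0r.
    by rewrite -chiM divff // chi1 [chi 0 t]chi_triv // t0.
  rewrite normE -sumrB; apply: eq_bigr => t _; rewrite -sumrB; apply: eq_bigr => s _.
  by rewrite sum_chi_quotient // mulrBr mulr1.
by rewrite lerBlDr lerDl exprn_ge0.
Qed.

Let R : algC := sqrtC #|F|%:R.

Lemma sqrt_card_ge0 : 0 <= R. Proof. by rewrite sqrtC_ge0 ler0n. Qed.

Lemma sqrt_cardK : R ^+ 2 = #|F|%:R. Proof. exact: sqrtCK. Qed.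

(** If [chi j] is trivial, the sum at shift 1 is the complete sum of [chi i], which is 0, without
    its term at [t = -1], so it has modulus 1. Otherwise the second moment applies. *)
Lemma jacobi_bound i j b : b != 0 -> ~~ ((n %| i) && (n %| j))%N -> `|jacobi i j b| <= R.
Proof.
move=> b0; rewrite negb_and jacobi_scale // !normrM !norm_chi b0 !mul1r => nij.
rewrite -(@ler_pXn2r _ 2) ?nnegrE ?normr_ge0 ?sqrt_card_ge0 // sqrt_cardK.
have [nj|nj] := boolP (n %| j)%N; last exact: jacobi_bound_nontriv.
have -> : jacobi i j 1 = - chi i (-1).
  have := sum_chi i; rewrite nj orbF in nij; rewrite (negPf nij) => s0.
  rewrite -[RHS]add0r -s0 [in RHS](bigD1 (-1)) //= addrAC subrr add0r.
  rewrite /jacobi (bigD1 (-1)) //= addNr chi0 mulr0 add0r; apply: eq_bigr => t tN1.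
  by rewrite [chi j _]chi_triv // addr_eq0 tN1 mulr1.
rewrite normrN norm_chi oppr_eq0 oner_eq0 expr1n ler1n.
by apply/card_gt0P; exists 0.
Qed.

Hypothesis n_even : ~~ odd n.
Let h := n./2.

Let hh : (h + h)%N = n.
Proof. by rewrite addnn /h halfK (negPf n_even) subn0. Qed.

Let h_gt0 : (0 < h)%N.
Proof. by rewrite -double_gt0 -addnn hh. Qed.

Lemma prim_half : w ^+ h = -1.
Proof. by apply: primitive_rootN1 => //; rewrite -addnn hh. Qed.

Lemma gen_half : g ^+ h = -1.
Proof. by apply: primitive_rootN1 => //; rewrite -addnn hh. Qed.

Lemma chiN1 i : chi i (-1) = (-1) ^+ i.
Proof. by rewrite -gen_half chiX mulnC exprM prim_half. Qed.

Lemma chiN i x : chi i (- x) = (-1) ^+ i * chi i x.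
Proof. by rewrite -[- x]mulN1r chiM chiN1. Qed.

(** The characteristic is odd because [chi 1] takes the value [-1] at [-1], and [-1] differs from
    [1] in [algC]. *)
Lemma neq_opp (x : F) : x != 0 -> x != - x.
Proof.
move=> x0; rewrite -subr_eq0 opprK -[x]mul1r -mulrDl mulf_neq0 // addr_eq0.
apply/eqP => /(congr1 (chi 1)); rewrite chi1 chiN1 expr1 => /eqP.
by rewrite -addr_eq0 -[1 + 1]/(2%:R) pnatr_eq0.
Qed.

Lemma sum_sqrt (t : F) : t != 0 -> \sum_x (x ^+ 2 == t)%:R = 1 + chi h t :> algC.
Proof.
move=> t0; rewrite -(dlogK t0) chiX.
have [k_odd|k_even] := boolP (odd (dlog t)).
  rewrite -[X in w ^+ (h * X)](odd_double_half (dlog t)) k_odd mulnDr muln1 exprD.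
  rewrite prim_half -muln2 mulnA mulnAC muln2 -addnn hh exprM (prim_expr_order w_prim).
  rewrite expr1n mulr1 subrr big1 // => x _; case: eqP => //= xk.
  have x0 : x != 0.
    by apply/eqP => x0; move/eqP: xk; rewrite x0 expr0n eq_sym (negPf (gen_neq0 _)).
  have /eqP := xk; rewrite -(dlogK x0) -exprM (eq_prim_root_expr g_prim) => /eqP e.
  have := odd_mod (dlog t) (negPf n_even); rewrite -e odd_mod ?(negPf n_even) //.
  by rewrite oddM andbF k_odd.
have := odd_double_half (dlog t); rewrite (negPf k_even) add0n => <-.
set u := g ^+ (dlog t)./2; have u0 : u != 0 by apply: gen_neq0.
have uE : g ^+ (dlog t)./2.*2 = u ^+ 2 by rewrite -exprM muln2.
rewrite uE -muln2 mulnCA [(h * 2)%N]muln2 -addnn hh mulnC exprM (prim_expr_order w_prim) expr1n.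
rewrite (bigD1 u) //= eqxx (bigD1 (- u)) /=; last by rewrite eq_sym neq_opp.
rewrite sqrrN eqxx big1 ?addr0 // => x /andP[xu xNu].
by rewrite eqf_sqr (negPf xu) (negPf xNu).
Qed.

(** * Sums over the abscissas and over the points of the curve *)

Section Curve.

Variable a : F.
Hypothesis a_neq0 : a != 0.

Definition cubic (x : F) := x ^+ 3 + a * x.

Lemma cubicE x : cubic x = x * (x ^+ 2 + a).
Proof. by rewrite /cubic; ring. Qed.

(* Replacing [x] by [- x] kills the sums with [i + m] odd; the others are sums over [t = x ^ 2]. *)
Definition xsum i m := \sum_x chi i x * chi m (cubic x).

Lemma xsum_odd i m : odd (i + m) -> xsum i m = 0.
Proof.
move=> im; have : xsum i m = - xsum i m.
  rewrite {1}/xsum (reindex_inj oppr_inj) /xsum -sumrN; apply: eq_bigr => x _.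
  have -> : cubic (- x) = - cubic x by rewrite /cubic; ring.
  by rewrite !chiN mulrACA -exprD -signr_odd im expr1 mulN1r.
by move/eqP; rewrite -subr_eq0 opprK -mulr2n mulrn_eq0 => /eqP.
Qed.

(** As [i + m = 2 r], the summand equals [chi r (x ^ 2) * chi m (x ^ 2 + a)], and each [t != 0] is a
    square in [1 + chi h t] ways. *)
Lemma xsum_even i m r : (i + m = r.*2)%N -> xsum i m = jacobi r m a + jacobi (r + h) m a.
Proof.
move=> imr; rewrite /jacobi -big_split /=.
transitivity (\sum_x \sum_t (x ^+ 2 == t)%:R * (chi r t * chi m (t + a))).
  apply: eq_bigr => x _; rewrite (bigD1 (x ^+ 2)) //= eqxx mul1r big1 ?addr0.
    by rewrite cubicE chiM mulrA -chiD imr -addnn chiD expr2 chiM.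
  by move=> t; rewrite eq_sym => /negPf ->; rewrite mul0r.
rewrite exchange_big; apply: eq_bigr => t _ /=; rewrite -mulr_suml.
have [->|t0] := eqVneq t 0; first by rewrite !chi0 !mul0r mulr0 addr0.
by rewrite sum_sqrt // chiD; ring.
Qed.

(** Neither Jacobi sum is trivial: if [n] divides [m] and one of [r], [r + h], then it divides
    [2 r = i + m] since [2 h = n], hence also [i]. *)
Lemma xsum_bound i m : ~~ ((n %| i) && (n %| m))%N -> `|xsum i m| <= 2 * R.
Proof.
move=> nim; have [o|/negPf e] := boolP (odd (i + m)).
  by rewrite xsum_odd // normr0 mulr_ge0 ?sqrt_card_ge0.
have := odd_double_half (i + m); rewrite e add0n => /esym imr.
rewrite (xsum_even imr) (le_trans (ler_normD _ _)) // mulr_natl mulr2n lerD // jacobi_bound //;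
 apply: contra nim => /andP[nr nm]; rewrite nm andbT -(dvdn_addl _ nm) imr -muln2.
- exact: dvdn_mulr.
- rewrite -(dvdn_addl _ (dvdnn n)) -{2}hh addnn -muln2 -mulnDl; exact: dvdn_mulr.
Qed.

Let dbl_h i : (n %| (i + h).*2)%N = (n %| i.*2)%N.
Proof. by rewrite doubleD -[h.*2]addnn hh dvdn_addl. Qed.

Let dvd_dbl i : (n %| i)%N -> (n %| i.*2)%N.
Proof. by rewrite -muln2; apply: dvdn_mulr. Qed.

(** The weight is a parameter because the same sum is needed with weight 1, with the parity weight
    [w2] and with the sieve weights [wt]. *)
Definition point_sum (W : F -> F -> algC) i j :=
  \sum_(p : F * F | p.2 ^+ 2 == cubic p.1) W p.1 p.2 * chi i p.1 * chi j p.2.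

Notation tsum := (point_sum (fun _ _ => 1)).

Lemma tsum_odd i j : odd j -> tsum i j = 0.
Proof.
move=> oj; have : tsum i j = - tsum i j.
  rewrite /point_sum -sumrN.
  rewrite [LHS](reindex_inj (h := fun p : F * F => (p.1, - p.2))) /=; last first.
    by move=> [x y] [x' y'] [-> /oppr_inj ->].
  by apply: eq_big => [p|p _]; rewrite ?sqrrN // chiN -signr_odd oj; ring.
by move/eqP; rewrite -subr_eq0 opprK -mulr2n mulrn_eq0 => /eqP.
Qed.

(** An even character of [y] depends only on [y ^ 2 = cubic x], a value with [1 + chi h (cubic x)]
    square roots when it is not 0. *)
Lemma tsum_even i m : tsum i m.*2 = xsum i m + xsum i (m + h).
Proof.
transitivity (\sum_x \sum_(y | y ^+ 2 == cubic x) chi i x * chi m.*2 y).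
  by rewrite pair_big_dep /=; apply: eq_bigr => p _; rewrite mul1r.
rewrite -big_split /=; apply: eq_bigr => x _.
transitivity (chi i x * chi m (cubic x) * \sum_y (y ^+ 2 == cubic x)%:R).
  rewrite mulr_sumr big_mkcond; apply: eq_bigr => y _.
  case: eqP => [<-|_]; last by rewrite mulr0.
  by rewrite mulr1 -addnn chiD expr2 chiM.
have [->|c0] := eqVneq (cubic x) 0; first by rewrite !chi0 !mulr0 mul0r addr0.
by rewrite sum_sqrt // chiD; ring.
Qed.

(** A shift of an index by [h] disappears after doubling, so if [j = 2 m] is nontrivial, so are both
    [m] and [m + h]. *)
Lemma tsum_bound i j : ~~ ((n %| i) && (n %| j))%N -> `|tsum i j| <= 4 * R.
Proof.
move=> nij; have [oj|/negPf ej] := boolP (odd j).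
  by rewrite tsum_odd // normr0 mulr_ge0 ?sqrt_card_ge0.
have := odd_double_half j; rewrite ej add0n => jE; rewrite -jE in nij *.
rewrite tsum_even (le_trans (ler_normD _ _)) // -[4]/(2 + 2)%:R natrD mulrDl lerD //.
  by apply: xsum_bound; apply: contra nij => /andP[-> /dvd_dbl ->].
by apply: xsum_bound; apply: contra nij => /andP[-> /dvd_dbl]; rewrite dbl_h.
Qed.

(* On points with nonzero coordinates, the indicator of both being nonsquares. *)
Definition w2 (x y : F) := (1 - chi h x) * (1 - chi h y) / 4.

(** The three cases are [q] congruent to 3 modulo 4, to 5 modulo 8 and to 1 modulo 8. *)
Definition parity_factor := if odd h then 1%N else if odd h./2 then 2%N else 4%N.

Lemma point_sum_w2 i j : point_sum w2 i j =
  (tsum i j - tsum (i + h) j - tsum i (j + h) + tsum (i + h) (j + h)) / 4.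
Proof.
rewrite /point_sum -!sumrB -big_split mulr_suml; apply: eq_bigr => p _ /=.
by rewrite !chiD /w2; field.
Qed.

(** For odd [h] one of [i + m] and [i + m + h] is odd, so one of the two sums over [x] vanishes and
    the bound is halved. *)
Lemma tsum_bound_half i j : odd h -> ~~ ((n %| i) && (n %| j))%N -> `|tsum i j| <= 2 * R.
Proof.
move=> oh nij; have [oj|/negPf ej] := boolP (odd j).
  by rewrite tsum_odd // normr0 mulr_ge0 ?sqrt_card_ge0.
have := odd_double_half j; rewrite ej add0n => jE; rewrite -jE in nij *.
rewrite tsum_even; have [o|e] := boolP (odd (i + j./2)).
  rewrite xsum_odd // add0r; apply: xsum_bound; apply: contra nij => /andP[-> /dvd_dbl].
  by rewrite dbl_h.
rewrite [X in _ + X]xsum_odd ?addr0; last by rewrite addnA oddD oh addbT.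
by apply: xsum_bound; apply: contra nij => /andP[-> /dvd_dbl].
Qed.

Lemma tsum_zero i m : ~~ odd h -> odd (i + m) -> tsum i m.*2 = 0.
Proof.
move=> /negPf eh o; rewrite tsum_even !xsum_odd ?addr0 //.
by rewrite addnA oddD eh addbF.
Qed.

(* Only even twists matter: the parity of [q - 1] modulo 4 and 8 then kills some of the four sums. *)
Lemma point_sum_w2_bound i j : ~~ odd i -> ~~ odd j -> ~~ ((n %| i.*2) && (n %| j.*2))%N ->
  `|point_sum w2 i j| <= parity_factor%:R * R.
Proof.
move=> /negPf ei /negPf ej nij.
have n1 : ~~ ((n %| i) && (n %| j))%N.
  by apply: contra nij => /andP[/dvd_dbl-> /dvd_dbl->].
have n2 : ~~ ((n %| i + h) && (n %| j))%N.
  by apply: contra nij => /andP[/dvd_dbl]; rewrite dbl_h => -> /dvd_dbl->.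
have n3 : ~~ ((n %| i) && (n %| j + h))%N.
  by apply: contra nij => /andP[/dvd_dbl->/dvd_dbl]; rewrite dbl_h => ->.
have n4 : ~~ ((n %| i + h) && (n %| j + h))%N.
  by apply: contra nij => /andP[/dvd_dbl + /dvd_dbl]; rewrite !dbl_h => -> ->.
rewrite point_sum_w2 normrM [X in _ * X]ger0_norm ?invr_ge0 ?ler0n // ler_pdivrMr // /parity_factor.
have R0 := sqrt_card_ge0.
have four (x y z t : algC) c : `|x| <= c -> `|y| <= c -> `|z| <= c -> `|t| <= c ->
    `|x - y - z + t| <= c + c + c + c.
  move=> hx hy hz ht; rewrite (le_trans (ler_normD _ _)) // lerD //.
  rewrite (le_trans (ler_normB _ _)) // lerD //.
  by rewrite (le_trans (ler_normB _ _)) // lerD //.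
have two (x y : algC) c : `|x| <= c -> `|y| <= c -> `|x - y| <= c + c.
  by move=> hx hy; rewrite (le_trans (ler_normB _ _)) // lerD //.
case: ifP => [oh|/negbT eh].
  rewrite [tsum i (j + h)]tsum_odd ?[tsum _ (j + h)]tsum_odd ?oddD ?ej // subr0 addr0.
  apply: le_trans (two _ _ _ (tsum_bound_half oh n1) (tsum_bound_half oh n2)) _.
  by rewrite le_eqVlt; apply/orP; left; apply/eqP; ring.
case: ifP => [oh2|_]; last first.
  apply: le_trans (four _ _ _ _ _ (tsum_bound n1) (tsum_bound n2) (tsum_bound n3) (tsum_bound n4)) _.
  by rewrite le_eqVlt; apply/orP; left; apply/eqP; ring.
have := odd_double_half j; rewrite ej add0n => jE.
have := odd_double_half h; rewrite (negPf eh) add0n => hE.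
have jhE : (j + h = (j./2 + h./2).*2)%N by rewrite doubleD jE hE.
(* Write [j = 2 m]. For odd [m] the two sums at [j] vanish; for even [m] the two at
   [j + h = 2 (m + h / 2)] do, because [h / 2] is odd here. *)
have [oj2|ej2] := boolP (odd j./2).
  rewrite -{1 2}jE !tsum_zero ?oddD ?ei ?(negPf eh) ?oj2 //.
  rewrite subr0 sub0r addrC.
  apply: le_trans (two _ _ _ (tsum_bound n4) (tsum_bound n3)) _.
  by rewrite le_eqVlt; apply/orP; left; apply/eqP; ring.
rewrite jhE [tsum i (_.*2)]tsum_zero ?[tsum (i + h) (_.*2)]tsum_zero ?oddD ?ei ?(negPf eh) ?(negPf ej2) ?oh2 //.
rewrite subr0 addr0.
apply: le_trans (two _ _ _ (tsum_bound n1) (tsum_bound n2)) _.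
by rewrite le_eqVlt; apply/orP; left; apply/eqP; ring.
Qed.

Let n_ndvd_h : (n %| h)%N = false.
Proof.
by apply/negP => /dvdn_leq -/(_ h_gt0); rewrite -hh -{3}[h]addn0 leq_add2l leqn0 (gtn_eqF h_gt0).
Qed.

(** Only [tsum 0 0 = xsum 0 0 + xsum 0 h] contains a main term. In the three classes the remaining
    sums are at most [4 R], [6 R] and [14 R], within the allowance of 4, 8 and 16 times [R] before
    division by 4. *)
Lemma point_sum_w2_main : `|point_sum w2 0 0 - xsum 0 0 / 4| <= parity_factor%:R * R.
Proof.
have R0 := sqrt_card_ge0.
have -> : point_sum w2 0 0 - xsum 0 0 / 4 =
    (xsum 0 h - tsum h 0 - tsum 0 h + tsum h h) / 4.
  by rewrite point_sum_w2 !add0n -[X in tsum 0 X]/(0.*2)%N tsum_even add0n; field.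
rewrite normrM [X in _ * X]ger0_norm ?invr_ge0 ?ler0n // ler_pdivrMr // /parity_factor.
have s0h : `|xsum 0 h| <= 2 * R by apply: xsum_bound; rewrite n_ndvd_h andbF.
have th0 : `|tsum h 0| <= 4 * R by apply: tsum_bound; rewrite n_ndvd_h.
case: ifP => [oh|/negbT eh].
  rewrite xsum_odd ?add0n // [tsum 0 h]tsum_odd // [tsum h h]tsum_odd // subr0 addr0 sub0r normrN mul1r.
  by rewrite mulrC.
case: ifP => [oh2|_].
  have := odd_double_half h; rewrite (negPf eh) add0n => hE.
  have -> : tsum 0 h = 0 by rewrite -{1}hE tsum_zero.
  have -> : tsum h h = 0 by rewrite -{2}hE tsum_zero // oddD (negPf eh).
  rewrite subr0 addr0 (le_trans (ler_normB _ _)) //.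
  apply: le_trans (lerD s0h th0) _; rewrite -subr_ge0.
  by have -> : 2%:R * R * 4 - (2 * R + 4 * R) = 2 * R by [ring]; rewrite mulr_ge0.
have t0h : `|tsum 0 h| <= 4 * R by apply: tsum_bound; rewrite n_ndvd_h andbF.
have thh : `|tsum h h| <= 4 * R by apply: tsum_bound; rewrite n_ndvd_h andbF.
rewrite (le_trans (ler_normD _ _)) //.
apply: (@le_trans _ _ (2 * R + 4 * R + 4 * R + 4 * R)).
  rewrite lerD // (le_trans (ler_normB _ _)) // lerD //.
  by rewrite (le_trans (ler_normB _ _)) // lerD.
by rewrite -subr_ge0; have -> : 4%:R * R * 4 - (2 * R + 4 * R + 4 * R + 4 * R) = 2 * R by [ring]; rewrite mulr_ge0.
Qed.

(** The three lost abscissas are 0 and the at most two roots of [x ^ 2 = - a]. *)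
Lemma xsum_main : #|F|%:R - 3 <= xsum 0 0.
Proof.
rewrite lerBlDr.
have -> : #|F|%:R = \sum_(x : F) 1 :> algC by rewrite sumr_const.
apply: (@le_trans _ _ (xsum 0 0 + \sum_x ((x == 0)%:R + (x ^+ 2 == - a)%:R))).
  rewrite /xsum -big_split /=; apply: ler_sum => x _; rewrite !chi_triv // cubicE mulf_eq0.
  rewrite addr_eq0; case: eqP => _ /=; case: eqP => _ /=; rewrite ?(mul0r, mulr0, mulr1, add0r, addr0) ?lexx ?lerDl ?lerDr ?ler01 //.
rewrite lerD2l big_split /= (bigD1 0) //= eqxx big1 ?addr0 => [|x /negPf -> //].
rewrite -[3]/(1 + 2)%:R natrD lerD2l.
rewrite -[leLHS]ger0_norm ?sumr_ge0 // sum_sqrt ?oppr_eq0 //.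
by rewrite (le_trans (ler_normD _ _)) // normr1 norm_chi oppr_eq0 a_neq0 -[2]/(1 + 1)%:R natrD.
Qed.

(* For [x != 0], the indicator of the [l]-th powers, by orthogonality of characters. *)
Definition power_ind (l : nat) (x : F) : algC := (\sum_(k < l) chi (k * (n %/ l)) x) / l%:R.

Lemma power_indE l x : (0 < l)%N -> (l %| n)%N -> x != 0 -> power_ind l x = (l %| dlog x)%:R.
Proof.
move=> l0 ln x0; rewrite /power_ind -{1}(dlogK x0).
under eq_bigr => k _ do rewrite chiX -mulnA mulnC exprM.
set z := w ^+ _.
have z1 : (z == 1) = (l %| dlog x)%N.
  rewrite -(prim_order_dvd w_prim) -{1}(divnK ln) dvdn_pmul2l //.
  by rewrite divn_gt0 // dvdn_leq.
have zl : z ^+ l = 1.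
  by rewrite -exprM mulnAC divnK // exprM (prim_expr_order w_prim) expr1n.
have lC : l%:R != 0 :> algC by rewrite pnatr_eq0 -lt0n.
rewrite -z1; have [->|z_neq1] := eqVneq z 1.
  by under eq_bigr => k _ do rewrite expr1n; rewrite sumr_const card_ord divff.
apply/eqP; rewrite mulf_eq0; apply/orP; left.
by rewrite -(mulrI_eq0 _ (mulfI (_ : z - 1 != 0))) ?subr_eq0 // -subrX1 zl subrr.
Qed.

(* [(true, l)]: the abscissa is not an [l]-th power; [(false, l)]: the ordinate is not. *)
Definition cond := (bool * nat)%type.

Definition cind (c : cond) (x y : F) := power_ind c.2 (if c.1 then x else y).

Definition wt (cs : seq cond) (x y : F) := w2 x y * \prod_(c <- cs) (1 - cind c x y).

(** The indicator of [l]-th powers expands into [l] characters; the boolean [c.1], read as 0 or 1,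
    selects the coordinate whose index they shift. *)
Lemma point_sum_cons c cs i j : (0 < c.2)%N ->
  point_sum (wt (c :: cs)) i j = point_sum (wt cs) i j -
   (\sum_(k < c.2) point_sum (wt cs) (i + c.1 * (k * (n %/ c.2))) (j + ~~ c.1 * (k * (n %/ c.2)))) / c.2%:R.
Proof.
move=> c0; rewrite /point_sum exchange_big /= mulr_suml -sumrB; apply: eq_bigr => p _.
rewrite /wt big_cons /cind /power_ind; set P := \prod_(_ <- _) _.
transitivity (w2 p.1 p.2 * P * chi i p.1 * chi j p.2 -
  w2 p.1 p.2 * P * chi i p.1 * chi j p.2 * ((\sum_(k < c.2) chi (k * (n %/ c.2)) (if c.1 then p.1 else p.2)) / c.2%:R)).
  by ring.
congr (_ - _); rewrite mulrA mulr_sumr; congr (_ / _); apply: eq_bigr => k _.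
case: c.1; rewrite ?mul1n ?mul0n addn0 chiD; ring.
Qed.

Definition theta (cs : seq cond) : algC := \prod_(c <- cs) (1 - c.2%:R^-1).

(** Multiplying an index by this number annihilates every twist that the conditions of [cs] on that
    coordinate can introduce. *)
Definition side (b : bool) (cs : seq cond) := (\prod_(c <- cs | c.1 == b) c.2)%N.

Definition good_cond (c : cond) := [&& prime c.2, odd c.2 & c.2 %| n]%N.

Lemma side_cons b c cs : side b (c :: cs) = ((if c.1 == b then c.2 else 1) * side b cs)%N.
Proof. by rewrite /side big_cons; case: ifP; rewrite ?mul1n. Qed.

Lemma even_twist l k : odd l -> (l %| n)%N -> odd (k * (n %/ l)) = false.
Proof.
move=> ol ln; apply/negbTE; apply: contra n_even; rewrite -{2}(divnK ln) !oddM ol andbT.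
by case/andP.
Qed.

Lemma theta_ge0 cs : all good_cond cs -> 0 <= theta cs.
Proof.
elim: cs => [|c cs IH] /=; first by rewrite /theta big_nil ler01.
case/andP=> /and3P[cp _ _] /IH t0; rewrite /theta big_cons mulr_ge0 // subr_ge0.
by rewrite invf_le1 ?ler1n ?ltr0n prime_gt0.
Qed.

Let inv1 (l : nat) : prime l -> 0 <= 1 - l%:R^-1 :> algC.
Proof. by move=> cp; rewrite subr_ge0 invf_le1 ?ler1n ?ltr0n prime_gt0. Qed.

Lemma twist_sum_bound (l : nat) (f : nat -> algC) (B : algC) : prime l ->
  (forall k, (0 < k < l)%N -> `|f k| <= B) ->
  `|(\sum_(1 <= k < l) f k) / l%:R| <= (1 - l%:R^-1) * B.
Proof.
move=> lp fB; have l0 : 0 < l%:R :> algC by rewrite ltr0n prime_gt0.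
rewrite normrM [X in _ * X]ger0_norm ?invr_ge0 ?ler0n // ler_pdivrMr //.
apply: le_trans (ler_norm_sum _ _ _) _.
apply: (@le_trans _ _ (\sum_(1 <= k < l) B)).
  by rewrite !big_nat; apply: ler_sum => k; apply: fB.
rewrite sumr_const_nat -[leLHS]mulr_natl natrB ?prime_gt0 // le_eqVlt; apply/orP; left; apply/eqP.
by field; rewrite lt0r_neq0.
Qed.

(** Each condition multiplies the bound by [2 (1 - 1 / l)]: the term [k = 0] merges with the
    untwisted sum into [1 - 1 / l] times it, and the other [l - 1] twists, divided by [l],
    contribute as much again. Nontriviality is assumed after multiplication by [side] and doubling,
    so that it survives the twists of [cs] and the shifts by [h]. *)
Lemma point_sum_twist_bound cs i j : all good_cond cs -> ~~ odd i -> ~~ odd j ->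
  ~~ ((n %| (side true cs * i).*2) && (n %| (side false cs * j).*2))%N ->
  `|point_sum (wt cs) i j| <= parity_factor%:R * R * (2 ^+ size cs * theta cs).
Proof.
elim: cs i j => [|c cs IH] i j /=.
  move=> _ ei ej; rewrite /side !big_nil !mul1n => nij.
  rewrite /theta big_nil expr0 !mulr1.
  rewrite (_ : point_sum _ i j = point_sum w2 i j) ?point_sum_w2_bound //.
  by apply: eq_bigr => p _; rewrite /wt big_nil mulr1.
case/andP=> /and3P[cp co cn] gcs ei ej nij.
have c0 := prime_gt0 cp.
have key k : `|point_sum (wt cs) (i + c.1 * (k * (n %/ c.2))) (j + ~~ c.1 * (k * (n %/ c.2)))|
    <= parity_factor%:R * R * (2 ^+ size cs * theta cs).
  apply: IH => //.
  - by rewrite oddD (negPf ei) oddM even_twist // andbF.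
  - by rewrite oddD (negPf ej) oddM even_twist // andbF.
  apply: contra nij; rewrite !side_cons.
  (* Multiplication by [c.2] turns the twist [k * (n %/ c.2)] into a multiple of [n]. *)
  have tw m t : (n %| (m * (t + k * (n %/ c.2))).*2 -> n %| (c.2 * m * t).*2)%N.
    move=> d; rewrite -(@dvdn_addl (m * k * n).*2); last first.
      by rewrite -muln2 mulnAC dvdn_mull.
    rewrite -doubleD (_ : (_ + _)%N = (c.2 * (m * (t + k * (n %/ c.2))))%N).
      by rewrite -muln2 -mulnA dvdn_mull // muln2.
    by rewrite -{1}(divnK cn); ring.
  have up m t : (n %| (m * (t + 0)).*2 -> n %| (m * t).*2)%N by rewrite addn0.
  case: c.1 => /=; rewrite ?mul1n ?mul0n => /andP[A B]; apply/andP; split.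
  - exact: tw. - exact: up. - exact: up. - exact: tw.
rewrite point_sum_cons // -(big_mkord xpredT (fun k => point_sum (wt cs) (i + c.1 * (k * (n %/ c.2))) (j + ~~ c.1 * (k * (n %/ c.2))))).
rewrite big_ltn // mul0n !muln0 !addn0 mulrDl opprD addrA.
have cC : c.2%:R != 0 :> algC by rewrite pnatr_eq0 -lt0n.
apply: le_trans (ler_normB _ _) _.
apply: le_trans (lerD (_ : _ <= (1 - c.2%:R^-1) * (parity_factor%:R * R * (2 ^+ size cs * theta cs))) (twist_sum_bound cp (fun k _ => key k))) _.
  rewrite -{1}[point_sum _ i j]mulr1 [_ / _]mulrC [_ * 1]mulrC -mulrBl normrM ger0_norm ?inv1 //.
  apply: ler_wpM2l; first exact: inv1.
  by have := key 0; rewrite mul0n !muln0 !addn0.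
rewrite /theta big_cons exprS le_eqVlt; apply/orP; left; apply/eqP; ring.
Qed.

Lemma side_coprime b l cs : prime l -> all good_cond cs -> (b, l) \notin cs ->
  ~~ (l %| side b cs)%N.
Proof.
move=> lp; elim: cs => [|c cs IH] /=.
  by rewrite /side big_nil dvdn1 => _ _; case: l lp => [|[]].
case/andP=> /and3P[cp _ _] gcs; rewrite in_cons negb_or => /andP[lc lcs].
rewrite side_cons Euclid_dvdM // negb_or IH // andbT.
case: eqP => [cb|_]; last by rewrite dvdn1; case: l lp {IH lc lcs} => [|[]].
rewrite dvdn_prime2 //; apply: contra lc => /eqP ->.
by rewrite -cb; case: c {cp cb}.
Qed.

(** The index [k * (n %/ l)] belongs to a character of order [l], and the prime [l] divides neither
    2 nor the product of the other primes on the same coordinate. *)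
Lemma twist_nontriv b l k cs : good_cond (b, l) -> all good_cond cs -> (b, l) \notin cs ->
  (0 < k < l)%N -> ~~ (n %| (side b cs * (k * (n %/ l))).*2)%N.
Proof.
case/and3P=> /= lp lo ln gcs lcs /andP[k0 kl].
have l0 := prime_gt0 lp.
have -> : (side b cs * (k * (n %/ l))).*2 = (2 * side b cs * k * (n %/ l))%N by rewrite -muln2; ring.
rewrite -{1}(divnK ln) [X in (X %| _)%N]mulnC.
rewrite dvdn_pmul2r ?divn_gt0 ?(dvdn_leq n_gt0) //.
rewrite !Euclid_dvdM // !negb_or side_coprime // (gtnNdvd k0 kl) !andbT.
by rewrite dvdn_prime2 //; case: eqP lo => // ->.
Qed.

Lemma core_twist_bound c cs k : good_cond c -> all good_cond cs -> c \notin cs ->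
  (0 < k < c.2)%N ->
  `|point_sum (wt cs) (0 + c.1 * (k * (n %/ c.2))) (0 + ~~ c.1 * (k * (n %/ c.2)))|
    <= parity_factor%:R * R * (2 ^+ size cs * theta cs).
Proof.
case: c => b l gc gcs ccs kl; have /and3P[lp lo ln] := gc.
have := twist_nontriv gc gcs ccs kl => tw.
apply: point_sum_twist_bound => //; rewrite ?add0n.
- by rewrite oddM even_twist // andbF.
- by rewrite oddM even_twist // andbF.
rewrite negb_and; by case: (b) tw => /= tw; rewrite !mul1n tw ?orbT.
Qed.

(** Compared with the twisted bound, one [theta cs] is saved because the term with all twists
    trivial is kept exactly, as [theta cs * point_sum w2 0 0]. *)
Lemma point_sum_main cs : all good_cond cs -> uniq cs ->
  `|point_sum (wt cs) 0 0 - theta cs * point_sum w2 0 0| <= parity_factor%:R * R * (2 ^+ size cs * theta cs - theta cs).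
Proof.
elim: cs => [|c cs IH] /=.
  move=> _ _; rewrite /theta big_nil expr0 !mul1r subrr mulr0.
  rewrite (_ : point_sum _ 0 0 = point_sum w2 0 0) ?subrr ?normr0 //.
  by apply: eq_bigr => p _; rewrite /wt big_nil mulr1.
case/andP=> gc gcs /andP[ccs ucs]; have /and3P[cp co cn] := gc.
have c0 := prime_gt0 cp; have cC : c.2%:R != 0 :> algC by rewrite pnatr_eq0 -lt0n.
rewrite point_sum_cons // -(big_mkord xpredT (fun k => point_sum (wt cs) (0 + c.1 * (k * (n %/ c.2))) (0 + ~~ c.1 * (k * (n %/ c.2))))).
rewrite big_ltn // mul0n !muln0 !addn0.
rewrite /theta big_cons -/(theta cs); set X := point_sum (wt cs) 0 0; set S := \sum_(_ <= _ < _) _.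
have -> : X - (X + S) / c.2%:R - (1 - c.2%:R^-1) * theta cs * point_sum w2 0 0 =
  (1 - c.2%:R^-1) * (X - theta cs * point_sum w2 0 0) - S / c.2%:R by ring.
apply: le_trans (ler_normB _ _) _.
have tw := twist_sum_bound cp (fun k kl => core_twist_bound gc gcs ccs kl).
apply: le_trans (lerD (_ : _ <= (1 - c.2%:R^-1) * (parity_factor%:R * R * (2 ^+ size cs * theta cs - theta cs))) tw) _.
  rewrite normrM ger0_norm ?inv1 //; apply: ler_wpM2l; first exact: inv1.
  exact: IH.
by rewrite exprS le_eqVlt; apply/orP; left; apply/eqP; ring.
Qed.

Lemma w2E x y : x != 0 -> y != 0 -> w2 x y = ((odd (dlog x)) && (odd (dlog y)))%:R.
Proof.
have half z : z != 0 -> 1 - chi h z = 2 * (odd (dlog z))%:R.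
  move=> z0; rewrite -{1}(dlogK z0) chiX exprM prim_half -signr_odd.
  by case: (odd _); rewrite ?expr1 ?expr0 ?opprK ?mulr1 ?mulr0 ?subrr.
move=> x0 y0; rewrite /w2 !half //.
by case: (odd (dlog x)); case: (odd (dlog y)); rewrite /= ?(mulr0, mul0r, mulr1) //; field.
Qed.

Definition condb (c : cond) (x y : F) := ~~ (c.2 %| dlog (if c.1 then x else y))%N.

Lemma wtE cs x y : all good_cond cs -> x != 0 -> y != 0 ->
  wt cs x y = [&& odd (dlog x), odd (dlog y) & all (fun c => condb c x y) cs]%:R.
Proof.
move=> gcs x0 y0; rewrite /wt w2E // andbA -[in RHS]mulnb natrM; congr (_ * _).
elim: cs gcs => [|c cs IH] /=; first by rewrite big_nil.
case/andP=> /and3P[cp _ cn] gcs; rewrite big_cons IH // -mulnb natrM; congr (_ * _).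
rewrite /cind power_indE ?prime_gt0 //; last by case: ifP.
by rewrite /condb; case: (_ %| _)%N; rewrite ?subrr ?subr0.
Qed.

(** * The sieve inequality *)

Definition all_conds (s : seq nat) : seq cond := [seq (true, l) | l <- s] ++ [seq (false, l) | l <- s].

Lemma all_conds_good s : all good_cond (all_conds s) = all (fun l => [&& prime l, odd l & l %| n]%N) s.
Proof. by rewrite all_cat !all_map andbb. Qed.

Lemma all_conds_uniq s : uniq (all_conds s) = uniq s.
Proof.
rewrite /all_conds cat_uniq !map_inj_uniq; try by move=> ? ? [].
rewrite (_ : has _ _ = false) /= ?andbb //.
by apply/hasP => -[c /mapP[l _ ->] /mapP[]].
Qed.

Lemma point_sumE cs : all good_cond cs -> point_sum (wt cs) 0 0 =
  \sum_(p : F * F | (p.2 ^+ 2 == cubic p.1) && ((p.1 != 0) && (p.2 != 0)))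
    [&& odd (dlog p.1), odd (dlog p.2) & all (fun c => condb c p.1 p.2) cs]%:R.
Proof.
move=> gcs; rewrite /point_sum big_mkcondr; apply: eq_bigr => p _.
rewrite !chi_triv // -mulrA -natrM mulnb; case: ifP => pp; last by rewrite mulr0.
by rewrite mulr1 wtE //; case/andP: pp.
Qed.

Definition no_power_point (s : seq nat) := forall x y, y ^+ 2 = cubic x -> x != 0 -> y != 0 ->
  odd (dlog x) -> odd (dlog y) -> exists2 l, l \in s & (l %| dlog x)%N || (l %| dlog y)%N.

Lemma point_sum_ind cs c : all good_cond cs -> good_cond c -> 
  (\sum_(k < c.2) point_sum (wt cs) (0 + c.1 * (k * (n %/ c.2))) (0 + ~~ c.1 * (k * (n %/ c.2)))) / c.2%:R =
  \sum_(p : F * F | (p.2 ^+ 2 == cubic p.1) && ((p.1 != 0) && (p.2 != 0)))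
    [&& odd (dlog p.1), odd (dlog p.2), all (fun c => condb c p.1 p.2) cs & ~~ condb c p.1 p.2]%:R.
Proof.
move=> gcs gc; have /and3P[cp _ _] := gc.
have := point_sum_cons cs 0 0 (prime_gt0 cp) => /eqP; rewrite eq_sym subr_eq addrC -subr_eq => /eqP <-.
rewrite !point_sumE /= ?gc // -sumrB; apply: eq_bigr => p _.
by case: (odd _); case: (odd _); case: (condb _ _ _); case: (all _ _); rewrite /= ?subrr ?subr0.
Qed.

(** Without a good point, every point that satisfies the core conditions violates a condition at
    some remaining prime in one coordinate, so it is counted at least once on the right. *)
Lemma sieve_ineq (core rest : seq nat) :
  all (fun l => [&& prime l, odd l & l %| n]%N) (core ++ rest) -> uniq (core ++ rest) ->
  no_power_point (core ++ rest) ->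
  point_sum (wt (all_conds core)) 0 0 <= \sum_(c <- all_conds rest)
    (\sum_(k < c.2) point_sum (wt (all_conds core)) (0 + c.1 * (k * (n %/ c.2))) (0 + ~~ c.1 * (k * (n %/ c.2)))) / c.2%:R.
Proof.
rewrite all_cat => /andP[gcore grest] _ nop.
have gc : all good_cond (all_conds core) by rewrite all_conds_good.
have gr : all good_cond (all_conds rest) by rewrite all_conds_good.
rewrite point_sumE // (eq_big_seq _ (fun c cr => point_sum_ind gc (allP gr c cr))) exchange_big /=.
apply: ler_sum => p /andP[/eqP pC /andP[x0 y0]].
case: (boolP (odd _)) => ox; last by rewrite sumr_ge0.
case: (boolP (odd _)) => oy; last by rewrite sumr_ge0.
case: (boolP (all _ _)) => al /=; last by rewrite sumr_ge0.
have [l] := nop _ _ pC x0 y0 ox oy.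
rewrite mem_cat => /orP[lc|lr] ldvd.
  have := allP al; rewrite /all_conds => al'; exfalso; case/orP: ldvd => ld.
    have := al' (true, l); rewrite mem_cat map_f // => /(_ isT).
    by rewrite /condb ld.
  have := al' (false, l); rewrite mem_cat (map_f _ lc) orbT => /(_ isT).
  by rewrite /condb ld.
have key c : c \in all_conds rest -> ~~ condb c p.1 p.2 ->
  1 <= \sum_(c <- all_conds rest) (~~ condb c p.1 p.2)%:R :> algC.
  by move=> cr cc; rewrite (big_rem c) //= cc lerDl sumr_ge0.
case/orP: ldvd => ld; [apply: (key (true, l)) | apply: (key (false, l))];
  rewrite ?mem_cat ?(map_f _ lr) ?orbT /condb //= ?ld //.
Qed.

(** Let [P] be the core count. A condition at a remaining prime [l] fails for [P / l + E c] of these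
    points, where the trivial twist gives [P / l]. With two conditions per prime, the terms [P / l]
    add up to [2 sg P] and move to the left; the errors [E c] are sums over nontrivial twists. The
    density [T] is a common positive factor and cancels. *)
Lemma sieve_bound (core rest : seq nat) (sg : algC) :
  all (fun l => [&& prime l, odd l & l %| n]%N) (core ++ rest) -> uniq (core ++ rest) ->
  no_power_point (core ++ rest) ->
  \sum_(l <- rest) l%:R^-1 = sg -> sg < 2^-1 ->
  (1 - 2 * sg) * (#|F|%:R - 3 - 4 * (parity_factor%:R * R * 4 ^+ size core)) <=
  8 * ((size rest)%:R - sg) * (parity_factor%:R * R * 4 ^+ size core).
Proof.
move=> gcr ucr nop sgE sg2; have := sieve_ineq gcr ucr nop.
move: gcr ucr; rewrite all_cat cat_uniq => /andP[gcore grest] /and3P[ucore disj urest].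
have gc : all good_cond (all_conds core) by rewrite all_conds_good.
have gr : all good_cond (all_conds rest) by rewrite all_conds_good.
set P := point_sum (wt _) 0 0.
set T := theta (all_conds core); set K := parity_factor%:R * R.
have szE : size (all_conds core) = (2 * size core)%N by rewrite size_cat !size_map addnn mul2n.
have T0 : 0 < T.
  rewrite /T /theta; elim: (all_conds core) gc => [|c cs IH] /=; first by rewrite big_nil ltr01.
  case/andP=> /and3P[cp _ _] gcs; rewrite big_cons mulr_gt0 ?IH // subr_gt0.
  by rewrite invf_lt1 ?ltr1n ?ltr0n ?prime_gt0 ?prime_gt1.
set B := K * 4 ^+ size core.
have pow4 : 2 ^+ size (all_conds core) = 4 ^+ size core :> algC.
  by rewrite szE exprM; congr (_ ^+ _); rewrite -natrX.
have Preal cs : all good_cond cs -> 0 <= point_sum (wt cs) 0 0.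
  by move=> gcs; rewrite point_sumE // sumr_ge0.
have N2E : point_sum w2 0 0 = point_sum (wt [::]) 0 0.
  by apply: eq_bigr => p _; rewrite /wt big_nil mulr1.
(* Two errors add up: [T K] from the comparison with [xsum 0 0], and [K (4 ^ k T - T)] from the core
   conditions, with [k] the size of the core. Together they are exactly [T B]. *)
have Plow : T * ((#|F|%:R - 3) / 4 - B) <= P.
  have X0 := xsum_main.
  have q3 : (#|F|%:R - 3 : algC) \is Num.real by rewrite rpredB ?realn.
  have Xr : xsum 0 0 \is Num.real by rewrite (ger_real X0).
  have N2r : point_sum w2 0 0 \is Num.real by rewrite N2E ger0_real // Preal.
  have := real_lerNnormlW _ point_sum_w2_main; rewrite rpredB ?rpredM ?rpredV ?realn // => /(_ isT) h1.
  have := point_sum_main gc; rewrite all_conds_uniq ucore => /(_ isT) h2.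
  have := real_lerNnormlW _ h2; rewrite rpredB ?rpredM ?N2r ?ger0_real ?Preal ?theta_ge0 // => /(_ isT).
  rewrite -/T -/P pow4 -/K lerBrDr => h3; apply: le_trans h3.
  have h4 : (#|F|%:R - 3) / 4 - K <= point_sum w2 0 0.
    move: h1; rewrite lerBrDr => h1; apply: le_trans h1.
    by rewrite addrC lerD2l ler_pM2r // invr_gt0 ltr0n.
  apply: le_trans (_ : - (K * (4 ^+ size core * T - T)) + T * ((#|F|%:R - 3) / 4 - K) <= _).
    by rewrite le_eqVlt; apply/orP; left; apply/eqP; rewrite /B; ring.
  by rewrite lerD2l ler_pM2l.
pose E (c : cond) := (\sum_(1 <= k < c.2) point_sum (wt (all_conds core)) (0 + c.1 * (k * (n %/ c.2))) (0 + ~~ c.1 * (k * (n %/ c.2)))) / c.2%:R.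
have EB c : c \in all_conds rest -> `|E c| <= (1 - c.2%:R^-1) * (B * T).
  move=> cr; have gcc := allP gr c cr; have /and3P[cp _ _] := gcc.
  rewrite /B -mulrA -pow4; apply: twist_sum_bound => // k kl.
  apply: core_twist_bound => //.
  move: cr; rewrite mem_cat => /orP[] /mapP[l lr ->]; rewrite mem_cat negb_or;
   apply/andP; split; apply/mapP => -[m mc] // [lm];
   by move/hasPn: disj => /(_ l lr); rewrite /= lm mc.
have sumc (f : nat -> algC) : \sum_(c <- all_conds rest) f c.2 = 2 * \sum_(l <- rest) f l.
  by rewrite /all_conds big_cat !big_map /= mulr_natl.
move=> hP.
have hP2 : P * (1 - 2 * sg) <= \sum_(c <- all_conds rest) E c.
  rewrite mulrBr mulr1 lerBlDr (le_trans hP) // -sgE -(sumc (fun l => l%:R^-1)) mulr_sumr -big_split /=.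
  rewrite le_eqVlt; apply/orP; left; apply/eqP.
  rewrite big_seq [RHS]big_seq; apply: eq_bigr => c cr.
  have /and3P[cp _ _] := allP gr c cr.
  rewrite -(big_mkord xpredT (fun k => point_sum (wt (all_conds core)) (0 + c.1 * (k * (n %/ c.2))) (0 + ~~ c.1 * (k * (n %/ c.2))))).
  by rewrite big_ltn ?prime_gt0 // mul0n !muln0 !addn0 mulrDl addrC.
have s1 : 0 < 1 - 2 * sg by rewrite subr_gt0 mulrC -ltr_pdivlMr // mul1r.
have hE : P * (1 - 2 * sg) <= 2 * ((size rest)%:R - sg) * (B * T).
  (* The order of [algC] is partial; lying above a nonnegative number makes the sum of the [E c]
     real and equal to its modulus, to which the triangle inequality applies. *)
  apply: (le_trans hP2); have E0 : 0 <= \sum_(c <- all_conds rest) E c.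
    by apply: (le_trans _ hP2); rewrite mulr_ge0 ?Preal // ltW.
  rewrite -(ger0_norm E0); apply: le_trans (ler_norm_sum _ _ _) _.
  apply: (@le_trans _ _ (\sum_(c <- all_conds rest) (1 - c.2%:R^-1) * (B * T))).
    by rewrite big_seq [leRHS]big_seq; apply: ler_sum => c; apply: EB.
  rewrite -mulr_suml (sumc (fun l => 1 - l%:R^-1)) sumrB sgE.
  by rewrite big_const_seq count_predT iter_addr_0.
have : T * ((1 - 2 * sg) * ((#|F|%:R - 3) / 4 - B)) <= T * (2 * ((size rest)%:R - sg) * B).
  rewrite mulrCA -[leRHS]mulrC -[leRHS]mulrA; apply: le_trans hE.
  by rewrite [leRHS]mulrC ler_pM2l.
rewrite ler_pM2l // => fin; rewrite -(ler_pM2l (_ : 0 < 4^-1)) ?invr_gt0 ?ltr0n //.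
apply: le_trans (_ : (1 - 2 * sg) * ((#|F|%:R - 3) / 4 - B) <= _).
  by rewrite le_eqVlt; apply/orP; left; apply/eqP; field.
by apply: le_trans fin _; rewrite le_eqVlt; apply/orP; left; apply/eqP; field.
Qed.

End Curve.
End Characters.

(** * The sieve *)

Lemma primitive_eltP (F : finFieldType) (x : F) :
  #|F|.-1.-primitive_root x -> primitive_elt x.
Proof.
move=> px; have n0 := card_pred_gt0 F; split.
  apply/eqP => x0; have := prim_expr_order px.
  by rewrite x0 expr0n (gtn_eqF n0) => /esym/eqP; rewrite oner_eq0.
move=> y y0; have /(prim_rootP px)[i ->] := expf_card_pred y0.
by exists i.
Qed.

Lemma coprime_primes n e : (0 < n)%N ->
  (forall l, prime l -> l %| n -> ~~ (l %| e))%N -> coprime e n.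
Proof.
move=> n0 nol; rewrite /coprime; apply: contraT => g1.
have g0 : (0 < gcdn e n)%N by rewrite gcdn_gt0 n0 orbT.
have lp : prime (pdiv (gcdn e n)) by rewrite pdiv_prime // ltn_neqAle eq_sym g1.
have := nol _ lp (dvdn_trans (pdiv_dvd _) (dvdn_gcdr _ _)).
by rewrite (dvdn_trans (pdiv_dvd _) (dvdn_gcdl _ _)).
Qed.

Section Sieve.

Variables (F : finFieldType) (a : F).
Hypotheses (a0 : a != 0) (q_odd : odd #|F|).
Let n := #|F|.-1.
Let q := #|F|.

Let n0 : (0 < n)%N := card_pred_gt0 F.
Let nE : n.+1 = q. Proof. by rewrite /n prednK //; apply/card_gt0P; exists 0. Qed.
Let n_even : ~~ odd n. Proof. by have := q_odd; rewrite -/q -nE. Qed.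

Variables (core rest : seq nat).
Hypothesis good : all (fun l => [&& prime l, odd l & l %| n]%N) (core ++ rest).
Hypothesis uniq_cr : uniq (core ++ rest).
Hypothesis complete : forall l, prime l -> odd l -> (l %| n)%N -> l \in core ++ rest.

Lemma primitive_point_or_none (g : F) (w : algC) : n.-primitive_root g ->
  has_primitive_point a \/ no_power_point g a (core ++ rest).
Proof.
move=> gP; pose bad x y := [|| ~~ odd (dlog g x), ~~ odd (dlog g y) |
  has (fun l => (l %| dlog g x) || (l %| dlog g y))%N (core ++ rest)].
have [/existsP[[x y]] | /existsPn none] :=
  boolP [exists p : F * F, [&& p.2 ^+ 2 == cubic a p.1, p.1 != 0, p.2 != 0 & ~~ bad p.1 p.2]]; last first.
  right=> x y e x0 y0 ox oy; have := none (x, y).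
  by rewrite /= e eqxx x0 y0 /bad ox oy /= negbK => /hasP[l ls ld]; exists l.
case/and4P=> /= /eqP e x0 y0; rewrite /bad !negb_or !negbK => /and3P[ox oy /hasPn nol]; left.
exists x, y; split; first by rewrite e /cubic.
have prim z : z != 0 -> odd (dlog g z) -> {in core ++ rest, forall l, ~~ (l %| dlog g z)}%N -> primitive_elt z.
  move=> z0 oz nz; apply: primitive_eltP.
  rewrite -(dlogK gP z0) prim_root_exp_coprime //; apply: coprime_primes => // l lp ln.
  have [ol|] := boolP (odd l); first exact/nz/complete.
  by case/prime_oddPn: lp => // ->; rewrite dvdn2 oz.
by split; apply: prim => // l ls; have := nol l ls; rewrite negb_or => /andP[].
Qed.

Variables (P A C : nat).
Let d := (P - 2 * A)%N.
Let V := (C * 4 ^ size core * (d + 2 * (size rest * P - A)))%N.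
Hypothesis P_gt0 : (0 < P)%N.
Hypothesis A_bound : (\sum_(l <- rest) (P %/ l).+1 <= A)%N.
Hypothesis A_rest : (0 < size rest)%N || (A == 0)%N.
Hypothesis d_gt0 : (0 < d)%N.
Hypothesis C_ge : (4 * parity_factor F <= C)%N.

(** The bound of the sieve with [tau = A / P] in place of the exact sum of inverses, multiplied by
    [P] to become integral ([d = P (1 - 2 tau)]), then squared to remove [sqrt q]. The contradiction
    comes from [(q - 6) q <= (q - 3) ^ 2]. *)
Theorem sieve_criterion : (V ^ 2 < (q - 6) * d ^ 2)%N -> has_primitive_point a.
Proof.
move=> big; have [g gP] := primitive_root_exists F.
have [w wP] := C_prim_root_exists n0.
have [//|nop] := primitive_point_or_none w gP; exfalso.
have q6 : (6 < q)%N by rewrite ltnNge; apply: contraL big; rewrite -subn_eq0 => /eqP ->; rewrite mul0n.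
have PC : 0 < P%:R :> algC by rewrite ltr0n.
pose sg : algC := \sum_(l <- rest) l%:R^-1.
pose tau : algC := A%:R / P%:R.
have P2A : (2 * A < P)%N by rewrite -subn_gt0.
have sg_tau : sg <= tau.
  rewrite /tau ler_pdivlMr // /sg mulr_suml.
  apply: (@le_trans _ _ (\sum_(l <- rest) (P %/ l).+1%:R)).
    rewrite big_seq [leRHS]big_seq; apply: ler_sum => l lr.
    have l0 : (0 < l)%N.
      by have := allP good l; rewrite mem_cat lr orbT => /(_ isT) /and3P[/prime_gt0].
    rewrite mulrC ler_pdivrMr ?ltr0n // -natrM ler_nat ltnW //; exact: ltn_ceil.
  by rewrite -natr_sum ler_nat.
have tau2 : 2 * tau < 1 by rewrite mulrA ltr_pdivrMr // mul1r -natrM ltr_nat.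
have sg2 : sg < 2^-1.
  by rewrite -[2^-1]mul1r ltr_pdivlMr ?ltr0n // mulrC (le_lt_trans _ tau2) // ler_pM2l ?ltr0n.
pose R : algC := sqrtC #|F|%:R; have R0 : 0 <= R by rewrite sqrtC_ge0 ler0n.
have R2 : R ^+ 2 = q%:R := sqrtCK _.
pose K := (parity_factor F)%:R * R * 4 ^+ size core.
have K0 : 0 <= K by rewrite !mulr_ge0 ?exprn_ge0 ?ler0n.
have := sieve_bound gP wP n_even a0 good uniq_cr nop (erefl sg) sg2.
rewrite -/q -/R -/K => ineq.
pose s : algC := (size rest)%:R; pose Z : algC := q%:R - 3 - 4 * K.
(* Passing from [sg] to [tau] lowers the left side by [2 (tau - sg) Z] and the right side by
   [2 (tau - sg) 4 K], which is fine for [Z >= 4 K]. For smaller [Z] the claim holds outright as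
   soon as there is a sieving prime; with none, [A_rest] makes both [tau] and [sg] zero. *)
have ineq2 : (1 - 2 * tau) * Z <= 8 * (s - tau) * K.
  have Kr : 4 * K \is Num.real by rewrite ger0_real // mulr_ge0 ?ler0n.
  have Zr : Z \is Num.real by rewrite /Z !rpredB ?realn.
  have [ZK|ZK] := real_leP Kr Zr.
    have -> : (1 - 2 * tau) * Z = (1 - 2 * sg) * Z - 2 * (tau - sg) * Z by ring.
    have -> : 8 * (s - tau) * K = 8 * (s - sg) * K - 2 * (tau - sg) * (4 * K) by ring.
    by rewrite lerB // ler_wpM2l // mulr_ge0 ?ler0n // subr_ge0.
  case: (posnP (size rest)) A_rest => [s0|s_gt0 _].
    move=> A0; have tau0 : tau = 0 by rewrite /tau; move: A0 => /= /eqP ->; rewrite mul0r.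
    have sg0 : sg = 0 by rewrite /sg (size0nil s0) big_nil.
    by move: ineq; rewrite tau0 sg0.
  apply: (@le_trans _ _ ((1 - 2 * tau) * (4 * K))).
    by rewrite ler_pM2l ?subr_gt0 // ltW.
  have -> : (1 - 2 * tau) * (4 * K) = (4 - 8 * tau) * K by ring.
  have -> : 8 * (s - tau) * K = (8 * s - 8 * tau) * K by ring.
  rewrite ler_wpM2r // lerB // /s -natrM ler_nat.
  by rewrite (leq_trans (n := 8 * 1)) // leq_mul2l s_gt0.
have sA : (A <= size rest * P)%N.
  case/orP: A_rest => [s_gt0|/eqP -> //].
  by rewrite (leq_trans _ (leq_pmull _ s_gt0)) // (leq_trans _ (ltnW P2A)) // leq_pmull.
have ineq3 : d%:R * (q - 3)%:R <= V%:R * R.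
  have PN : P%:R != 0 :> algC by rewrite lt0r_neq0.
  have e1 : d%:R = P%:R * (1 - 2 * tau).
    by rewrite /d natrB ?(ltnW P2A) // natrM /tau; field.
  have e2 : (size rest * P - A)%:R = P%:R * (s - tau).
    by rewrite natrB // natrM /tau /s; field.
  have e3 : d%:R * (q%:R - 3) <= 4 * K * (d + 2 * (size rest * P - A))%:R.
    rewrite natrD natrM e1 e2 -subr_ge0.
    have -> : 4 * K * (P%:R * (1 - 2 * tau) + 2 * (P%:R * (s - tau))) - P%:R * (1 - 2 * tau) * (q%:R - 3)
      = P%:R * (8 * (s - tau) * K - (1 - 2 * tau) * Z) by rewrite /Z; ring.
    by rewrite mulr_ge0 ?ler0n // subr_ge0.
  rewrite [(q - 3)%:R]natrB; last by rewrite (leq_trans _ q6).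
  apply: le_trans e3 _; rewrite /V !natrM natrX /K.
  have -> : 4 * ((parity_factor F)%:R * R * 4 ^+ size core) = (4 * parity_factor F)%:R * 4 ^+ size core * R.
    by rewrite natrM; ring.
  by rewrite [leRHS]mulrAC; do 3![apply: ler_wpM2r; rewrite ?exprn_ge0 ?ler0n //]; rewrite ler_nat.
have : ((d * (q - 3)) ^ 2 <= V ^ 2 * q)%N.
  rewrite -(ler_nat algC).
  have -> : (V ^ 2 * q)%:R = (V%:R * R) ^+ 2 :> algC by rewrite exprMn R2 -natrX -natrM.
  have -> : ((d * (q - 3)) ^ 2)%:R = (d%:R * (q - 3)%:R) ^+ 2 :> algC by rewrite -natrM -natrX.
  by rewrite lerXn2r ?nnegrE ?mulr_ge0 ?ler0n.
apply/negP; rewrite -ltnNge.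
apply: (@leq_trans ((q - 6) * d ^ 2 * q)); first by rewrite ltn_pmul2r // (leq_trans _ q6).
rewrite expnMn mulnAC mulnC leq_mul2l; apply/orP; right.
by move: q6; clear; nia.
Qed.

End Sieve.

(** * Primitive points over prime fields *)

Lemma prim_root_of_prime_divisors (R : nzRingType) (z : R) (N : nat) : (0 < N)%N -> z ^+ N = 1 ->
  (forall l, prime l -> (l %| N)%N -> z ^+ (N %/ l)%N != 1) -> N.-primitive_root z.
Proof.
move=> N0 zN nl; have [m zm mN] := prim_order_exists N0 zN.
have m0 := prim_order_gt0 zm.
have [->//|Nm] := eqVneq N m.
have Em := divnK mN; have k1 : (1 < N %/ m)%N.
  rewrite ltn_neqAle divn_gt0 // dvdn_leq // andbT eq_sym; apply: contra Nm => /eqP k1.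
  by rewrite -Em k1 mul1n.
have lp := pdiv_prime k1; have lk := pdiv_dvd (N %/ m).
have lN : (pdiv (N %/ m) %| N)%N by rewrite -{2}Em dvdn_mulr.
case/negP: (nl _ lp lN); rewrite -(prim_order_dvd zm).
by rewrite -{1}Em mulnC -muln_divA ?dvdn_mulr.
Qed.

Section OrderSpec.

Variables (A : Type) (mul : A -> A -> A) (R : nzRingType) (ev : A -> R).
Hypothesis evM : forall x y, ev (mul x y) = ev x * ev y.

Lemma powpE z e : ev (powp mul z e) = ev z ^+ Pos.to_nat e.
Proof.
elim: e z => [e IH|e IH|] z /=.
- by rewrite evM IH evM -expr2 -exprM Pos2Nat.inj_xI exprS; congr (_ * _ ^+ _); lia.
- by rewrite IH evM -expr2 -exprM Pos2Nat.inj_xO; congr (_ ^+ _); lia.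
- by rewrite expr1.
Qed.

Lemma prodpE ls : Pos.to_nat (prodp ls) = (\prod_(l <- map Pos.to_nat ls) l)%N.
Proof. by elim: ls => [|l ls IH]; rewrite ?big_nil //= big_cons -IH Pos2Nat.inj_mul. Qed.

Lemma ordlistP z ls f ws : ordlist mul z ls = (f, ws) ->
  ev f = ev z ^+ Pos.to_nat (prodp ls) /\
  forall l, l \in map Pos.to_nat ls ->
    exists i, [/\ (i < size ws)%N & forall w0, ev (nth w0 ws i) = ev z ^+ (Pos.to_nat (prodp ls) %/ l)%N].
Proof.
elim: ls z f ws => [|l ls IH] z f ws /=; first by case=> <- _; rewrite expr1.
case E : (ordlist mul (powp mul z l) ls) => [f' ws'] [<- <-].
have [fE wsE] := IH _ _ _ E; have l0 : (0 < Pos.to_nat l)%N by lia.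
split; first by rewrite fE powpE -exprM Pos2Nat.inj_mul.
move=> l'; rewrite in_cons => /orP[/eqP ->|l'ls].
  exists 0%N; split=> // w0 /=; rewrite powpE Pos2Nat.inj_mul.
  by rewrite (_ : Nat.mul _ _ = Pos.to_nat l * Pos.to_nat (prodp ls))%N // mulKn.
have [i [iws wE]] := wsE _ l'ls; exists i.+1; split=> // w0 /=; rewrite wE powpE -exprM.
rewrite Pos2Nat.inj_mul (_ : Nat.mul _ _ = Pos.to_nat l * Pos.to_nat (prodp ls))%N //.
by rewrite -muln_divA // prodpE (big_rem _ l'ls) /= dvdn_mulr.
Qed.

End OrderSpec.

Section Montgomery.

Variables (R : comUnitRingType) (m : positive).
Let q := xI m.
Hypothesis char_q : (Pos.to_nat q)%:R = 0 :> R.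
Hypothesis char_inj : forall a b : nat, a%:R = b%:R :> R -> a = b %[mod Pos.to_nat q].

Definition nr (z : N) : R := (N.to_nat z)%:R.

Lemma nrD a b : nr (N.add a b) = nr a + nr b.
Proof. by rewrite /nr N2Nat.inj_add natrD. Qed.

Lemma nrM a b : nr (N.mul a b) = nr a * nr b.
Proof. by rewrite /nr N2Nat.inj_mul natrM. Qed.

Lemma nr_mod a : nr (N.modulo a (Npos q)) = nr a.
Proof.
by rewrite {2}(N.div_mod a (Npos q)) // nrD nrM /nr char_q mul0r add0r.
Qed.

Lemma halveE acc : nr (halve m acc) * 2 = nr acc.
Proof.
suff [t tE] : exists t, (N.to_nat (halve m acc) * 2 = N.to_nat acc + t * Pos.to_nat q)%N.
  by rewrite /nr -natrM tE natrD natrM char_q mulr0 addr0.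
rewrite /q; case: acc => [|[p|p|]] /=; [exists 0%N|exists 1%N|exists 0%N|exists 1%N]; rewrite ?Pos.add_carry_spec; lia.
Qed.

Lemma addpE b acc : nr (addp b acc) = nr (Npos b) + nr acc.
Proof. by case: acc => [|p]; rewrite -nrD /addp //=; congr nr; lia. Qed.

Lemma halvesE k acc : nr (halves k m acc) * 2 ^+ k = nr acc.
Proof.
elim: k acc => [|k IH] acc /=; first by rewrite mulr1.
by rewrite exprSr mulrA IH halveE.
Qed.

Lemma montpE k b a acc : nr (montp k m b a acc) * 2 ^+ k = nr acc + nr (Npos a) * nr (Npos b).
Proof.
elim: k a acc => [|k IH] a acc; first by rewrite mulr1 /= nrD -nrM.
have xO_E p : nr (Npos (xO p)) = nr (Npos p) * 2.
  by rewrite /nr -natrM; congr (_%:R); lia.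
have xI_E p : nr (Npos (xI p)) = nr (Npos p) * 2 + 1.
  by rewrite /nr -natrM natr1; congr (_%:R); lia.
case: a => [a|a|]; rewrite /= exprSr mulrA.
- by rewrite IH mulrDl halveE addpE xI_E; ring.
- by rewrite IH mulrDl halveE xO_E; ring.
- by rewrite halvesE halveE addpE mul1r addrC.
Qed.

Lemma two_unit : (2 : R) \is a GRing.unit.
Proof.
apply/unitrPr; exists (- (Pos.to_nat m)%:R); move: char_q.
rewrite /q Pos2Nat.inj_xI -[Nat.mul 2 _]/(2 * Pos.to_nat m)%N -addn1 natrD natrM => e.
by rewrite mulrN; apply/eqP; rewrite -subr_eq0 -opprD oppr_eq0 e.
Qed.

Variable k : nat.

(** Montgomery form: [z] stands for [z / 2 ^ k], and [montgomery] becomes multiplication. The ring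
    is general because it will be the integers modulo [q], before [q] is known to be prime, and then
    the field. *)
Definition mev (z : N) : R := nr z / 2 ^+ k.

Lemma mevM a b : mev (montgomery k m a b) = mev a * mev b.
Proof.
have u2 : (2 ^+ k : R) \is a GRing.unit by rewrite unitrX ?two_unit.
have E : nr (montgomery k m a b) * 2 ^+ k = nr a * nr b.
  by case: a b => [|a] [|b]; rewrite /= ?mul0r ?mulr0 ?montpE ?add0r // mulrC.
rewrite /mev -[nr (montgomery _ _ _ _)](mulrK u2) E -!mulrA; congr (_ * _).
by rewrite [RHS]mulrC !mulrA [nr b / _]mulrC.
Qed.

Variable one : N.
Hypothesis oneE : one = N.modulo (N.pow 2 (N.of_nat k)) (Npos q).

Lemma nr_one : nr one = 2 ^+ k.
Proof.
rewrite oneE nr_mod /nr N2Nat.inj_pow Nat2N.id -natrX; congr (_%:R).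
by elim: (k) => //= j IH; rewrite IH expnS; lia.
Qed.

Lemma order_testP z N ls : order_test k m q one z N ls ->
  mev z ^+ Pos.to_nat N = 1 /\
  forall l, l \in map Pos.to_nat ls -> mev z ^+ (Pos.to_nat N %/ l)%N != 1.
Proof.
have u2 : (2 ^+ k : R) \is a GRing.unit by rewrite unitrX ?two_unit.
rewrite /order_test; case E : N.div_eucl => [[|c] [|]] //.
have NE : (Pos.to_nat N = Pos.to_nat c * Pos.to_nat (prodp ls))%N.
  have := N.div_eucl_spec (Npos N) (Npos (prodp ls)); rewrite E; lia.
case O : ordlist => [f ws].
have normE w : nr (reduce_once q w) = nr w.
  rewrite /reduce_once; case: N.leb_spec => // le.
  have -> : w = N.add (N.sub w (Npos q)) (Npos q) by lia.
  rewrite nrD [nr (Npos q)]/nr char_q addr0; congr nr; lia.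
case/andP=> /N.eqb_eq f1 /(all_nthP 0%num) wsP.
have [fE wE] := ordlistP mevM O; rewrite (powpE mevM) in fE wE.
rewrite NE; split.
  by rewrite exprM -fE /mev -normE f1 nr_one divrr.
move=> l lls; have [i [iws /(_ 0%num) wi]] := wE _ lls.
rewrite -muln_divA; last by rewrite prodpE (big_rem _ lls) /= dvdn_mulr.
rewrite exprM -wi; have /andP[/N.ltb_spec0 lt /negP ne] := wsP _ iws.
apply/eqP => /(congr1 (fun t => t * 2 ^+ k)); rewrite /mev divrK // mul1r -normE -nr_one.
move/char_inj; set w := reduce_once _ _ in lt ne *; move=> e; apply: ne; apply/N.eqb_eq.
have o_lt : N.lt one (Npos q) by rewrite oneE; apply: N.mod_lt.
rewrite !modn_small in e; [exact: N2Nat.inj | lia | lia].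
Qed.

End Montgomery.

Lemma finField_card_gt0 (F : finFieldType) : (0 < #|F|)%N.
Proof. by apply/card_gt0P; exists 0. Qed.

(* The equation only involves [y ^ 2], so no square root has to be computed: any
   square root of an element of order [(q - 1) / 2], or its opposite, is primitive. *)
Lemma point_of_orders (F : finFieldType) (a x : F) : odd #|F| ->
  #|F|.-1.-primitive_root x -> #|F|.-1./2.-primitive_root (x ^+ 3 + a * x) ->
  has_primitive_point a.
Proof.
move=> oF; have n0 := card_pred_gt0 F; set n := #|F|.-1; set h := n./2.
have nE : n = h.*2.
  have : ~~ odd n by move: oF; rewrite -(prednK (finField_card_gt0 F)).
  by move=> en; rewrite -[LHS]odd_double_half (negPf en).
set f := _ + _ => px pf; have h0 : (0 < h)%N by rewrite -double_gt0 -nE.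
have fh := prim_expr_order pf.
have fn : f ^+ n = 1 by rewrite nE -muln2 exprM fh expr1n.
have [e fE] : exists e : nat, f = x ^+ e by have [i ->] := prim_rootP px fn; exists i.
have e2 : ~~ odd e.
  have /eqP := fh; rewrite fE -exprM -(prim_order_dvd px) nE -muln2 [(e * h)%N]mulnC.
  by rewrite dvdn_pmul2l // dvdn2.
have eE : (e = e./2.*2 :> nat)%N by rewrite -[LHS]odd_double_half (negPf e2).
set y0 := x ^+ e./2; have y0f : y0 ^+ 2 = f by rewrite fE eE -exprM muln2 -eE.
have x_h : x ^+ h = -1 by apply: primitive_rootN1 => //; rewrite -nE.
have y0h : y0 ^+ h = 1 \/ y0 ^+ h = -1.
  by apply/pred2P; rewrite /= -sqrf_eq1 -exprM mulnC exprM y0f fh.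
suff [y yf yl] : exists2 y, y ^+ 2 = f & forall l, prime l -> (l %| n)%N -> y ^+ (n %/ l)%N != 1.
  exists x, y; split => //; split; apply: primitive_eltP => //.
  apply: prim_root_of_prime_divisors => //.
  by rewrite -/n nE -mul2n exprM yf fh.
have odd_l y l : y ^+ 2 = f -> prime l -> odd l -> (l %| n)%N -> y ^+ (n %/ l)%N != 1.
  move=> yf lp ol ln; have lh : (l %| h)%N.
    by move: ln; rewrite nE -mul2n Euclid_dvdM // dvdn_prime2 // => /orP[/eqP l2|//]; rewrite l2 in ol.
  apply/eqP => yl1; have : f ^+ (h %/ l) == 1.
    by rewrite -yf -exprM muln_divA // mul2n -nE yl1.
  rewrite -(prim_order_dvd pf) => /dvdn_leq; rewrite divn_gt0 ?prime_gt0 // dvdn_leq // => /(_ isT).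
  by rewrite leqNgt ltn_Pdiv // prime_gt1.
have two y : y ^+ 2 = f -> y ^+ h = -1 -> forall l, prime l -> (l %| n)%N -> y ^+ (n %/ l)%N != 1.
  move=> yf yh l lp ln; have [ol|] := boolP (odd l); first exact: odd_l.
  case/prime_oddPn: (lp) => // -> _; rewrite nE -muln2 mulnK // yh -x_h -(prim_order_dvd px).
  by apply/negP => /dvdn_leq -/(_ h0); rewrite -/n nE -addnn -{3}[h]addn0 leq_add2l leqn0 (gtn_eqF h0).
(* If [y0 ^ h = -1], then [y0] is primitive. If [y0 ^ h = 1], then [- y0] is for odd [h], while for
   even [h] the cubic value would satisfy [f ^ (h / 2) = 1], against its order [h]. *)
case: y0h => y0h; last by exists y0 => //; apply: two.
have [oh|eh] := boolP (odd h).
  exists (- y0); first by rewrite sqrrN.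
  by apply: two; rewrite ?sqrrN // exprNn y0h -signr_odd oh mulr1.
exfalso; have : f ^+ h./2 == 1.
  by rewrite -y0f -exprM mul2n -[h./2.*2]/(false + _)%N -(negPf eh) odd_double_half y0h.
rewrite -(prim_order_dvd pf) => /dvdn_leq.
by case: (h) h0 eh => [|[|k]] //= _ _; rewrite ltnNge; lia.
Qed.

Lemma card_finField_pprime (F : finFieldType) :
  exists p e, [/\ prime p, p \in [pchar F] & #|F| = (p ^ e)%N].
Proof.
have [p pp cp] := finPcharP F; exists p, (logn p #|F|); split=> //.
exact: (card_pprimeChar cp).
Qed.

Lemma pchar_natr_inj (R : nzRingType) p : p \in [pchar R] ->
  forall a b : nat, a%:R = b%:R :> R -> a = b %[mod p].
Proof.
move=> cp a b; wlog le : a b / (b <= a)%N.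
  by move=> W e; case/orP: (leq_total a b) => le; [apply/esym/W|apply: W].
move/eqP; rewrite -subr_eq0 -natrB // -(dvdn_pcharf cp) => d.
by apply/eqP; rewrite eqn_mod_dvd.
Qed.

(* Lucas' criterion, for a number already known to be a prime power. *)
Lemma lucas_prime p e (z : 'Z_(p ^ e)) : prime p -> (2 < p ^ e)%N ->
  (p ^ e).-1.-primitive_root z -> e = 1%N.
Proof.
move=> pp q2 pz; set q := (p ^ e)%N in z q2 pz *.
have q1 : (1 < q)%N := ltnW q2; have q0 : (0 < q)%N := ltnW q1.
have qm : (0 < q.-1)%N by rewrite -ltnS prednK.
have uz : z \is a GRing.unit.
  apply/unitrPr; exists (z ^+ q.-2); rewrite -exprS prednK //; exact: prim_expr_order.
have cz : coprime q z by rewrite -unitZpE // natr_Zp.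
have zt : z ^+ totient q = 1.
  have e1 : (z : nat) ^ totient q = 1 %[mod q].
    by apply: Euler_exp_totient; rewrite coprime_sym.
  by rewrite -{1}[z]natr_Zp -natrX -(Zp_nat_mod q1) e1 (Zp_nat_mod q1).
have := zt; move/eqP; rewrite -(prim_order_dvd pz).
have e0 : (0 < e)%N by rewrite lt0n; apply: contraTneq q2 => e0; rewrite /q e0.
(* [q - 1] divides [totient q = (p - 1) p ^ (e - 1)] and is prime to [p], so it divides [p - 1],
   which forces [q <= p]. *)
rewrite /q totient_pfactor // Gauss_dvdl; last first.
  rewrite coprimeXr // coprime_sym prime_coprime // -/q.
  have : (p %| q)%N by rewrite /q -(prednK e0) expnS dvdn_mulr.
  rewrite -{1}(prednK q0) -addn1 => pq; apply/negP => pq1.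
  by move: pq; rewrite dvdn_addr // dvdn1; case: (p) pp => [|[]].
have p1 := prime_gt1 pp.
have p1' : (0 < p.-1)%N by lia.
move/dvdn_leq => /(_ p1'); rewrite -/q => le; apply/eqP; rewrite eqn_leq e0 andbT.
have {}le : (q <= p)%N by lia.
by rewrite -(leq_exp2l _ _ p1) expn1.
Qed.

Definition both_points (q : nat) := forall F : finFieldType, #|F| = q ->
  has_primitive_point (1 : F) /\ has_primitive_point (-1 : F).

(** The same order computation is read twice. In the integers modulo [q] it shows by Lucas'
    criterion that the prime power [q] is prime; then [F] has characteristic [q], and read in [F] it
    gives the points. *)
Lemma prime_testP q ls x :
  (forall l, prime l -> odd l -> l %| (Pos.to_nat q).-1 -> l \in map Pos.to_nat ls)%N ->
  prime_test q ls x -> both_points (Pos.to_nat q).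
Proof.
case: q => // m lsP; rewrite /prime_test => /and3P[t1 t2 t3] F cF.
set q := xI m in lsP t1 t2 t3 cF; set Q := Pos.to_nat q in lsP cF *.
set k := (Pos.size_nat q).+2 in t1 t2 t3 *.
set one := N.modulo _ _ in t1 t2 t3 *.
have Qm : Q.-1 = (Pos.to_nat m).*2 by rewrite /Q; lia.
have Q2 : (2 < Q)%N by rewrite /Q; lia.
have Q_odd : odd Q by rewrite /Q; lia.
have ring_case (R : comUnitRingType) : Q%:R = 0 :> R ->
   (forall a b : nat, a%:R = b%:R :> R -> a = b %[mod Q]) ->
   [/\ Q.-1.-primitive_root (nr R x), Q.-1./2.-primitive_root (nr R x ^+ 3 + 1 * nr R x) &
     Q.-1./2.-primitive_root (nr R x ^+ 3 + -1 * nr R x)].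
  move=> Q0 inj.
  have conv z : mev R k (N.modulo (N.mul z one) (Npos q)) = nr R z.
    rewrite /mev nr_mod // nrM (nr_one Q0 (erefl one)) mulrK //.
    by rewrite unitrX // (two_unit Q0).
  have N1 : Pos.to_nat (Pos.mul 2 m) = Q.-1 by rewrite Qm; lia.
  have N2 : Pos.to_nat m = Q.-1./2 by rewrite Qm doubleK.
  have N1_gt0 : (0 < Q.-1)%N by rewrite -N1; lia.
  have N2_gt0 : (0 < Q.-1./2)%N by rewrite -N2; lia.
  have complete l : prime l -> (l %| Q.-1)%N -> l \in map Pos.to_nat (ls ++ [:: 2%positive]).
    move=> lp ln; rewrite map_cat mem_cat; have [ol|] := boolP (odd l).
      by rewrite lsP.
    by case/prime_oddPn: (lp) => // ->; rewrite orbT.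
  have half z : order_test k m q one (N.modulo (N.mul z one) (Npos q)) m
      (match m with xO _ => ls ++ [:: 2%positive] | _ => ls end) ->
      Q.-1./2.-primitive_root (nr R z).
    case/(order_testP Q0 inj (erefl one)); rewrite conv N2 => z1 zl.
    apply: prim_root_of_prime_divisors => // l lp lh; apply: zl.
    have ln : (l %| Q.-1)%N by rewrite Qm -muln2 dvdn_mulr // N2.
    have [ol|] := boolP (odd l).
      by case: (m) => *; rewrite ?map_cat ?mem_cat lsP.
    case/prime_oddPn: (lp) => // l2; move: lh; rewrite l2 -N2 dvdn2.
    case: (m) => [m'|m'|] h2; [exfalso; lia | by rewrite map_cat mem_cat orbT | by []].
  have x3E : nr R (N.mul x (N.mul x x)) = nr R x ^+ 3 by rewrite !nrM !exprS mulr1.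
  split.
  - move: t1 => /(order_testP Q0 inj (erefl one)); rewrite conv N1 => -[x1 xl].
    by apply: prim_root_of_prime_divisors => // l lp ln; apply/xl/complete.
  - by rewrite mul1r -x3E -nrD; apply: half.
  - rewrite mulN1r -x3E (_ : _ - _ = nr R (N.sub (N.mul x (N.mul x x)) x)); first exact: half.
    apply/eqP; rewrite subr_eq -nrD; apply/eqP; congr nr.
    (* The truncated subtraction is exact because [x <= x ^ 3] for naturals. *)
    by rewrite N.sub_add //; case: (x) => [|y] //; nia.
have [p [e [pp cp cFE]]] := card_finField_pprime F.
have Qpe : Q = (p ^ e)%N by rewrite -cF.
have e1 : e = 1%N.
  have Q1 : (1 < Q)%N := ltnW Q2.
  have [] := ring_case 'Z_Q (pchar_Zp Q1).
    by move=> a b /(congr1 (fun t : 'Z_Q => t : nat)); rewrite !val_Zp_nat.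
  by rewrite Qpe in Q2 * => pz _ _; apply: lucas_prime pz.
have Qp : Q = p by rewrite Qpe e1 expn1.
have [] := ring_case F; rewrite ?Qp ?(pcharf0 cp) //.
  exact: pchar_natr_inj.
rewrite -Qp -cF => p1 p2 p3.
by split; apply: (point_of_orders (x := nr F x)); rewrite // cF.
Qed.

(** * Enumeration of the fields that escape the sieve *)

Lemma split_not_prime_power q c p e : split_at q c -> prime p -> N.to_nat q = (p ^ e)%N -> False.
Proof.
rewrite /split_at; set d := N.div q c; case/and4P=> /N.ltb_lt c1 /N.ltb_lt d1 /N.eqb_eq cd /N.eqb_eq g1 pp qE.
have dvdp m : (1 < m)%N -> (m %| p ^ e)%N -> (p %| m)%N.
  move=> m1 /(dvdn_pfactor _ _ pp)[i _ mE]; rewrite mE in m1 *.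
  by case: i m1 {mE} => // i _; rewrite expnS dvdn_mulr.
have qcd : (p ^ e = N.to_nat c * N.to_nat d)%N by rewrite -qE -cd; lia.
have pc : (p %| N.to_nat c)%N by apply: dvdp; [lia | rewrite qcd dvdn_mulr].
have pd : (p %| N.to_nat d)%N by apply: dvdp; [lia | rewrite qcd dvdn_mull].
have NP m : (p %| N.to_nat m)%N -> N.divide (N.of_nat p) m.
  by case/dvdnP=> k kE; exists (N.of_nat k); lia.
have := N.gcd_greatest _ _ _ (NP _ pc) (NP _ pd); rewrite g1 => /N.divide_1_r.
by have := prime_gt1 pp; lia.
Qed.

Lemma split_at_both q c : split_at q c -> both_points (N.to_nat q).
Proof.
move=> sp F cF; have [p [e [pp _ pE]]] := card_finField_pprime F.
by case: (split_not_prime_power sp pp (e := e)); rewrite -cF.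
Qed.

Lemma to_nat_div a b : N.to_nat (N.div a b) = (N.to_nat a %/ N.to_nat b)%N.
Proof.
rewrite N2Nat.inj_div; have [->|b0] := posnP (N.to_nat b); first by rewrite divn0.
apply/esym/(Nat.div_unique _ _ _ (N.to_nat a %% N.to_nat b)); first by have := ltn_mod (N.to_nat a) (N.to_nat b); lia.
by rewrite [LHS](divn_eq _ (N.to_nat b)) mulnC.
Qed.

Definition odd_primes_of (n : nat) (s : seq nat) :=
  [/\ uniq s, all (fun l => [&& prime l, odd l & l %| n]%N) s &
    forall l, prime l -> odd l -> (l %| n)%N -> l \in s].

Definition class_bound (n C : nat) := forall F : finFieldType, #|F| = n.+1 -> (4 * parity_factor F <= C)%N.

Lemma sumN_inv ls : N.to_nat (sumN (map inv_up ls)) =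
  (\sum_(l <- map N.to_nat ls) (N.to_nat scale %/ l).+1)%N.
Proof.
elim: ls => [|l ls IH]; first by rewrite big_nil.
by rewrite /= big_cons -IH N2Nat.inj_add /inv_up N2Nat.inj_succ to_nat_div.
Qed.

Lemma lenN_size s : N.to_nat (lenN s) = size s.
Proof. by elim: s => //= x s IH; lia. Qed.

Lemma crit_at_sound n C q s A core rest : q = N.of_nat n.+1 -> ~~ odd n ->
  odd_primes_of n (core ++ rest) -> class_bound n (N.to_nat C) ->
  N.to_nat s = size rest -> (\sum_(l <- rest) (N.to_nat scale %/ l).+1 <= N.to_nat A)%N ->
  (0 < size rest)%N || (N.to_nat A == 0)%N ->
  crit_at (N.mul C (N.pow 4 (N.of_nat (size core)))) q s A -> both_points n.+1.
Proof.
move=> -> en [us gs cs] Cn sE AE As /andP[/N.ltb_lt d0 /N.ltb_lt big] F cF.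
have oF : odd #|F| by rewrite cF.
have nF : #|F|.-1 = n by rewrite cF.
have CF := Cn F cF.
have sc (a : F) : a != 0 -> has_primitive_point a.
  move=> a0; apply: (@sieve_criterion F a a0 oF core rest _ us _ (N.to_nat scale) (N.to_nat A) (N.to_nat C)) => //.
  - by rewrite nF.
  - by rewrite nF.
  - by move: d0; lia.
  have pw : N.to_nat (N.pow 4 (N.of_nat (size core))) = (4 ^ size core)%N.
    by elim: (size core) => // k IH; rewrite expnS -IH Nat2N.inj_succ N.pow_succ_r'; lia.
  rewrite cF -pw -sE -!mulnn.
  by move: big; set d := N.sub _ (N.mul 2 A); set V := N.mul (N.mul _ _) _; rewrite /V /d; lia.
by split; apply: sc; rewrite ?oppr_eq0 oner_eq0.
Qed.

Lemma pow4S c k : N.mul (N.mul 4 c) (N.pow 4 (N.of_nat k)) = N.mul c (N.pow 4 (N.of_nat k.+1)).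
Proof. by rewrite Nat2N.inj_succ N.pow_succ_r'; lia. Qed.

Lemma crit_split C q ls : crit C q (map inv_up ls) -> exists core rest,
  ls = core ++ rest /\
  crit_at (N.mul C (N.pow 4 (N.of_nat (size core)))) q (lenN (map inv_up rest)) (sumN (map inv_up rest)).
Proof.
elim: ls C => [|l ls IH] C.
  by rewrite /= orbF => h; exists [::], [::]; split=> //; rewrite N.pow_0_r N.mul_1_r.
rewrite /= -[N.succ (lenN _)]/(lenN (map inv_up (l :: ls))) -[N.add (inv_up l) _]/(sumN (map inv_up (l :: ls))).
case/orP => [h|/IH[core [rest [-> h]]]].
  by exists [::], (l :: ls); split=> //; rewrite N.pow_0_r N.mul_1_r.
by exists (l :: core), rest; split=> //; rewrite -pow4S.
Qed.

Lemma crit_sound n C ls : ~~ odd n -> odd_primes_of n (map N.to_nat ls) ->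
  class_bound n (N.to_nat C) -> crit C (N.of_nat n.+1) (map inv_up ls) -> both_points n.+1.
Proof.
move=> en op Cn /crit_split[core [rest [lsE]]].
rewrite -(size_map N.to_nat core) => h.
apply: (crit_at_sound (erefl _) en _ Cn _ _ _ h (rest := map N.to_nat rest)).
- by rewrite -map_cat -lsE.
- by rewrite lenN_size !size_map.
- by rewrite sumN_inv.
- by rewrite size_map; case: (rest).
Qed.

Lemma candidateP pl C n ls certs certs' : ~~ odd n -> odd_primes_of n (map N.to_nat ls) ->
  class_bound n (N.to_nat C) -> candidate pl C (N.of_nat n.+1) ls certs = Some certs' ->
  both_points n.+1 \/ N.of_nat n.+1 \in pl.
Proof.
move=> en op Cn; rewrite /candidate.
case: ifP => [/hasP[d _]|_].
  by case: ifP => // _ sp _; left; have := split_at_both sp; rewrite Nat2N.id.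
case: ifP => [cr _|_]; first by left; apply: crit_sound cr.
case: certs => // c certs; case: c => [|c].
  by case: ifP => // /hasP[x xpl /N.eqb_eq ->] _; right.
case: ifP => _; first by case: ifP => // sp _; left; have := split_at_both sp; rewrite Nat2N.id.
case: ifP => // pt _; left.
have qE : n.+1 = Pos.to_nat (pos_of (N.of_nat n.+1)) by rewrite /=; lia.
rewrite qE; apply: prime_testP pt => l lp ol; rewrite -qE => ln.
have [_ _ /(_ l lp ol ln)] := op; case/mapP=> x xls lE.
rewrite map_rev mem_rev -map_comp; apply/mapP; exists x => //=.
by rewrite lE; case: x {xls} lE => //= l0; rewrite l0 in lp.
Qed.

Lemma threshold_atP Ck q s a t : threshold_at Ck s a = Some t -> N.le t q -> crit_at Ck q s a.
Proof.
rewrite /threshold_at /crit_at; set d := N.sub scale _; set V := N.mul Ck _.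
case: N.eqb_spec => // d0 /Some_inj <- le; apply/andP; split; first by apply/N.ltb_lt; lia.
apply/N.ltb_lt.
have dd0 : N.mul d d <> 0%num by nia.
have := N.mul_succ_div_gt (N.mul V V) (N.mul d d) dd0.
move=> h; apply: N.lt_le_trans h _; rewrite N.mul_comm; apply: N.mul_le_mono_r.
by move: le; generalize (N.div (N.mul V V) (N.mul d d)); clear; lia.
Qed.

Lemma threshold_split C q ls s a t : threshold C (map inv_up ls) s a = Some t -> N.le t q ->
  exists core rest, ls = core ++ rest /\
  crit_at (N.mul C (N.pow 4 (N.of_nat (size core)))) q
    (N.add (lenN (map inv_up rest)) s) (N.add (sumN (map inv_up rest)) a).
Proof.
have base Ck l t0 : threshold_at Ck (N.add (lenN (map inv_up l)) s) (N.add (sumN (map inv_up l)) a) = Some t0 ->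
   N.le t0 q -> exists core rest, l = core ++ rest /\
   crit_at (N.mul Ck (N.pow 4 (N.of_nat (size core)))) q
    (N.add (lenN (map inv_up rest)) s) (N.add (sumN (map inv_up rest)) a).
  by move=> e le; exists [::], l; split=> //; rewrite N.pow_0_r N.mul_1_r; apply: threshold_atP e le.
elim: ls C t => [|l ls IH] C t.
  rewrite [threshold _ _ _ _]/=; case E : threshold_at => [t0|] //= [<-]; exact: (base _ [::]) E.
rewrite /= -[N.succ (lenN _)]/(lenN (map inv_up (l :: ls))) -[N.add (inv_up l) _]/(sumN (map inv_up (l :: ls))).
case E : threshold_at => [t0|]; case E' : threshold => [t1|] //= [tE] le.
- have [le0|le1] : N.le t0 q \/ N.le t1 q by lia.
    exact: base E le0.
  have [core [rest [-> h]]] := IH _ _ E' le1.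
  by exists (l :: core), rest; split=> //; rewrite -pow4S.
- by apply: base E _; rewrite tE.
- rewrite tE in E'; have [core [rest [-> h]]] := IH _ _ E' le.
  by exists (l :: core), rest; split=> //; rewrite -pow4S.
Qed.

Lemma sum_inv_ge p E : all (fun l => p <= l)%N E -> (0 < p)%N ->
  (\sum_(l <- E) (N.to_nat scale %/ l).+1 <= size E * (N.to_nat scale %/ p).+1)%N.
Proof.
move=> Ep p0; elim: E Ep => [|l E IH] /=; first by rewrite big_nil.
by case/andP=> pl /IH le; rewrite big_cons mulSn leq_add // ltnS leq_div2l.
Qed.

(** The primes of [E] enter the search only through their number and the lower bound [p], so each
    inverse is replaced by that of [p]. *)
Lemma threshold_sound n C ch E p t : ~~ odd n -> odd_primes_of n (map N.to_nat ch ++ E) ->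
  class_bound n (N.to_nat C) -> all (fun l => N.to_nat p <= l)%N E -> (0 < N.to_nat p)%N ->
  threshold C (map inv_up ch) (N.of_nat (size E)) (N.mul (N.of_nat (size E)) (inv_up p)) = Some t ->
  N.le t (N.of_nat n.+1) -> both_points n.+1.
Proof.
move=> en op Cn Ep p0 tE le; have [core [rest [chE]]] := threshold_split tE le.
rewrite -(size_map N.to_nat core) => h.
apply: (crit_at_sound (erefl _) en _ Cn _ _ _ h (rest := map N.to_nat rest ++ E)).
- by rewrite catA -map_cat -chE.
- by rewrite N2Nat.inj_add lenN_size Nat2N.id size_cat !size_map.
- rewrite big_cat /= N2Nat.inj_add sumN_inv leq_add // N2Nat.inj_mul Nat2N.id.
  by rewrite /inv_up N2Nat.inj_succ to_nat_div; apply: sum_inv_ge.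
- rewrite size_cat size_map; case: (rest) => //; case: (E) => //=.
Qed.

(** With all odd primes in the core, the criterion reduces to [C ^ 2 16 ^ s < q - 6], where [s] is
    their number. *)
Lemma all_core_sound n C s : ~~ odd n -> odd_primes_of n s -> class_bound n (N.to_nat C) ->
  (N.to_nat C ^ 2 * 16 ^ size s + 5 < n)%N -> both_points n.+1.
Proof.
move=> en op Cn big.
apply: (@crit_at_sound n C _ 0 0 s [::] (erefl _)) => //; rewrite ?cats0 ?big_nil //.
rewrite /crit_at; apply/andP; split=> //; apply/N.ltb_lt.
have pw : N.to_nat (N.pow 4 (N.of_nat (size s))) = (4 ^ size s)%N.
  by elim: (size s) => // k IH; rewrite expnS -IH Nat2N.inj_succ N.pow_succ_r'; lia.
have e16 : (16 ^ size s = 4 ^ size s * 4 ^ size s)%N by rewrite -expnMn.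
rewrite e16 -pw in big; move: big; set x := N.pow _ _; set sc := scale.
have sc0 : N.lt 0 sc by [].
move=> {}big; have lt : N.lt (N.mul (N.mul C x) (N.mul C x)) (N.sub (N.of_nat n.+1) 6) by lia.
have -> : N.sub sc (N.mul 2 0) = sc by lia.
have -> : N.add sc (N.mul 2 (N.sub (N.mul 0 sc) 0)) = sc by lia.
have := proj1 (N.mul_lt_mono_pos_r (N.mul sc sc) _ _ (N.mul_pos_pos _ _ sc0 sc0)) lt; lia.
Qed.

Lemma prime_ndvd_prod l s : prime l -> all prime s -> l \notin s -> ~~ (l %| \prod_(x <- s) x)%N.
Proof.
move=> lp; elim: s => [|x s IH] /=.
  by rewrite big_nil dvdn1; case: l lp => [|[]].
case/andP=> xp sp; rewrite in_cons negb_or => /andP[lx ls].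
by rewrite big_cons Euclid_dvdM // negb_or IH // dvdn_prime2 // lx.
Qed.

Lemma prod_odd_primes_dvdn n T s : uniq s -> all (fun l => [&& prime l, odd l & l %| n]%N) s ->
  (T %| n)%N -> T \in [:: 2; 4; 8]%N -> (T * \prod_(l <- s) l %| n)%N.
Proof.
move=> us gs Tn T2.
have sn : (\prod_(l <- s) l %| n)%N.
  elim: s us gs => [|l s IH] /=; first by rewrite big_nil dvd1n.
  case/andP=> ls us /andP[/and3P[lp ol ln] gs]; rewrite big_cons Gauss_dvd ?ln ?IH //.
  by rewrite prime_coprime // prime_ndvd_prod //; apply: sub_all gs => x /and3P[].
have os : odd (\prod_(l <- s) l).
  elim: s {us sn} gs => [|l s IH] /=; first by rewrite big_nil.
  by case/andP=> /and3P[_ ol _] gs; rewrite big_cons oddM ol IH.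
rewrite Gauss_dvd ?Tn //.
have c2 : coprime 2 (\prod_(l <- s) l) by rewrite coprime2n.
by move: T2; rewrite !inE => /or3P[] /eqP ->; [exact: c2 | exact: (coprimeXl 2 c2) | exact: (coprimeXl 3 c2)].
Qed.

Lemma leaf_bound_mono fuel C invs ip p r Q K B B' :
  leaf_bound fuel C invs ip p r Q K B = Some B' -> N.le B B'.
Proof.
elim: fuel r Q K B => [|fuel IH] r Q K B /=; first by case: ifP => // _ /Some_inj ->; lia.
case: ifP => [_ /Some_inj ->|_]; first lia.
by case: threshold => // t /IH; case: ifP; lia.
Qed.

Lemma odd_of_nat i : N.odd (N.of_nat i) = odd i.
Proof. by elim: i => // i IH; rewrite Nat2N.inj_succ N.odd_succ -N.negb_odd IH. Qed.

Lemma jtableE k i : jtable k (N.of_nat i) =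
  [seq (N.of_nat j, odd_primes_small (N.of_nat j)) | j <- iota i k].
Proof.
elim: k i => [//|k IH] i.
have -> : iota i k.+1 = i :: iota i.+1 k by [].
rewrite map_cons -IH Nat2N.inj_succ; reflexivity.
Qed.

(** * Soundness of the tree search *)

Section Tree.

Variables (pl : seq N) (C T : N) (n : nat).
Hypotheses (n_gt0 : (0 < n)%N) (n_even : ~~ odd n) (Cn : class_bound n (N.to_nat C)).
Hypotheses (Tn : (N.to_nat T %| n)%N) (T2 : N.to_nat T \in [:: 2; 4; 8]%N).
Hypothesis T_odd : N.ltb T 8 -> odd (n %/ N.to_nat T).

Definition settled := both_points n.+1 \/ N.of_nat n.+1 \in pl.

Let nat_ch (ch : seq N) := map N.to_nat ch.

Definition chain_ok (p : N) (ch : seq N) :=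
  [/\ uniq (nat_ch ch), all (fun l => [&& prime l, odd l & l %| n]%N) (nat_ch ch),
      all (fun l => l < N.to_nat p)%N (nat_ch ch) &
      forall l, prime l -> odd l -> (l %| n)%N -> l \in nat_ch ch \/ (N.to_nat p <= l)%N].

Definition extra (ch : seq N) := [seq l <- primes n | odd l && (l \notin nat_ch ch)].

Lemma extra_primes p ch : chain_ok p ch -> odd_primes_of n (nat_ch ch ++ extra ch).
Proof.
case=> uc gc _ _; split.
- rewrite cat_uniq uc filter_uniq ?primes_uniq // andbT; apply/hasPn => l.
  by rewrite mem_filter => /andP[/andP[]].
- rewrite all_cat gc; apply/allP => l; rewrite mem_filter mem_primes n_gt0.
  by case/andP=> /andP[-> _] /and3P[-> _ ->].
move=> l lp ol ln; rewrite mem_cat mem_filter mem_primes lp ol n_gt0 ln.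
by case: (l \in _).
Qed.

Lemma extra_ge p ch : chain_ok p ch -> all (fun l => N.to_nat p <= l)%N (extra ch).
Proof.
case=> _ _ _ cc; apply/allP => l; rewrite mem_filter mem_primes => /andP[/andP[ol nl] /and3P[lp _ ln]].
by case: (cc l lp ol ln) => // lc; rewrite lc in nl.
Qed.

Lemma chain_extra_le p ch : chain_ok p ch ->
  (N.to_nat T * \prod_(l <- nat_ch ch) l * N.to_nat p ^ size (extra ch) <= n)%N.
Proof.
move=> ok; have [ue ge _] := extra_primes ok.
have := dvdn_leq n_gt0 (prod_odd_primes_dvdn ue ge Tn T2); apply: leq_trans.
rewrite -mulnA leq_mul2l big_cat leq_mul2l /=; apply/orP; right; apply/orP; right.
elim: (extra ch) (extra_ge ok) => [|l s IH] /=; first by rewrite big_nil.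
by case/andP=> pl' /IH le; rewrite big_cons expnS leq_mul.
Qed.

(** The recursion either stops early or reaches the true number [r] of extra primes. There, either
    [q] is at least the threshold [t] and the sieve succeeds, or [t > q >= Q + 1], so that [t] has
    been recorded in the bound [B']. *)
Lemma leaf_boundP fuel ch p r Q K B B' : chain_ok p ch -> (16 <= N.to_nat p)%N ->
  (N.to_nat r <= size (extra ch))%N ->
  (N.to_nat Q * N.to_nat p ^ (size (extra ch) - N.to_nat r) <= n)%N ->
  N.to_nat K = (N.to_nat C ^ 2 * 16 ^ (size ch + N.to_nat r))%N ->
  leaf_bound fuel C (map inv_up ch) (inv_up p) p r Q K B = Some B' ->
  both_points n.+1 \/ (n.+1 < N.to_nat B')%N.
Proof.
move=> ok p16; have op := extra_primes ok.
(* Each further prime multiplies [Q1] by at least [p >= 16] and [K1] by 16, so the inequality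
   [5 + K1 < Q1] persists. *)
have en i (Q1 K1 : N) : N.lt (N.add 5 K1) Q1 -> (N.to_nat Q1 * N.to_nat p ^ i <= n)%N ->
    (N.to_nat K1 * 16 ^ i + 5 < n)%N.
  move=> lt; apply: leq_trans; apply: (@leq_trans (N.to_nat Q1 * 16 ^ i)); last first.
    by rewrite leq_mul2l; case: i => [|i]; rewrite ?orbT // leq_exp2r // p16 orbT.
  have : (0 < 16 ^ i)%N by rewrite expn_gt0.
  by move: (16 ^ i)%N lt => x; nia.
have final r1 Q1 K1 : (N.to_nat r1 <= size (extra ch))%N -> N.lt (N.add 5 K1) Q1 ->
    (N.to_nat Q1 * N.to_nat p ^ (size (extra ch) - N.to_nat r1) <= n)%N ->
    N.to_nat K1 = (N.to_nat C ^ 2 * 16 ^ (size ch + N.to_nat r1))%N -> both_points n.+1.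
  move=> rE lt Qn KE; apply: (all_core_sound n_even op Cn).
  have := en _ _ _ lt Qn; rewrite KE -mulnA -expnD -addnA subnKC //.
  by rewrite size_cat size_map.
elim: fuel r Q K B => [|fuel IH] r Q K B rE Qn KE /=.
  by case: N.ltb_spec0 => // lt _; left; apply: final rE lt Qn KE.
case: N.ltb_spec0 => [lt _|_]; first by left; apply: final rE lt Qn KE.
case tE : threshold => [t|] // lb.
move: rE; rewrite leq_eqVlt => /orP[/eqP rE|rE]; last first.
  apply: IH lb; rewrite ?N2Nat.inj_succ //.
    by rewrite N2Nat.inj_mul -mulnA -expnS -subSn // subSS.
  by rewrite addnS [(16 ^ _.+1)%N]expnS mulnCA -KE; case: (K) => [|x] //; lia.
have rN : r = N.of_nat (size (extra ch)) by lia.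
have := leaf_bound_mono lb; rewrite rE subnn muln1 in Qn.
have [le|lt] : N.le t (N.of_nat n.+1) \/ N.lt (N.of_nat n.+1) t by lia.
  by move=> _; left; move: tE; rewrite rN => tE; apply: (threshold_sound n_even op Cn (extra_ge ok) _ tE le); lia.
by case: N.ltb_spec0 => h le; right; lia.
Qed.

Lemma leaf_runP TM J p skip ch (f : nat -> seq N) i k certs certs' :
  leaf_run pl C TM J p skip ch [seq (N.of_nat j, f j) | j <- iota i k] certs = Some certs' ->
  forall j, (i <= j)%N -> (j <= N.to_nat J)%N ->
  let new := filter (fun l => ~~ memN l ch) (f j) in
  [\/ skip && ~~ odd j, has (fun l => N.ltb l p) new |
    exists c c', candidate pl C (N.succ (N.mul TM (N.of_nat j))) (ch ++ new) c = Some c'].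
Proof.
elim: k i certs => [|k IH] i certs //=.
case: N.ltb_spec0 => [lt _ j ij jJ|_]; first by lia.
set new := filter _ (f i).
case: ifP => [skp /IH H j ij jJ|_].
  move: ij; rewrite leq_eqVlt => /orP[/eqP <-|ij]; last exact: H.
  case/orP: skp => [skp|]; last by constructor 2.
  by constructor 1; rewrite -odd_of_nat.
case cE : candidate => [c|] // /IH H j ij jJ.
move: ij; rewrite leq_eqVlt => /orP[/eqP <-|ij]; last exact: H.
by constructor 3; exists certs, c.
Qed.

Lemma memNE x s : memN x s = (N.to_nat x \in map N.to_nat s).
Proof.
elim: s => //= y s IH; rewrite in_cons -IH; congr (_ || _).
by apply/N.eqb_spec/eqP => [->|/N2Nat.inj].
Qed.

Lemma next_odd (x l : nat) : odd x -> odd l -> l != x -> (x <= l)%N -> (x.+2 <= l)%N.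
Proof.
move=> ox ol lx xl; have xl' : (x < l)%N by rewrite ltn_neqAle eq_sym lx.
by rewrite ltn_neqAle xl' andbT; apply/eqP => e; move: ol; rewrite -e /= ox.
Qed.

Lemma to_nat_add2 p : N.to_nat (N.add 2 p) = (N.to_nat p).+2.
Proof. by rewrite N2Nat.inj_add. Qed.

Lemma chain_ok_skip p ch : odd (N.to_nat p) -> ~~ (prime (N.to_nat p) && (N.to_nat p %| n))%N ->
  chain_ok p ch -> chain_ok (N.add 2 p) ch.
Proof.
move=> op np [u g lt cc]; split=> //.
  by apply: sub_all lt => l; rewrite to_nat_add2 => /ltn_trans; apply.
move=> l lp ol ln; case: (cc l lp ol ln) => [|pl']; [by left|right].
rewrite to_nat_add2; apply: next_odd => //; apply: contra np => /eqP <-.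
by rewrite lp ln.
Qed.

Lemma chain_ok_add p ch : odd (N.to_nat p) -> prime (N.to_nat p) -> (N.to_nat p %| n)%N ->
  chain_ok p ch -> chain_ok (N.add 2 p) (ch ++ [:: p]).
Proof.
move=> op pp pn [u g lt cc]; rewrite /chain_ok /nat_ch map_cat /=; split.
- by rewrite cats1 rcons_uniq u andbT; apply/negP => /(allP lt); rewrite ltnn.
- by rewrite all_cat g /= pp op pn.
- rewrite all_cat; apply/andP; split; last by rewrite /= andbT to_nat_add2.
  by apply: sub_all lt => l; rewrite to_nat_add2 => /ltn_trans; apply.
move=> l lp ol ln; rewrite mem_cat inE; case: (cc l lp ol ln) => [->|pl']; first by left.
have [->|lE] := eqVneq l (N.to_nat p); first by rewrite orbT; left.
by right; rewrite to_nat_add2; apply: next_odd.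
Qed.

Lemma proper_factor_not_prime p : has_proper_factor p -> prime (N.to_nat p) = false.
Proof.
case/hasP=> d _ /and3P[/N.ltb_lt d1 /N.ltb_lt dp]; rewrite /hasdiv.
case E : N.modulo => // _; apply/negP => /primeP[_ /(_ (N.to_nat d))].
have -> : (N.to_nat d %| N.to_nat p)%N.
  apply/dvdnP; exists (N.to_nat (N.div p d)).
  by rewrite {1}(N.div_mod p d) ?E; lia.
by move=> /(_ isT) /orP[] /eqP; lia.
Qed.

Variables (f : nat -> seq N) (k : nat).
Hypothesis fP : forall j, (0 < j <= 1500)%N -> map N.to_nat (f j) = [seq l <- primes j | odd l].
Let tab := [seq (N.of_nat j, f j) | j <- iota 1 k].

(** Below the leaf bound, [n = M j] with [j <= J], so [n] corresponds to a row of the table, and its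
    odd primes are those of [ch] together with those of [j]. A skipped row cannot be this one: an
    even [j] contradicts the class of [q], and a new prime below [p] contradicts [chain_ok]. *)
Lemma leaf_settled M J p ch certs certs' B : chain_ok p ch -> (16 <= N.to_nat p)%N ->
  N.to_nat M = (N.to_nat T * \prod_(l <- nat_ch ch) l)%N ->
  leaf_bound 30 C (map inv_up ch) (inv_up p) p 0 M (N.mul (N.mul C C) (N.pow 16 (lenN ch))) 0 = Some B ->
  J = N.div B M -> N.leb J 1500 ->
  leaf_run pl C M J p (N.ltb T 8) ch tab certs = Some certs' -> settled.
Proof.
move=> ok p16 ME lb JE /N.leb_le J1500 lr; have [uc gc _ cc] := ok.
have [] := leaf_boundP ok p16 _ _ _ lb => //.
- by rewrite subn0 ME chain_extra_le.
- rewrite addn0 !N2Nat.inj_mul -mulnn; congr (_ * _)%N.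
  by elim: (ch) => //= _ s IH; rewrite N.pow_succ_r' N2Nat.inj_mul IH expnS.
- by left.
move=> nB.
have Mn : (N.to_nat M %| n)%N by rewrite ME prod_odd_primes_dvdn.
have M0 : (0 < N.to_nat M)%N by rewrite (dvdn_gt0 n_gt0 Mn).
set j := (n %/ N.to_nat M)%N; have nE : n = (N.to_nat M * j)%N by rewrite mulnC divnK.
have j0 : (0 < j)%N by rewrite divn_gt0 // dvdn_leq.
have jJ : (j <= N.to_nat J)%N by rewrite JE to_nat_div leq_div2r // ltnW // ltnW.
have fj := fP (j := j); rewrite j0 (leq_trans jJ) in fj; last by lia.
have jn : (j %| n)%N by rewrite nE dvdn_mull.
set new := filter (fun l => ~~ memN l ch) (f j).
have newP l : l \in new -> [/\ prime (N.to_nat l), odd (N.to_nat l), (N.to_nat l %| j)%N & N.to_nat l \notin nat_ch ch].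
  rewrite mem_filter memNE => /andP[nl /(map_f N.to_nat)]; rewrite fj // mem_filter mem_primes.
  by case/andP=> ol /and3P[lp _ lj].
case: (leaf_runP lr j0 jJ) => [/andP[/T_odd oT ej]|/hasP[l /newP[lp ol lj nl] /N.ltb_lt llt]|[c [c' cE]]].
- move: oT; rewrite nE ME -mulnA mulKn ?oddM; last by have := dvdn_gt0 n_gt0 Tn.
  by rewrite (negPf ej) andbF.
- by case: (cc _ lp ol (dvdn_trans lj jn)) => [lc|]; [rewrite lc in nl | lia].
apply: (candidateP n_even _ Cn (ls := ch ++ new) (certs := c) (certs' := c')).
  split.
  - rewrite map_cat cat_uniq uc /=; apply/andP; split.
      by apply/hasPn => _ /mapP[l /newP[_ _ _ nl] ->].
    apply: (@subseq_uniq _ _ (map N.to_nat (f j))); first by apply/map_subseq/filter_subseq.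
    by rewrite fj // filter_uniq ?primes_uniq.
  - rewrite map_cat all_cat gc; apply/allP => _ /mapP[l /newP[lp ol lj _] ->].
    by rewrite lp ol (dvdn_trans lj jn).
  move=> l lp ol ln; rewrite map_cat mem_cat.
  have [//|nlc] := boolP (l \in map N.to_nat ch).
  have lj : (l %| j)%N.
    move: ln; rewrite nE ME -mulnA Euclid_dvdM // => /orP[|].
      move=> lT; have : (l %| 2 ^ 3)%N.
        by apply: dvdn_trans lT _; move: T2; rewrite !inE => /or3P[] /eqP ->.
      by rewrite Euclid_dvdX // andbT dvdn_prime2 // => /eqP l2; rewrite l2 in ol.
    rewrite Euclid_dvdM // => /orP[|//]; rewrite (negPf (prime_ndvd_prod lp _ nlc)) //.
    by apply: sub_all gc => x /and3P[].
  have : l \in map N.to_nat (f j) by rewrite fj // mem_filter ol mem_primes lp j0 lj.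
  case/mapP=> x xf lE; rewrite lE map_f // mem_filter memNE -lE xf andbT //.
by rewrite -cE; congr candidate; rewrite {1}nE; lia.
Qed.

Lemma nodeP fuel p ch M certs certs' : odd (N.to_nat p) -> chain_ok p ch ->
  N.to_nat M = (N.to_nat T * \prod_(l <- nat_ch ch) l)%N ->
  node tab pl C T fuel p ch M certs = Some certs' -> settled.
Proof.
elim: fuel p ch M certs certs' => // fuel IH p ch M certs certs' op ok ME.
have op2 : odd (N.to_nat (N.add 2 p)) by rewrite to_nat_add2 /= negbK.
cbn [node]; case: ifP => [/proper_factor_not_prime np|_].
  by apply: IH => //; apply: chain_ok_skip; rewrite // np.
set b := if N.ltb p 17 then None else _; cbn zeta; set J := match b with None => _ | _ => _ end.
case: ifP => [J1500|_].
  move: J1500; rewrite /J; case bE : b => [B|] // J1500; move: bE; rewrite /b.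
  case: N.ltb_spec0 => // p17 lb lr.
  by apply: leaf_settled lb (erefl _) J1500 lr => //; lia.
case E : node => [c|] //; have [/andP[pp pn] _|np] := boolP (prime (N.to_nat p) && (N.to_nat p %| n))%N.
  apply: IH E => //; first exact: chain_ok_add.
  by rewrite /nat_ch map_cat big_cat big_seq1 mulnA -ME N2Nat.inj_mul.
by apply: IH => //; apply: chain_ok_skip.
Qed.

End Tree.

Lemma chain_ok_nil n : ~~ odd n -> chain_ok n 3 [::].
Proof. by move=> en; split=> // l lp ol _; right; have := prime_gt1 lp; lia. Qed.

Lemma runP k fuel pl certs :
  (forall j, (0 < j <= 1500)%N -> map N.to_nat (odd_primes_small (N.of_nat j)) = [seq l <- primes j | odd l]) ->
  run k fuel pl certs -> forall n, (0 < n)%N -> ~~ odd n -> settled pl n.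
Proof.
move=> fP; rewrite /run -[1%num]/(N.of_nat 1) jtableE.
case E8 : node => [c8|] //; case E4 : node => [c4|] //; case E2 : node => [c2|] // _ n n0 en.
have ok := chain_ok_nil en.
(* The cases are [n = 2 j] and [n = 4 j] with [j] odd, and [8 %| n]; the constants 4, 8 and 16 are 4
   times the parity factors. *)
have [h2|h2] := boolP (odd n./2).
  apply: (nodeP n0 en _ _ _ _ fP _ ok _ E2) => //=.
  - by move=> F cF; rewrite /parity_factor cF h2.
  - by rewrite dvdn2.
  - by move=> _; rewrite divn2.
  - by rewrite big_nil.
have [h4|h4] := boolP (odd n./2./2).
  apply: (nodeP n0 en _ _ _ _ fP _ ok _ E4) => //=.
  - by move=> F cF; rewrite /parity_factor cF (negPf h2) h4.
  - lia.
  - by move=> _; rewrite (_ : (n %/ _ = n./2./2)%N) // -!divn2 -divnMA.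
  - by rewrite big_nil.
apply: (nodeP n0 en _ _ _ _ fP _ ok _ E8) => //=.
- by move=> F cF; rewrite /parity_factor; case: ifP => // _; case: ifP.
- lia.
- by rewrite big_nil.
Qed.

(** * Proper prime powers and the fields of the statement *)

HB.instance Definition _ := hasDecEq.Build positive Pos.eqb_spec.

(** * Fields presented by one polynomial relation *)

Section ListEval.

Variables (R : comUnitRingType) (tau : R).

Definition list_eval (v : seq N) : R := foldr (fun c acc => nr R c + tau * acc) 0 v.

Lemma list_eval_addl u v : list_eval (addl u v) = list_eval u + list_eval v.
Proof.
elim: u v => [|x u IH] [|y v] /=; rewrite ?add0r ?addr0 //.
by rewrite IH nrD; ring.
Qed.

Lemma list_eval_scalel c v : list_eval (scalel c v) = nr R c * list_eval v.
Proof. by elim: v => [|x v IH] /=; rewrite ?mulr0 // IH nrM; ring. Qed.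

Lemma list_eval_rcons s c : list_eval (rcons s c) = list_eval s + tau ^+ size s * nr R c.
Proof.
elim: s => [|x s IH] /=; first by rewrite mulr0 addr0 add0r mul1r.
by rewrite IH exprS; ring.
Qed.

Lemma list_eval_const c k : list_eval (c :: nseq k 0%num) = nr R c.
Proof.
rewrite /= (_ : list_eval _ = 0) ?mulr0 ?addr0 //.
by elim: k => //= k ->; rewrite mulr0 addr0.
Qed.

Lemma is_constP c v : is_const c v -> list_eval v = nr R c.
Proof.
case: v => //= x s /andP[/N.eqb_eq -> s0]; rewrite (_ : list_eval s = 0) ?mulr0 ?addr0 //.
elim: s s0 => // y s IH /andP[/N.eqb_spec y0 /IH sE].
by rewrite /= sE -y0 mulr0 addr0.
Qed.

Variables (p : N) (h : seq N).
Hypothesis p_gt0 : (0 < N.to_nat p)%N.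
Hypothesis p0 : nr R p = 0.
Hypothesis root_h : tau ^+ size h = list_eval h.

Lemma nr_modp x : nr R (N.modulo x p) = nr R x.
Proof.
have pn : p <> 0%num by lia.
by rewrite {2}(N.div_mod x p pn) nrD nrM p0 mul0r add0r.
Qed.

Lemma nr_predp : nr R (N.pred p) = -1.
Proof.
apply/eqP; rewrite -addr_eq0 -[1]/(nr R 1) -nrD; apply/eqP; rewrite -p0; congr nr; lia.
Qed.

Lemma list_eval_mulx v : list_eval (mulx h v) = tau * list_eval v.
Proof.
rewrite /mulx; case: eqP => [sz|_]; last by rewrite /= /nr add0r.
rewrite list_eval_addl list_eval_scalel -root_h -sz.
have := list_eval_rcons (belast 0%num v) (last 0%num v); rewrite -lastI size_belast.
by rewrite /= {1}/nr add0r => ->; ring.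
Qed.

Lemma list_eval_mull u v : list_eval (mull p h u v) = list_eval u * list_eval v.
Proof.
rewrite /mull; set w := foldr _ _ _.
have -> : list_eval [seq N.modulo x p | x <- w] = list_eval w.
  by elim: w => //= x w ->; rewrite nr_modp.
rewrite /w {w}; elim: u => [|c u IH] /=; first by rewrite mul0r.
by rewrite list_eval_addl list_eval_scalel list_eval_mulx IH; ring.
Qed.

Lemma list_eval_gen : list_eval (gen_elt h) = tau.
Proof. by rewrite /gen_elt list_eval_mulx list_eval_const mulr1. Qed.

Definition sgn (s : bool) : R := if s then 1 else -1.

Lemma list_eval_cubic s z : list_eval (cubic_elt p h s z) = list_eval z ^+ 3 + sgn s * list_eval z.
Proof.
rewrite /cubic_elt list_eval_mull list_eval_addl list_eval_mull /= mulr0 addr0 /sgn.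
by case: s; rewrite ?nr_predp -?[nr R 1]/(1 : R); ring.
Qed.

Lemma order_listP z e ls ws : order_list p h z e ls = Some ws ->
  list_eval z ^+ Pos.to_nat e = 1 /\ forall l, l \in map Pos.to_nat ls ->
    exists2 w, w \in ws & list_eval w = list_eval z ^+ (Pos.to_nat e %/ l)%N.
Proof.
rewrite /order_list; case E : N.div_eucl => [[|c] [|]] //.
have eE : (Pos.to_nat e = Pos.to_nat c * Pos.to_nat (prodp ls))%N.
  by have := N.div_eucl_spec (Npos e) (Npos (prodp ls)); rewrite E; lia.
case O : ordlist => [f ws']; case: ifP => // /is_constP f1 [<-].
have [fE wE] := ordlistP list_eval_mull O; rewrite (powpE list_eval_mull) in fE wE.
rewrite eE; split; first by rewrite exprM -fE f1.
move=> l lls; have [i [iws /(_ [::]) wi]] := wE _ lls.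
exists (nth [::] ws' i); first exact: mem_nth.
by rewrite wi -exprM -muln_divA // prodpE (big_rem _ lls) /= dvdn_mulr.
Qed.

Lemma no_onesP e ws : no_ones p h e ws -> forall w, w \in ws -> list_eval w != 1.
Proof.
rewrite /no_ones; set W := foldr _ _ _ => /is_constP; rewrite (powpE list_eval_mull) => W1 w ww.
apply/eqP => w1; have W0 : list_eval W = 0.
  rewrite /W; elim: ws ww {W W1} => //= x ws IH; rewrite in_cons list_eval_mull list_eval_addl.
  case/orP => [/eqP <-|/IH ->]; last by rewrite mulr0.
  by rewrite w1 /= mulr0 addr0 nr_predp subrr mul0r.
move/eqP: W1; rewrite W0 expr0n -[nr R 1]/(1 : R).
by case: (Pos.to_nat e) (Pos2Nat.is_pos e) => [|k _]; [lia | rewrite eq_sym oner_eq0].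
Qed.

End ListEval.

Lemma list_eval_rmorph (R S : comUnitRingType) (phi : {rmorphism R -> S}) tau v :
  phi (list_eval tau v) = list_eval (phi tau) v.
Proof.
elim: v => [|c v IH] /=; first exact: rmorph0.
by rewrite rmorphD rmorphM IH /nr rmorph_nat.
Qed.

Lemma size_lev_polyX (F : fieldType) v : (size (list_eval ('X : {poly F}) v) <= size v)%N.
Proof.
elim: v => [|c v IH] /=; first by rewrite size_poly0.
apply: leq_trans (size_polyD _ _) _; rewrite geq_max; apply/andP; split.
  by rewrite /nr -polyC_natr (leq_trans (size_polyC_leq1 _)).
by apply: leq_trans (size_polyMleq _ _) _; rewrite size_polyX.
Qed.

(** The polynomial ['X^(size h)] minus the relation is monic of positive degree for any [h], so it
    has a root in some extension. *)
Lemma splitting_root (F : finFieldType) (h : seq N) : (0 < size h)%N ->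
  exists (L : splittingFieldType F) (z : L), z ^+ size h = list_eval z h.
Proof.
move=> h0; pose P : {poly F} := 'X^(size h) - list_eval 'X h.
have szP : size P = (size h).+1.
  by rewrite /P size_polyDl ?size_polyXn // size_polyN ltnS size_lev_polyX.
have P0 : P != 0 by rewrite -size_poly_eq0 szP.
have [L [rs PE _]] := FinSplittingFieldFor P0; exists L.
have szr : (0 < size rs)%N.
  by have := eqp_size PE; rewrite size_map_poly szP size_prod_XsubC => -[<-].
exists (nth 0 rs 0); set z := nth 0 rs 0.
have : root (map_poly (in_alg L) P) z by rewrite (eqp_root PE) root_prod_XsubC mem_nth.
rewrite /root /P rmorphB rmorphXn /= map_polyX hornerD hornerN hornerXn subr_eq0 => /eqP ->.
have := list_eval_rmorph (horner_eval z \o map_poly (in_alg L)) ('X : {poly F}) h.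
by rewrite /= /horner_eval map_polyX hornerX.
Qed.

(** ['X^q - 'X] is the product of the ['X - x] over the [x] in [F], so its roots in an extension
    come from [F]. *)
Lemma fixed_by_card (F : finFieldType) (L : splittingFieldType F) (z : L) :
  z ^+ #|F| = z -> exists x : F, z = x%:A.
Proof.
move=> zq; have := congr1 (fun P : {poly F} => (map_poly (in_alg L) P).[z]) (finField_genPoly F).
rewrite rmorphB rmorphXn /= map_polyX hornerD hornerN hornerXn hornerX zq subrr.
rewrite rmorph_prod horner_prod => /esym/eqP/prodf_eq0[x _].
by rewrite rmorphB /= map_polyX map_polyC hornerXsubC subr_eq0 => /eqP ->; exists x.
Qed.

Lemma prime_coverP e ls l : prime_cover e ls -> prime l -> (l %| Pos.to_nat e)%N ->
  l \in map Pos.to_nat ls.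
Proof.
case/andP=> /allP pls; rewrite /hasdiv; case E : N.modulo => // _ lp le.
have : (l %| Pos.to_nat (prodp ls) ^ 30)%N.
  apply: dvdn_trans le _; apply/dvdnP; exists (N.to_nat (N.div (N.pow (Npos (prodp ls)) 30) (Npos e))).
  have pw k : N.to_nat (N.pow (Npos (prodp ls)) (N.of_nat k)) = (Pos.to_nat (prodp ls) ^ k)%N.
    by elim: k => // k IH; rewrite Nat2N.inj_succ N.pow_succ_r' N2Nat.inj_mul IH expnS.
  rewrite -(pw 30) -[N.of_nat 30]/(30%num).
  have := N.div_mod (N.pow (Npos (prodp ls)) 30) (Npos e); rewrite E N.add_0_r.
  move=> H; have {H} H := H (fun e0 => match e0 with end).
  by rewrite {1}H N2Nat.inj_mul mulnC.
rewrite Euclid_dvdX // andbT prodpE Euclid_dvd_prod // big_has => /hasP[x xls /= lx].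
have xp := pls _ xls; move: lx; rewrite dvdn_prime2 // => /eqP ->; exact: xls.
Qed.

Lemma prime_cover_primes e ls : prime_cover e ls -> all prime (map Pos.to_nat ls).
Proof. by case/andP. Qed.

(** Each alternative makes [v] zero or gives [y ^ c = 1] with [0 < c < n] for a primitive [y]. A
    nonsquare cubic value would give [-1 = v ^ n = 1], where [-1 = x ^ (n / 2)]. For [l >= 3],
    [(v ^ 2) ^ (n / l) = 1] has exponent [2 n / l < n]; the entry 4 catches fourth powers, which the
    primes alone would miss. *)
Lemma excluded_sound (F : finFieldType) (x : F) p h e ls s z u v :
  (0 < N.to_nat p)%N -> nr F p = 0 -> x ^+ size h = list_eval x h ->
  odd #|F| -> #|F|.-1 = Pos.to_nat e -> Pos.mul 2 (Pos.div2 e) = e ->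
  all prime (map Pos.to_nat (ls ++ [:: 2%positive])) ->
  (Pos.to_nat e).-primitive_root x -> (Pos.to_nat e).-primitive_root u ->
  (Pos.to_nat e).-primitive_root v -> v ^+ 2 = u ^+ 3 + sgn F s * u ->
  list_eval x z = u -> excluded p h e ls s z -> False.
Proof.
move=> p_gt0 p0 xh oF nE mE pls xp up vp uv zu; set n := Pos.to_nat e in nE xp up vp.
have n0 : (0 < n)%N by rewrite /n; lia.
have list_evalM := list_eval_mull p_gt0 p0 xh.
have fE : list_eval x (cubic_elt p h s z) = v ^+ 2 by rewrite uv (list_eval_cubic p_gt0 p0 xh) zu.
have v0 : v != 0.
  by apply/eqP => v0; have := prim_expr_order vp; rewrite v0 expr0n (gtn_eqF n0) => /esym/eqP; rewrite oner_eq0.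
have pwP w l : pow_is_one p h e w l -> exists c, n = (c * Pos.to_nat l)%N /\ list_eval x w ^+ c = 1.
  rewrite /pow_is_one; case E : N.div_eucl => [[|c] [|]] // /(@is_constP _ x); rewrite (powpE list_evalM) => wc.
  exists (Pos.to_nat c); split=> //; rewrite /n.
  by have := N.div_eucl_spec (Npos e) (Npos l); rewrite E; lia.
have small y c : n.-primitive_root y -> (0 < c < n)%N -> y ^+ c <> 1.
  move=> yp /andP[c0 cn] /eqP; rewrite -(prim_order_dvd yp) => /dvdn_leq -/(_ c0).
  by rewrite leqNgt cn.
rewrite /excluded => /or4P[].
- case/hasP=> l lls /pwP[c [nc]]; rewrite zu; apply: small => //.
  have l2 : (1 < Pos.to_nat l)%N by apply/prime_gt1/(allP pls)/(map_f Pos.to_nat lls).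
  by rewrite nc in n0 *; nia.
- by move/(@is_constP _ x); rewrite fE => /eqP; rewrite expf_eq0 (negPf v0).
- move/(@is_constP _ x); rewrite (powpE list_evalM) fE -exprM (nr_predp p_gt0 p0).
  have -> : (2 * Pos.to_nat (Pos.div2 e))%N = n by rewrite /n -{2}mE; lia.
  rewrite (prim_expr_order vp) => e1; have n_even : ~~ odd n.
    by rewrite -nE; move: oF; rewrite -(prednK (finField_card_gt0 F)).
  have nh : n = n./2.*2 by rewrite -[LHS]odd_double_half (negPf n_even).
  have h0' : (0 < n./2)%N by rewrite -double_gt0 -nh.
  have := primitive_rootN1 h0' (_ : n./2.*2.-primitive_root x); rewrite -nh => /(_ xp).
  by rewrite -e1; apply: small => //; rewrite h0' {2}nh -addnn -{1}[n./2]addn0 ltn_add2l h0'.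
case/hasP=> l _ /andP[/Pos.leb_le l3] /pwP[c [nc]].
rewrite fE -exprM; apply: small => //.
by rewrite nc in n0 *; nia.
Qed.

Section ExtField.

Variables (F : finFieldType) (p : N) (h : seq N).
Hypothesis F_card : #|F| = N.to_nat (ext_card p h).

Let n := Pos.to_nat (ext_exp p h).

(** The list computation is read first at a root [z] in a splitting field, where it gives
    [z ^ n = 1]. Hence [z] comes from some [x] in [F], which satisfies the same relation, and the
    computation is read again at [x]. *)
Lemma gen_testP ws : gen_test p h = Some ws ->
  [/\ (0 < N.to_nat p)%N, nr F p = 0, (0 < size h)%N, #|F|.-1 = n &
  exists x : F, [/\ x ^+ size h = list_eval x h, x ^+ n = 1 &
    forall l, prime l -> (l %| n)%N -> exists2 w, w \in ws & list_eval x w = x ^+ (n %/ l)%N]].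
Proof.
rewrite /gen_test; case: ifP => // /and4P[pp h0 /N.ltb_lt card1 cov] ol.
have p_gt0 := prime_gt0 pp.
have cE : N.to_nat (ext_card p h) = (N.to_nat p ^ size h)%N.
  rewrite /ext_card -(lenN_size h); move: (lenN h) => k; rewrite N2Nat.inj_pow.
  by elim: (N.to_nat k) => //= j ->; rewrite expnS.
have pF : N.to_nat p \in [pchar F] by apply: (card_finPcharP (n := size h)) => //; rewrite F_card cE.
have nE : #|F|.-1 = n.
  rewrite F_card /n /ext_exp; move: (ext_card p h) card1 => c c1.
  by case E : (N.pred c) => [|q]; rewrite /pos_of; lia.
have nr0 (R : comUnitRingType) : N.to_nat p \in [pchar R] -> nr R p = 0 by move/pcharf0.
split=> //; first exact: nr0.
have [L [z zh]] := splitting_root F h0.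
have pL : N.to_nat p \in [pchar L] by rewrite (fmorph_pchar (in_alg L)).
have [z1 _] := order_listP p_gt0 (nr0 _ pL) zh ol.
rewrite (list_eval_gen zh) in z1.
have [x zx] : exists x : F, z = x%:A.
  apply: fixed_by_card; rewrite -(prednK (finField_card_gt0 F)) nE exprS.
  by rewrite z1 mulr1.
exists x; have xh : x ^+ size h = list_eval x h.
  apply: (fmorph_inj (in_alg L)); rewrite list_eval_rmorph rmorphXn /= -zx; exact: zh.
have [x1 xl] := order_listP p_gt0 (nr0 _ pF) xh ol.
rewrite (list_eval_gen xh) in x1 xl.
split=> // l lp ln; apply: xl; exact: prime_coverP ln.
Qed.

Lemma gen_test_primes ws : gen_test p h = Some ws ->
  all prime (map Pos.to_nat (ext_primes p h ++ [:: 2%positive])).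
Proof.
rewrite /gen_test; case: ifP => // /and4P[_ _ _ cov] _.
exact: prime_cover_primes cov.
Qed.

Lemma primitive_elt_root (x : F) : primitive_elt x -> #|F|.-1.-primitive_root x.
Proof.
case=> x0 gen; have n0 := card_pred_gt0 F.
have [m xm mn] := prim_order_exists n0 (expf_card_pred x0).
suff -> : #|F|.-1 = m by [].
have [g gP] := primitive_root_exists F.
have g0 : g != 0 by rewrite -[g]expr1 (gen_neq0 gP).
apply/eqP; rewrite eqn_dvd mn andbT (prim_order_dvd gP); have [k ->] := gen g g0.
by rewrite -exprM mulnC exprM (prim_expr_order xm) expr1n.
Qed.

Lemma point_testP s : odd #|F| -> point_test p h s -> has_primitive_point (sgn F s).
Proof.
move=> oF; rewrite /point_test; case G : gen_test => [ws|] //.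
have [p_gt0 p0 h0 nE [x [xh x1 xl]]] := gen_testP G.
set ls := if _ then _ else _; set m := Pos.div2 _.
case O : order_list => [ws'|] // /and3P[/Pos.eqb_eq mE cov no].
have [f1 fl] := order_listP p_gt0 p0 xh O.
rewrite (list_eval_cubic p_gt0 p0 xh) (list_eval_gen xh) in f1 fl.
have none := no_onesP p_gt0 p0 xh no.
have mE2 : #|F|.-1./2 = Pos.to_nat m by rewrite nE /n -mE; lia.
apply: (point_of_orders (x := x)) => //.
  rewrite nE; apply: prim_root_of_prime_divisors => //; first by rewrite /n; lia.
  by move=> l lp ln; have [w ww <-] := xl l lp ln; apply: none; rewrite mem_cat ww.
rewrite mE2; apply: prim_root_of_prime_divisors => //; first by lia.
move=> l lp lm; have [w ww <-] := fl l (prime_coverP cov lp lm).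
by apply: none; rewrite mem_cat ww orbT.
Qed.

Lemma all_powersP (tau : F) k test z : (forall u, list_eval tau (mull p h (gen_elt h) u) = tau * list_eval tau u) ->
  all_powers p h k test z -> forall i, (i < k)%N ->
  exists2 u, test u & list_eval tau u = tau ^+ i * list_eval tau z.
Proof.
move=> step; elim: k z => //= k IH z /andP[tz rec] [|i] ik.
  by exists z; rewrite ?mul1r.
have [u tu uE] := IH _ rec i ik; exists u => //.
by rewrite uE step exprSr mulrA.
Qed.

Lemma no_point_testP s : odd #|F| -> no_point_test p h s -> ~ has_primitive_point (sgn F s).
Proof.
move=> oF; rewrite /no_point_test; case G : gen_test => [ws|] //.
have [p_gt0 p0 h0 nE [x [xh x1 xl]]] := gen_testP G.
case/and3P=> /Pos.eqb_eq mE no pows [u [v [uv [/primitive_elt_root up /primitive_elt_root vp]]]].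
have none := no_onesP p_gt0 p0 xh no.
have n0 : (0 < n)%N by rewrite /n; lia.
have xp : n.-primitive_root x.
  apply: prim_root_of_prime_divisors => // l lp ln.
  by have [w ww <-] := xl l lp ln; apply: none.
rewrite nE in up vp.
have [i ui] := prim_rootP xp (prim_expr_order up).
have step z : list_eval x (mull p h (gen_elt h) z) = x * list_eval x z.
  by rewrite (list_eval_mull p_gt0 p0 xh) (list_eval_gen xh).
have [z tz] := all_powersP step pows (ltn_ord i).
rewrite list_eval_const mulr1 -ui => zu.
exact: (excluded_sound p_gt0 p0 xh oF nE mE (gen_test_primes G) xp up vp uv zu tz).
Qed.

End ExtField.

Definition dichotomy (F : finFieldType) :=
  (has_primitive_point (-1 : F) <-> #|F| \notin [:: 3; 7; 13; 17; 25; 49; 121]%N) /\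
  (has_primitive_point (1 : F) <-> #|F| \notin [:: 5; 9; 17; 41; 49]%N).

Lemma entry_testP e (F : finFieldType) : odd #|F| -> entry_test e ->
  #|F| = N.to_nat (entry_card e) -> dichotomy F.
Proof.
case: e => [[p h1] h2] oF /and3P[/eqP sz t1 t2] cF.
have sz2 : ext_card p h2 = ext_card p h1.
  by rewrite /ext_card; congr N.pow; apply: N2Nat.inj; rewrite !lenN_size sz.
have cF2 : #|F| = N.to_nat (ext_card p h2) by rewrite sz2.
have memE s : memN (ext_card p h1) s = (#|F| \in map N.to_nat s) by rewrite memNE cF.
rewrite /= in cF; split.
  move: t2; rewrite sz2 memE -[map _ _]/[:: 3; 7; 13; 17; 25; 49; 121]%N.
  by case: ifP => _ t; split=> // h; [case: (no_point_testP cF2 oF t) | apply: (point_testP cF2 oF t)].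
move: t1; rewrite memE -[map _ _]/[:: 5; 9; 17; 41; 49]%N.
by case: ifP => _ t; split=> // h; [case: (no_point_testP cF oF t) | apply: (point_testP cF oF t)].
Qed.

(** Coefficients start with the constant one; a relation of length 1 is the element [tau] itself.
    Every relation makes [tau] a generator and, except where the curve has no primitive point, the
    abscissa of such a point. Some fields use different abscissas for the two curves. *)
Definition entries : seq entry := [::
(3, [:: 2], [:: 2]); (5, [:: 3], [:: 3]); (7, [:: 3], [:: 3]); (3, [:: 1; 1], [:: 1; 1]); (13, [::
2], [:: 2]); (17, [:: 3], [:: 3]); (19, [:: 13], [:: 2]); (5, [:: 2; 2], [:: 2; 2]); (3, [:: 2; 0;
1], [:: 2; 0; 1]); (29, [:: 19], [:: 2]); (41, [:: 6], [:: 6]); (43, [:: 26], [:: 3]); (7, [:: 2;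
2], [:: 2; 2]); (61, [:: 6], [:: 18]); (3, [:: 1; 1; 1; 2], [:: 1; 0; 0; 1]); (97, [:: 23], [::
21]); (109, [:: 10], [:: 11]); (113, [:: 24], [:: 21]); (11, [:: 5; 2], [:: 5; 2]); (5, [:: 2; 0;
1], [:: 2; 3; 2]); (13, [:: 2; 5], [:: 2; 4]); (181, [:: 28], [:: 41]); (193, [:: 38], [:: 10]);
(241, [:: 35], [:: 42]); (17, [:: 3; 7], [:: 5; 2]); (313, [:: 31], [:: 14]); (337, [:: 34], [::
19]); (7, [:: 3; 2; 1], [:: 3; 0; 2]); (19, [:: 17; 7], [:: 5; 6]); (433, [:: 40], [:: 14]); (457,
[:: 15], [:: 46]); (23, [:: 12; 7], [:: 12; 8]); (5, [:: 3; 0; 3; 1], [:: 2; 1; 1; 0]); (641, [::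
12], [:: 24]); (673, [:: 30], [:: 11]); (3, [:: 1; 1; 1; 1; 1; 1], [:: 1; 0; 1; 0; 2; 1]); (29, [::
2; 3], [:: 3; 5]); (881, [:: 23], [:: 15]); (31, [:: 7; 5], [:: 7; 3]); (1201, [:: 29], [:: 69]);
(11, [:: 2; 0; 1], [:: 2; 0; 1]); (37, [:: 20; 14], [:: 20; 14]); (41, [:: 7; 5], [:: 6; 11]); (43,
[:: 10; 11], [:: 10; 11]); (13, [:: 2; 7; 6], [:: 2; 7; 6]); (47, [:: 3; 13], [:: 3; 13]); (7, [::
2; 2; 2; 0], [:: 2; 2; 2; 3]); (53, [:: 2; 25], [:: 2; 25]); (59, [:: 15; 6], [:: 15; 6]); (3697,
[:: 40], [:: 61]); (61, [:: 26; 23], [:: 26; 23]); (67, [:: 16; 17], [:: 16; 17]); (71, [:: 50; 29],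
[:: 50; 29]); (73, [:: 5; 3], [:: 5; 3]); (79, [:: 19; 3], [:: 19; 3]); (3, [:: 1; 1; 1; 0; 1; 0; 1;
0], [:: 1; 1; 1; 0; 1; 0; 1; 0]); (83, [:: 9; 16], [:: 9; 16]); (89, [:: 19; 28], [:: 19; 28]); (97,
[:: 10; 12], [:: 10; 12]); (101, [:: 29; 11], [:: 29; 11]); (103, [:: 19; 7], [:: 19; 7]); (107, [::
16; 18], [:: 16; 18]); (109, [:: 10; 14], [:: 10; 14]); (113, [:: 19; 5], [:: 19; 5]); (11, [:: 3;
0; 3; 1], [:: 3; 0; 3; 1]); (5, [:: 2; 1; 1; 1; 0; 2], [:: 2; 1; 1; 1; 0; 2]); (127, [:: 15; 10],
[:: 15; 10]); (131, [:: 7; 40], [:: 7; 40]); (137, [:: 13; 21], [:: 13; 21]); (139, [:: 29; 4], [::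
29; 4]); (149, [:: 13; 10], [:: 13; 10]); (151, [:: 22; 22], [:: 22; 22]); (157, [:: 18; 4], [:: 18;
4]); (163, [:: 10; 6], [:: 10; 6]); (167, [:: 8; 6], [:: 8; 6]); (13, [:: 11; 4; 11; 2], [:: 11; 4;
11; 2]); (173, [:: 8; 23], [:: 8; 23]); (179, [:: 9; 10], [:: 9; 10]); (181, [:: 2; 32], [:: 2;
32]); (191, [:: 18; 16], [:: 18; 16]); (197, [:: 3; 6], [:: 3; 6]); (199, [:: 10; 14], [:: 10; 14]);
(211, [:: 9; 2], [:: 9; 2]); (223, [:: 31; 6], [:: 31; 6]); (227, [:: 10; 15], [:: 10; 15]); (229,
[:: 6; 17], [:: 6; 17]); (233, [:: 6; 12], [:: 6; 12]); (239, [:: 72; 50], [:: 72; 50]); (241, [::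
35; 31], [:: 35; 31]); (251, [:: 17; 3], [:: 17; 3]); (263, [:: 8; 24], [:: 8; 24]); (269, [:: 8;
1], [:: 8; 1]); (271, [:: 18; 10], [:: 18; 10]); (277, [:: 18; 22], [:: 18; 22]); (281, [:: 11; 17],
[:: 11; 17]); (283, [:: 7; 2], [:: 7; 2]); (17, [:: 5; 2; 0; 4], [:: 5; 2; 0; 4]); (293, [:: 3; 13],
[:: 3; 13]); (307, [:: 11; 26], [:: 11; 26]); (311, [:: 25; 25], [:: 25; 25]); (313, [:: 10; 5], [::
10; 5]); (317, [:: 3; 6], [:: 3; 6]); (331, [:: 17; 19], [:: 17; 19]); (337, [:: 22; 26], [:: 22;
26]); (7, [:: 2; 0; 0; 0; 3; 2], [:: 2; 0; 0; 0; 3; 2]); (349, [:: 40; 29], [:: 40; 29]); (353, [::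
13; 22], [:: 13; 22]); (359, [:: 22; 24], [:: 22; 24]); (19, [:: 4; 0; 0; 1], [:: 4; 0; 0; 1]);
(373, [:: 34; 48], [:: 34; 48]); (379, [:: 26; 32], [:: 26; 32]); (389, [:: 14; 2], [:: 14; 2]);
(401, [:: 3; 11], [:: 3; 11]); (409, [:: 47; 1], [:: 47; 1]); (419, [:: 36; 19], [:: 36; 19]); (421,
[:: 18; 27], [:: 18; 27]); (431, [:: 10; 4], [:: 10; 4]); (439, [:: 20; 5], [:: 20; 5]); (443, [::
4; 2], [:: 4; 2]); (449, [:: 47; 50], [:: 47; 50]); (461, [:: 44; 30], [:: 44; 30]); (463, [:: 9;
1], [:: 9; 1]); (491, [:: 15; 6], [:: 15; 6]); (509, [:: 22; 12], [:: 22; 12]); (521, [:: 38; 48],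
[:: 38; 48]); (23, [:: 6; 3; 6; 0], [:: 6; 3; 6; 0]); (547, [:: 34; 11], [:: 34; 11]); (569, [:: 30;
9], [:: 30; 9]); (571, [:: 25; 14], [:: 25; 14]); (599, [:: 13; 23], [:: 13; 23]); (601, [:: 11; 7],
[:: 11; 7]); (617, [:: 17; 6], [:: 17; 6]); (619, [:: 16; 17], [:: 16; 17]); (631, [:: 10; 14], [::
10; 14]); (643, [:: 26; 18], [:: 26; 18]); (659, [:: 3; 4], [:: 3; 4]); (661, [:: 35; 13], [:: 35;
13]); (691, [:: 6; 7], [:: 6; 7]); (701, [:: 11; 17], [:: 11; 17]); (709, [:: 39; 61], [:: 39; 61]);
(727, [:: 15; 10], [:: 15; 10]); (739, [:: 17; 8], [:: 17; 8]); (761, [:: 7; 17], [:: 7; 17]); (769,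
[:: 28; 19], [:: 28; 19]); (811, [:: 35; 20], [:: 35; 20]); (839, [:: 8; 21], [:: 8; 21]); (29, [::
3; 4; 0; 2], [:: 3; 4; 0; 2]); (859, [:: 7; 7], [:: 7; 7]); (881, [:: 30; 28], [:: 30; 28]); (911,
[:: 6; 11], [:: 6; 11]); (919, [:: 21; 25], [:: 21; 25]); (991, [:: 4; 29], [:: 4; 29]); (1009, [::
52; 42], [:: 52; 42]); (1021, [:: 43; 7], [:: 43; 7]); (1049, [:: 24; 20], [:: 24; 20]); (1051, [::
26; 16], [:: 26; 16]); (1091, [:: 35; 19], [:: 35; 19]); (1231, [:: 2; 16], [:: 2; 16]); (1259, [::
17; 5], [:: 17; 5]); (1289, [:: 15; 17], [:: 15; 17]); (1291, [:: 33; 7], [:: 33; 7]); (1301, [::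
33; 43], [:: 33; 43]); (11, [:: 3; 2; 1; 1; 1; 3], [:: 3; 2; 1; 1; 1; 3]); (1429, [:: 24; 38], [::
24; 38]); (1471, [:: 10; 10], [:: 10; 10]); (1481, [:: 31; 12], [:: 31; 12]); (1559, [:: 11; 17],
[:: 11; 17]); (1609, [:: 37; 27], [:: 37; 27]); (1709, [:: 23; 3], [:: 23; 3]); (1721, [:: 27; 1],
[:: 27; 1]); (43, [:: 9; 1; 5; 9], [:: 9; 1; 5; 9]); (1861, [:: 21; 27], [:: 21; 27]); (1871, [:: 8;
21], [:: 8; 21]); (1931, [:: 19; 41], [:: 19; 41]); (2029, [:: 2; 11], [:: 2; 11]); (2129, [:: 29;
25], [:: 29; 25]); (2141, [:: 3; 51], [:: 3; 51]); (2281, [:: 7; 19], [:: 7; 19]); (2309, [:: 7;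
26], [:: 7; 26]); (2311, [:: 33; 28], [:: 33; 28]); (2339, [:: 41; 37], [:: 41; 37]); (2381, [:: 13;
3], [:: 13; 3]); (2521, [:: 44; 25], [:: 44; 25]); (2549, [:: 23; 49], [:: 23; 49]); (2729, [:: 46;
80], [:: 46; 80]); (2731, [:: 29; 13], [:: 29; 13]); (2969, [:: 58; 30], [:: 58; 30]); (3079, [::
11; 2], [:: 11; 2]); (3191, [:: 18; 53], [:: 18; 53]); (3541, [:: 7; 1], [:: 7; 1]); (3571, [:: 19;
20], [:: 19; 20]); (3739, [:: 20; 21], [:: 20; 21]); (4759, [:: 17; 41], [:: 17; 41]); (5279, [::
47; 52], [:: 47; 52]); (5851, [:: 4; 24], [:: 4; 24])]%num.

(* One number for each [q] that reaches the third case of [candidate], in the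
   order of the search: a coordinate [x] good for both curves when [q] is
   prime, a coprime factor when [q] is not a prime power, and [0] when [q] is
   the cardinality of an entry above. *)
Definition certificates : seq N := [::
103; 479; 1103; 43; 986; 366; 59; 1403; 4789; 0; 431; 47; 2167; 1693; 41; 157; 151; 173; 4397; 582;
811; 61; 109; 349; 127; 1263; 892; 214; 1381; 1473; 139; 83; 241; 683; 73; 2188; 137; 449; 2003;
641; 202; 1846; 101; 538; 53; 547; 3943; 205; 1150; 0; 474; 71; 47; 93; 79; 1067; 883; 109; 1662;
2757; 607; 239; 89; 531; 492; 3643; 1048; 229; 1439; 2663; 2555; 983; 97; 1031; 2492; 199; 620; 89;
47; 579; 71; 381; 658; 1687; 61; 53; 101; 59; 389; 447; 311; 1259; 229; 997; 542; 541; 207; 354;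
379; 269; 371; 41; 523; 283; 760; 43; 83; 1229; 2027; 127; 258; 109; 199; 113; 202; 67; 0; 149; 53;
197; 1199; 907; 599; 59; 131; 41; 2689; 582; 757; 2207; 211; 223; 302; 43; 163; 863; 619; 2699;
1914; 2467; 2209; 181; 313; 457; 659; 916; 559; 2011; 1277; 113; 138; 103; 2089; 877; 1289; 2633;
1811; 292; 2399; 222; 43; 69; 1063; 116; 444; 58; 71; 113; 476; 747; 797; 109; 2699; 1621; 479;
2347; 877; 43; 541; 3478; 89; 158; 1861; 643; 1667; 317; 61; 925; 41; 602; 558; 131; 149; 83; 101;
71; 2309; 1135; 872; 509; 257; 0; 101; 79; 493; 73; 139; 1652; 701; 2269; 2837; 3434; 2143; 71;
1873; 59; 227; 823; 715; 227; 253; 177; 47; 2397; 43; 53; 137; 4446; 2389; 67; 149; 587; 124; 907;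
964; 59; 281; 419; 101; 167; 547; 471; 472; 479; 666; 409; 89; 173; 1282; 1626; 773; 644; 247; 53;
479; 0; 433; 349; 2181; 611; 43; 1137; 1283; 1165; 356; 1667; 769; 41; 911; 813; 701; 118; 156;
1409; 1933; 307; 394; 83; 908; 645; 191; 61; 123; 143; 113; 107; 1258; 359; 79; 47; 836; 0; 1366;
2644; 181; 274; 89; 71; 401; 739; 601; 1072; 199; 1931; 502; 53; 254; 757; 439; 83; 757; 67; 1136;
379; 467; 167; 3697; 59; 563; 249; 617; 139; 127; 349; 5009; 0; 866; 590; 107; 1066; 307; 92; 67;
53; 1091; 109; 163; 313; 642; 43; 47; 853; 331; 1273; 61; 103; 59; 113; 401; 2361; 773; 787; 1259;
424; 277; 73; 857; 541; 0; 87; 295; 151; 0; 286; 79; 41; 53; 167; 263; 241; 461; 211; 317; 502;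
1098; 1282; 83; 3469; 41; 617; 863; 1365; 107; 599; 503; 557; 109; 4001; 148; 1270; 860; 1763; 606;
347; 559; 113; 918; 0; 43; 389; 73; 804; 82; 563; 541; 41; 53; 797; 416; 1559; 113; 71; 228; 59; 73;
131; 177; 1039; 47; 109; 1543; 2158; 2333; 733; 43; 443; 193; 1553; 0; 509; 458; 79; 673; 1949; 101;
137; 95; 293; 43; 103; 41; 281; 73; 446; 97; 1777; 226; 129; 131; 536; 1033; 601; 556; 79; 39; 727;
699; 41; 53; 1733; 367; 877; 971; 1283; 1381; 498; 193; 43; 456; 1684; 2203; 61; 83; 41; 857; 247;
2213; 53; 631; 151; 251; 1181; 97; 398; 935; 269; 733; 282; 898; 970; 1657; 597; 293; 491; 348; 101;
842; 211; 71; 233; 47; 232; 1443; 149; 229; 1359; 255; 73; 59; 58; 58; 1070; 82; 987; 823; 757; 347;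
0; 257; 763; 228; 1873; 425; 181; 173; 367; 43; 61; 67; 0; 569; 460; 151; 79; 203; 1040; 545; 647;
202; 1821; 2473; 318; 434; 181; 835; 83; 467; 179; 888; 1358; 79; 463; 809; 449; 526; 41; 1775; 569;
67; 59; 1041; 511; 0; 1520; 426; 41; 1123; 367; 106; 619; 239; 758; 469; 1251; 62; 313; 202; 639;
790; 47; 417; 71; 332; 740; 997; 635; 163; 59; 181; 61; 211; 134; 87; 41; 73; 269; 139; 137; 580;
310; 79; 255; 593; 67; 129; 0; 233; 683; 41; 577; 487; 238; 575; 0; 236; 805; 557; 985; 47; 249; 53;
452; 73; 364; 194; 723; 41; 199; 1412; 334; 425; 373; 402; 89; 238; 79; 897; 1013; 241; 47; 58; 71;
257; 382; 109; 505; 283; 491; 433; 1018; 203; 2857; 863; 887; 499; 151; 73; 239; 174; 107; 131; 503;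
41; 187; 291; 43; 628; 223; 1019; 1096; 113; 977; 268; 443; 71; 149; 936; 97; 855; 786; 74; 1175;
1338; 337; 43; 262; 431; 468; 419; 427; 73; 59; 53; 281; 61; 349; 171; 367; 695; 551; 265; 263; 442;
401; 43; 71; 83; 102; 1289; 233; 57; 839; 439; 69; 59; 780; 53; 820; 41; 139; 131; 67; 1195; 521;
1487; 1181; 527; 370; 1399; 339; 397; 599; 293; 171; 1504; 41; 71; 1254; 46; 733; 255; 101; 83; 193;
1082; 47; 181; 53; 103; 188; 371; 695; 107; 73; 465; 691; 141; 858; 263; 68; 43; 1026; 502; 97; 127;
1133; 552; 353; 47; 59; 481; 113; 262; 211; 69; 373; 467; 944; 67; 284; 561; 389; 1193; 271; 73;
151; 652; 430; 967; 643; 1663; 43; 631; 163; 61; 673; 227; 1011; 149; 290; 709; 164; 991; 137; 1367;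
1621; 1301; 83; 587; 281; 1672; 941; 59; 654; 667; 487; 41; 101; 1291; 47; 193; 0; 131; 227; 311;
167; 203; 597; 1273; 139; 521; 236; 59; 218; 79; 97; 344; 626; 816; 193; 241; 43; 61; 1191; 191;
303; 481; 814; 777; 122; 557; 1499; 173; 1433; 211; 89; 257; 157; 149; 1061; 101; 1016; 1069; 684;
546; 2440; 587; 172; 83; 471; 839; 47; 1951; 107; 1609; 558; 596; 41; 1002; 472; 479; 53; 227; 397;
563; 307; 469; 89; 61; 1321; 43; 383; 103; 79; 1249; 2067; 229; 524; 113; 151; 59; 929; 71; 1308;
145; 1637; 47; 97; 379; 109; 137; 1601; 302; 618; 977; 157; 1019; 283; 2381; 794; 52; 993; 1011; 43;
59; 190; 234; 419; 71; 1076; 331; 652; 223; 584; 83; 101; 449; 410; 364; 43; 719; 1801; 418; 681;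
509; 311; 47; 97; 617; 347; 73; 364; 337; 2521; 257; 79; 325; 67; 148; 1319; 1873; 1268; 0; 1117;
347; 1217; 367; 2269; 431; 389; 184; 2131; 691; 59; 226; 481; 346; 3461; 725; 372; 67; 613; 1333;
1145; 103; 67; 631; 113; 557; 475; 599; 53; 223; 191; 1317; 607; 937; 67; 97; 397; 229; 467; 149;
59; 0; 143; 763; 66; 2039; 61; 542; 163; 815; 3019; 71; 141; 591; 1783; 911; 43; 53; 67; 502; 954;
1781; 79; 1109; 346; 359; 435; 923; 103; 863; 668; 797; 0; 251; 97; 73; 241; 53; 283; 1511; 217; 79;
0; 1814; 368; 937; 352; 319; 1657; 613; 61; 59; 396; 253; 151; 73; 487; 923; 303; 47; 470; 233; 109;
229; 643; 831; 41; 317; 113; 1385; 359; 1227; 379; 173; 71; 131; 316; 821; 47; 79; 1597; 157; 937;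
563; 197; 43; 883; 318; 181; 1124; 211; 1071; 47; 41; 1070; 409; 1759; 408; 167; 1789; 331; 1919;
412; 43; 265; 73; 349; 67; 1093; 979; 83; 71; 47; 643; 456; 1311; 954; 383; 59; 137; 631; 599; 34;
142; 419; 1021; 386; 569; 73; 0; 199; 137; 982; 787; 114; 59; 118; 109; 1039; 894; 41; 67; 271;
1399; 1381; 313; 1052; 1155; 1621; 581; 0; 101; 167; 883; 261; 190; 1667; 547; 659; 314; 1741; 2032;
653; 157; 223; 519; 1375; 53; 46; 359; 1167; 47; 602; 326; 556; 861; 352; 617; 733; 454; 83; 214;
463; 92; 163; 1381; 442; 1307; 107; 235; 212; 89; 67; 1062; 67; 414; 0; 272; 657; 752; 199; 95; 59;
924; 165; 381; 93; 193; 137; 589; 1313; 83; 223; 229; 536; 131; 85; 228; 0; 59; 109; 255; 408; 449;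
1730; 73; 417; 127; 97; 346; 318; 115; 1258; 41; 472; 295; 23; 47; 1392; 149; 139; 677; 1239; 227;
271; 431; 43; 0; 193; 83; 643; 89; 641; 863; 954; 509; 930; 757; 67; 614; 173; 654; 743; 797; 197;
167; 569; 615; 158; 805; 142; 115; 97; 647; 151; 94; 179; 283; 1291; 691; 1657; 1123; 571; 374; 83;
775; 685; 34; 257; 71; 1117; 89; 881; 79; 185; 457; 1634; 206; 248; 1459; 593; 89; 530; 1373; 43;
373; 157; 41; 281; 137; 497; 592; 248; 608; 566; 286; 447; 97; 262; 929; 451; 731; 183; 43; 765; 59;
41; 552; 53; 205; 1429; 79; 742; 137; 89; 670; 193; 353; 609; 139; 367; 332; 167; 222; 1375; 151;
47; 761; 227; 401; 61; 2215; 53; 1026; 44; 119; 328; 83; 41; 47; 109; 953; 222; 188; 349; 277; 1591;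
149; 53; 452; 59; 334; 1213; 43; 1553; 477; 163; 535; 71; 443; 604; 61; 683; 118; 179; 528; 1273;
83; 101; 439; 1647; 43; 698; 877; 465; 165; 103; 47; 317; 67; 1100; 503; 89; 1124; 109; 61; 41; 211;
0; 1140; 857; 229; 862; 47; 139; 1048; 59; 281; 41; 207; 787; 67; 43; 311; 1306; 101; 61; 307; 383;
53; 59; 957; 354; 71; 419; 290; 1601; 41; 563; 491; 43; 0; 1229; 1013; 1139; 776; 1187; 827; 232;
607; 912; 220; 67; 621; 709; 79; 83; 271; 337; 788; 779; 863; 347; 77; 59; 71; 308; 509; 1091; 652;
2551; 139; 47; 373; 173; 257; 53; 1559; 61; 171; 1511; 23; 0; 409; 2351; 79; 193; 296; 825; 1747;
127; 223; 678; 43; 1279; 631; 563; 3078; 488; 1361; 34; 1103; 379; 601; 47; 229; 663; 61; 677; 1619;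
53; 373; 571; 73; 269; 1009; 83; 541; 104; 41; 311; 1373; 1889; 811; 257; 151; 281; 47; 766; 111;
1201; 469; 537; 1483; 0; 1663; 877; 131; 53; 173; 963; 1335; 43; 74; 151; 71; 445; 41; 1847; 2099;
615; 1171; 197; 705; 1361; 698; 179; 503; 3371; 1031; 1233; 0; 1540; 0; 47; 372; 497; 61; 206; 401;
89; 115; 107; 79; 59; 110; 43; 127; 713; 568; 283; 235; 461; 745; 157; 116; 482; 47; 41; 503; 821;
83; 71; 290; 307; 347; 0; 930; 43; 471; 309; 1539; 184; 857; 159; 367; 211; 179; 601; 193; 199; 947;
532; 890; 277; 109; 89; 0; 1076; 314; 827; 43; 1197; 475; 139; 228; 758; 53; 107; 71; 163; 424; 778;
41; 103; 1319; 47; 235; 534; 719; 233; 222; 271; 181; 409; 333; 79; 227; 2111; 809; 113; 434; 333;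
226; 436; 156; 371; 113; 61; 47; 743; 449; 830; 1051; 71; 59; 398; 247; 503; 109; 257; 173; 41; 539;
991; 1314; 1193; 379; 53; 781; 76; 101; 382; 1627; 61; 1687; 41; 149; 1289; 53; 1166; 314; 73; 107;
662; 401; 89; 43; 1117; 673; 83; 163; 197; 151; 509; 431; 83; 2011; 118; 0; 109; 681; 382; 966; 43;
827; 349; 195; 251; 71; 103; 775; 197; 223; 157; 88; 302; 39; 199; 708; 202; 907; 137; 47; 59; 41;
67; 223; 1489; 53; 1031; 0; 523; 139; 1654; 2137; 1382; 665; 1100; 127; 113; 43; 269; 1613; 41;
1427; 109; 647; 696; 107; 919; 386; 89; 1126; 1777; 852; 83; 2503; 701; 859; 1578; 1004; 61; 157;
137; 2029; 113; 1574; 831; 443; 219; 1078; 1327; 53; 73; 97; 43; 110; 293; 71; 149; 1583; 239; 1093;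
1060; 173; 2027; 354; 67; 1213; 269; 103; 43; 137; 439; 732; 306; 793; 136; 0; 93; 53; 184; 229; 71;
290; 92; 345; 433; 376; 785; 123; 386; 157; 179; 83; 367; 267; 67; 601; 283; 101; 188; 136; 310;
993; 186; 1003; 251; 433; 479; 86; 383; 597; 353; 1097; 389; 61; 71; 193; 62; 881; 1726; 395; 860;
82; 207; 389; 227; 227; 0; 193; 59; 154; 62; 127; 877; 1004; 197; 47; 43; 131; 137; 821; 761; 695;
61; 887; 101; 895; 1019; 91; 533; 319; 705; 181; 551; 257; 406; 53; 43; 47; 0; 310; 823; 631; 199;
79; 1645; 547; 1724; 281; 1471; 1098; 418; 0; 457; 463; 377; 132; 233; 211; 537; 1013; 523; 1249;
1753; 127; 418; 2189; 97; 329; 103; 61; 409; 101; 421; 165; 344; 816; 0; 156; 459; 744; 59; 832;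
1039; 71; 282; 43; 1091; 863; 1827; 409; 251; 0; 2237; 197; 143; 53; 646; 497; 119; 1681; 79; 573;
163; 107; 47; 83; 103; 109; 1010; 379; 41; 89; 443; 743; 753; 1487; 79; 660; 369; 509; 59; 587; 349;
0; 149; 109; 870; 437; 41; 1032; 998; 197; 179; 39; 61; 771; 433; 431; 547; 583; 859; 924; 47; 83;
287; 727; 37; 93; 671; 110; 620; 41; 373; 317; 809; 763; 395; 71; 268; 349; 449; 171; 821; 212; 61;
1032; 59; 0; 311; 1001; 314; 101; 325; 436; 1098; 134; 738; 167; 237; 0; 109; 346; 67; 157; 428;
352; 0; 57; 1075; 511; 59; 623; 107; 947; 223; 122; 541; 193; 327; 257; 1019; 1277; 87; 593; 238;
1345; 277; 0; 179; 569; 103; 319; 43; 197; 223; 263; 1877; 1197; 47; 1811; 53; 661; 1151; 286; 309;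
406; 739; 127; 43; 1033; 67; 877; 235; 231; 133; 53; 83; 251; 491; 271; 41; 1831; 1907; 439; 541;
97; 617; 83; 107; 158; 0; 544; 53; 47; 67; 143; 395; 173; 89; 409; 0; 733; 459; 541; 109; 335; 43;
467; 129; 1433; 439; 293; 514; 172; 137; 107; 182; 383; 346; 181; 523; 113; 177; 67; 33; 71; 97; 73;
191; 239; 380; 103; 199; 620; 89; 123; 223; 43; 295; 136; 109; 366; 67; 257; 821; 47; 1179; 41; 331;
1223; 593; 352; 53; 337; 263; 276; 101; 107; 738; 427; 689; 654; 379; 583; 599; 41; 316; 109; 373;
241; 261; 2138; 548; 53; 146; 137; 61; 101; 137; 516; 359; 513; 481; 41; 157; 163; 530; 631; 229;
439; 113; 307; 47; 133; 74; 129; 271; 331; 181; 871; 301; 211; 954; 491; 426; 191; 313; 131; 391;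
853; 53; 311; 43; 1613; 173; 199; 1540; 194; 47; 766; 347; 364; 881; 445; 285; 205; 287; 1758; 89;
101; 292; 47; 41; 667; 329; 158; 197; 298; 577; 877; 67; 113; 653; 1187; 59; 1338; 76; 443; 43; 389;
191; 101; 673; 181; 251; 89; 83; 59; 53; 151; 332; 645; 268; 277; 142; 0; 248; 479; 71; 359; 319;
79; 241; 351; 452; 482; 191; 457; 282; 986; 607; 359; 59; 83; 222; 137; 43; 587; 1087; 61; 0; 317;
65; 59; 303; 811; 1429; 41; 385; 313; 101; 119; 0; 149; 137; 302; 89; 104; 97; 691; 41; 181; 47;
787; 1185; 335; 281; 558; 751; 761; 41; 351; 109; 549; 0; 83; 79; 307; 86; 43; 131; 165; 59; 127;
702; 328; 173; 461; 149; 149; 151; 182; 487; 548; 237; 79; 167; 0; 87; 699; 390; 347; 237; 668; 380;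
230; 43; 176; 238; 220; 103; 199; 464; 286; 131; 491; 1266; 479; 1187; 107; 383; 103; 521; 258; 47;
193; 691; 789; 53; 545; 854; 41; 794; 1297; 723; 397; 347; 97; 214; 67; 138; 47; 218; 83; 149; 139;
293; 109; 342; 212; 59; 499; 863; 131; 119; 127; 594; 89; 44; 101; 254; 495; 53; 193; 111; 823; 47;
517; 557; 266; 71; 61; 257; 97; 351; 563; 41; 43; 394; 241; 86; 226; 679; 723; 0; 217; 271; 47; 503;
107; 1848; 113; 1037; 677; 1137; 369; 260; 131; 211; 151; 133; 345; 182; 101; 183; 677; 151; 41;
574; 97; 107; 322; 398; 187; 233; 273; 501; 101; 83; 1066; 199; 401; 530; 0; 463; 673; 113; 838;
142; 134; 365; 669; 102; 137; 67; 316; 263; 41; 1722; 61; 193; 317; 149; 317; 181; 141; 83; 229;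
163; 1510; 383; 740; 41; 43; 195; 1039; 436; 39; 109; 479; 119; 680; 179; 73; 186; 880; 356; 0; 157;
569; 129; 127; 191; 761; 661; 59; 293; 403; 284; 304; 263; 149; 61; 181; 47; 193; 364; 511; 184;
164; 69; 41; 141; 59; 79; 429; 709; 43; 860; 419; 647; 199; 139; 269; 251; 318; 53; 79; 358; 969;
673; 43; 1139; 110; 257; 194; 197; 755; 887; 103; 53; 53; 172; 43; 865; 109; 230; 282; 439; 339;
667; 311; 165; 163; 173; 43; 102; 228; 223; 139; 91; 143; 257; 127; 757; 109; 616; 61; 571; 47; 0;
113; 619; 829; 549; 920; 632; 607; 115; 253; 53; 114; 647; 936; 433; 827; 409; 41; 53; 47; 325; 283;
58; 351; 67; 39; 2001; 77; 330; 227; 1220; 59; 606; 1036; 173; 95; 89; 0; 232; 396; 172; 47; 707;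
53; 233; 307; 1468; 191; 145; 73; 457; 349; 803; 1376; 179; 177; 137; 388; 47; 106; 476; 497; 330;
919; 191; 467; 443; 380; 619; 130; 91; 164; 67; 69; 79; 521; 47; 704; 1016; 415; 565; 752; 151; 872;
419; 61; 802; 139; 223; 149; 661; 47; 317; 109; 859; 241; 132; 217; 103; 65; 759; 353; 101; 641;
181; 43; 233; 73; 376; 385; 155; 109; 0; 399; 331; 0; 47; 131; 557; 369; 499; 319; 751; 61; 137;
227; 103; 101; 47; 353; 157; 101; 213; 463; 41; 82; 43; 915; 193; 439; 769; 218; 71; 199; 73; 67;
887; 119; 879; 222; 979; 74; 271; 107; 167; 409; 449; 293; 59; 251; 43; 53; 593; 167; 97; 563; 41;
697; 644; 658; 335; 101; 79; 891; 88; 43; 43; 618; 277; 101; 67; 46; 263; 458; 47; 61; 1001; 599;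
179; 419; 151; 41; 439; 787; 239; 521; 113; 163; 131; 199; 568; 71; 511; 194; 257; 377; 271; 833;
819; 139; 670; 41; 262; 37; 331; 67; 1282; 281; 213; 646; 103; 163; 137; 523; 457; 234; 101; 443;
237; 73; 41; 466; 719; 138; 509; 223; 892; 59; 71; 1413; 277; 404; 130; 293; 344; 1084; 109; 582;
173; 83; 197; 59; 307; 571; 603; 163; 325; 683; 463; 62; 366; 67; 535; 281; 107; 554; 73; 409; 331;
347; 0; 0; 377; 469; 23; 0; 996; 79; 122; 804; 516; 53; 258; 102; 43; 37; 155; 207; 489; 213; 103;
61; 385; 97; 170; 257; 127; 0; 299; 41; 191; 167; 193; 257; 166; 53; 151; 73; 23; 661; 351; 986; 52;
473; 43; 1231; 83; 331; 0; 43; 131; 116; 359; 337; 673; 442; 326; 127; 431; 262; 47; 74; 277; 474;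
426; 191; 305; 523; 155; 332; 174; 103; 41; 151; 177; 518; 613; 113; 293; 307; 1283; 241; 73; 739;
592; 73; 41; 222; 1202; 0; 389; 71; 1909; 209; 122; 97; 59; 1439; 415; 79; 1048; 2251; 1583; 233;
41; 0; 346; 659; 41; 173; 332; 53; 1066; 504; 1831; 103; 42; 761; 254; 310; 1471; 1187; 421; 461;
67; 107; 61; 281; 231; 179; 139; 303; 1045; 0; 404; 83; 239; 107; 157; 41; 354; 499; 1888; 665; 503;
63; 53; 641; 367; 356; 61; 1109; 0; 439; 545; 307; 595; 140; 190; 41; 202; 241; 1240; 257; 552; 709;
354; 353; 761; 595; 313; 47; 107; 68; 317; 83; 263; 137; 112; 397; 277; 419; 113; 477; 483; 1307;
365; 47; 809; 138; 509; 163; 53; 93; 853; 604; 97; 654; 862; 67; 59; 388; 157; 371; 1669; 661; 565;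
166; 1231; 43; 1109; 356; 419; 449; 103; 414; 496; 107; 1619; 71; 239; 1179; 73; 819; 77; 126; 214;
73; 47; 2074; 127; 458; 107; 179; 1109; 14; 73; 61; 683; 59; 79; 103; 224; 278; 549; 401; 463; 52;
463; 76; 41; 499; 67; 452; 295; 209; 568; 43; 323; 139; 223; 641; 83; 149; 686; 304; 217; 233; 79;
674; 229; 603; 43; 251; 416; 82; 1039; 190; 137; 2074; 158; 653; 53; 43; 71; 307; 101; 211; 41; 109;
422; 59; 397; 1010; 79; 421; 103; 67; 89; 136; 776; 650; 435; 113; 1328; 41; 71; 79; 199; 167; 494;
85; 101; 201; 59; 181; 340; 193; 34; 186; 1283; 2578; 359; 353; 233; 661; 73; 89; 151; 329; 582;
1158; 79; 411; 383; 452; 769; 97; 41; 685; 287; 89; 521; 964; 402; 263; 314; 79; 623; 457; 143; 71;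
427; 643; 577; 1051; 188; 53; 47; 591; 488; 76; 131; 983; 431; 417; 733; 41; 645; 167; 386; 152; 77;
409; 251; 1135; 61; 359; 1031; 1087; 347; 115; 473; 179; 151; 223; 688; 271; 369; 113; 257; 309; 41;
333; 0; 457; 172; 113; 173; 623; 347; 59; 650; 41; 344; 770; 157; 290; 173; 321; 356; 848; 229; 387;
187; 173; 133; 280; 89; 42; 223; 83; 0; 59; 0; 43; 406; 139; 261; 113; 61; 0; 53; 212; 0; 191; 358;
43; 79; 530; 298; 206; 59; 101; 173; 555; 584; 182; 0; 61; 146; 167; 76; 292; 173; 934; 158; 525;
398; 109; 101; 167; 140; 47; 74; 79; 193; 381; 131; 0; 1433; 389; 532; 82; 73; 127; 281; 422; 353;
47; 222; 359; 277; 546; 656; 547; 53; 443; 393; 227; 106; 0; 79; 326; 373; 83; 149; 47; 43; 269;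
109; 457; 106; 215; 2397; 811; 53; 41; 246; 71; 28; 801; 654; 61; 101; 398; 86; 116; 2593; 808; 271;
59; 567; 303; 43; 97; 449; 107; 181; 0; 77; 355; 423; 397; 103; 43; 311; 823; 631; 759; 179; 211;
164; 856; 409; 1287; 182; 186; 257; 111; 671; 2061; 173; 59; 326; 647; 359; 283; 349; 53; 701; 163;
281; 1462; 28; 61; 281; 719; 1072; 613; 328; 133; 314; 349; 181; 137; 733; 201; 315; 299; 186; 321;
28; 421; 611; 874; 531; 43; 426; 257; 41; 127; 171; 239; 179; 461; 109; 1245; 53; 102; 541; 103; 43;
106; 271; 101; 170; 525; 113; 211; 247; 47; 265; 1060; 191; 107; 687; 59; 115; 174; 71; 379; 61;
503; 193; 991; 887; 97; 62; 269; 43; 41; 1084; 734; 163; 307; 199; 211; 318; 317; 963; 86; 83; 77;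
603; 809; 337; 188; 263; 499; 1239; 1063; 641; 88; 376; 569; 352; 308; 643; 107; 941; 71; 127; 83;
163; 751; 29; 230; 53; 831; 251; 59; 932; 155; 67; 233; 297; 370; 1008; 262; 491; 47; 229; 109; 223;
101; 157; 257; 59; 122; 0; 0; 92; 53; 349; 516; 41; 373; 0; 557; 114; 601; 435; 103; 454; 465; 322;
258; 43; 668; 89; 34; 269; 251; 1094; 84; 333; 142; 0; 47; 266; 41; 68; 271; 278; 617; 53; 137; 0;
59; 788; 236; 317; 281; 1153; 47; 1279; 528; 251; 0; 46; 97; 109; 179; 41; 109; 43; 47; 73; 949;
197; 801; 167; 355; 103; 89; 61; 133; 220; 127; 47; 67; 251; 344; 168; 63; 213; 0; 73; 354; 59; 71;
322; 97; 43; 471; 281; 109; 233; 53; 139; 166; 316; 669; 178; 421; 103; 397; 257; 199; 126; 501;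
179; 73; 419; 71; 373; 191; 313; 482; 127; 107; 22; 181; 193; 97; 372; 47; 449; 92; 331; 148; 47;
487; 53; 79; 136; 71; 103; 587; 277; 113; 92; 139; 106; 184; 499; 43; 398; 46; 83; 409; 61; 41; 337;
627; 431; 127; 43; 89; 131; 163; 916; 633; 758; 461; 132; 47; 249; 61; 641; 863; 430; 311; 149; 181;
59; 53; 101; 193; 509; 67; 158; 43; 35; 593; 237; 206; 44; 203; 41; 197; 427; 292; 262; 420; 226;
53; 109; 263; 199; 403; 173; 41; 229; 61; 456; 113; 415; 107; 466; 210; 328; 83; 73; 227; 43; 772;
331; 71; 421; 113; 97; 46; 597; 293; 541; 0; 139; 399; 379; 43; 47; 878; 237; 0; 199; 347; 157; 447;
217; 0; 558; 166; 71; 79; 401; 104; 28; 67; 348; 97; 139; 0; 342; 148; 221; 466; 181; 230; 460; 143;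
107; 201; 137; 103; 241; 607; 528; 257; 293; 149; 0; 859; 59; 1021; 47; 113; 433; 101; 53; 206; 127;
127; 229; 131; 0; 97; 447; 233; 252; 198; 228; 157; 419; 436; 397; 62; 139; 380; 83; 453; 335; 2326;
479; 313; 41; 21; 143; 127; 53; 292; 167; 373; 571; 317; 113; 83; 257; 520; 258; 151; 269; 59; 349;
43; 42; 482; 407; 226; 41; 593; 439; 443; 373; 159; 175; 773; 271; 114; 61; 1068; 165; 79; 618; 613;
574; 71; 233; 131; 0; 179; 47; 79; 218; 443; 205; 139; 233; 201; 503; 47; 258; 89; 0; 621; 0; 374;
188; 42; 73; 79; 214; 28; 101; 305; 22; 34; 22; 337; 156; 167; 271; 281; 179; 312; 293; 138; 1284;
107; 109; 41; 372; 73; 198; 422; 61; 232; 197; 43; 203; 41; 0; 269; 28; 383; 1490; 311; 628; 59;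
199; 461; 67; 131; 347; 409; 398; 499; 115; 428; 107; 805; 88; 331; 179; 41; 307; 47; 61; 365; 84;
356; 63; 0; 43; 68; 707; 407; 421; 173; 219; 227; 661; 542; 181; 61; 73; 71; 403; 695; 154; 636;
163; 369; 67; 55; 113; 756; 457; 170; 73; 59; 103; 280; 348; 211; 751; 157; 127; 167; 317; 449; 35;
387; 283; 83; 67; 149; 59; 112; 104; 349; 624; 963; 470; 109; 260; 22; 41; 21; 428; 752; 281; 0; 79;
223; 607; 193; 354; 73; 277; 56; 293; 349; 190; 55; 199; 0; 104; 53; 53; 868; 399; 142; 79; 56; 0;
43; 582; 193; 229; 23; 151; 371; 65; 191; 61; 211; 59; 76; 283; 351; 211; 359; 89; 673; 163; 373;
233; 269; 310; 127; 223; 304; 396; 416; 491; 71; 61; 130; 107; 233; 598; 257; 47; 113; 97; 0; 238;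
86; 115; 571; 41; 47; 262; 304; 157; 43; 76; 941; 190; 139; 47; 434; 406; 89; 179; 0; 251; 71; 67;
424; 651; 73; 43; 42; 239; 315; 88; 467; 220; 82; 83; 346; 0; 971; 989; 89; 227; 35; 229; 56; 164;
318; 47; 445; 332; 878; 77; 215; 239; 43; 393; 916; 599; 131; 163; 107; 73; 0; 44; 73; 53; 703; 213;
368; 110; 1320; 71; 67; 627; 352; 46; 53; 197; 323; 182; 303; 197; 83; 331; 228; 476; 113; 313; 126;
282; 491; 21; 293; 59; 94; 283; 0; 715; 167; 102; 227; 443; 199; 353; 581; 504; 122; 163; 43; 519;
205; 53; 223; 197; 277; 149; 354; 1218; 199; 494; 273; 67; 21; 197; 352; 202; 239; 131; 78; 271;
158; 254; 73; 127; 430; 101; 409; 61; 37; 367; 504; 314; 523; 0; 113; 0; 123; 167; 157; 177; 71;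
173; 281; 251; 139; 1259; 131; 0; 197; 0; 915; 172; 33; 248; 173; 443; 269; 114; 227; 843; 383; 41;
67; 436; 157; 101; 417; 67; 107; 149; 41; 130; 43; 73; 153; 553; 73; 146; 103; 47; 56; 131; 41; 0;
29; 251; 43; 425; 307; 201; 47; 101; 211; 13; 43; 167; 247; 273; 47; 119; 47; 59; 632; 61; 467; 83;
595; 299; 61; 58; 138; 139; 86; 151; 105; 371; 103; 247; 268; 35; 269; 345; 202; 71; 56; 83; 220;
166; 212; 187; 181; 217; 257; 199; 79; 473; 83; 212; 753; 41; 41; 131; 325; 890; 73; 163; 385; 21;
41; 473; 71; 313; 209; 74; 132; 13; 114; 215; 83; 646; 279; 67; 174; 329; 530; 207; 149; 59; 97;
307; 641; 211; 61; 218; 528; 168; 589; 262; 262; 0; 239; 97; 85; 283; 223; 0; 603; 70; 311; 113; 63;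
134; 70; 79; 47; 745; 279; 379; 59; 139; 420; 73; 76; 89; 301; 247; 43; 707; 307; 57; 71; 371; 137;
63; 46; 220; 521; 97; 262; 139; 89; 234; 264; 53; 73; 107; 109; 211; 127; 28; 403; 41; 73; 130; 178;
113; 112; 103; 193; 237; 177; 211; 252; 667; 102; 164; 213; 116; 85; 277; 257; 213; 313; 43; 79;
167; 230; 103; 647; 553; 43; 281; 67; 109; 70; 59; 122; 385; 39; 191; 482; 53; 136; 283; 101; 606;
425; 67; 226; 114; 77; 136; 111; 515; 34; 47; 109; 149; 173; 148; 89; 61; 151; 131; 336; 157; 71;
283; 73; 137; 227; 308; 79; 355; 59; 28; 139; 1031; 557; 594; 372; 111; 163; 173; 158; 274; 109;
185; 89; 47; 751; 153; 299; 194; 136; 233; 220; 110; 103; 35; 79; 396; 143; 41; 53; 191; 51; 239;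
78; 44; 43; 176; 21; 233; 37; 193; 616; 373; 59; 345; 23; 515; 520; 53; 306; 193; 342; 137; 101; 39;
83; 227; 263; 621; 166; 449; 582; 163; 212; 451; 163; 97; 47; 141; 465; 1005; 563; 59; 83; 439; 33;
41; 53; 61; 353; 109; 263; 229; 389; 297; 151; 109; 134; 179; 181; 357; 113; 41; 1119; 163; 201;
215; 311; 61; 83; 67; 126; 239; 167; 184; 79; 71; 39; 276; 148; 83; 59; 803; 41; 70; 55; 106; 359;
35; 283; 574; 373; 67; 85; 279; 41; 715; 151; 14; 53; 89; 178; 149; 41; 29; 187; 227; 197; 107; 0;
0; 0; 249; 0; 0; 812; 158; 0; 43; 107; 77; 331; 83; 381; 208; 157; 86; 41; 43; 74; 47; 215; 51; 234;
83; 83; 187; 59; 92; 47; 131; 83; 149; 566; 811; 163; 1175; 773; 348; 47; 827; 79; 548; 470; 70; 37;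
456; 747; 330; 317; 109; 0; 251; 73; 433; 82; 67; 1047; 152; 43; 457; 276; 71; 83; 620; 114; 160;
43; 234; 79; 199; 895; 89; 0; 233; 47; 95; 123; 138; 511; 623; 379; 564; 94; 937; 311; 41; 248; 367;
191; 39; 251; 780; 347; 417; 491; 47; 149; 562; 113; 337; 277; 95; 187; 210; 0; 0; 235; 565; 67; 59;
458; 0; 109; 41; 146; 59; 572; 101; 143; 399; 83; 565; 107; 139; 67; 30; 272; 38; 541; 67; 659; 178;
103; 43; 540; 138; 326; 274; 79; 195; 0; 311; 205; 975; 109; 245; 113; 83; 397; 67; 173; 138; 131;
105; 47; 419; 558; 149; 41; 53; 45; 0; 401; 38; 397; 177; 177; 137; 41; 257; 777; 101; 205; 119;
421; 342; 367; 274; 43; 59; 440; 322; 113; 118; 526; 89; 179; 532; 390; 364; 41; 165; 107; 45; 1885;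
367; 2069; 1240; 41; 53; 173; 139; 278; 587; 149; 226; 307; 201; 664; 184; 59; 340; 191; 332; 328;
103; 60; 212; 119; 101; 331; 282; 161; 20; 109; 368; 157; 47; 326; 70; 79; 103; 0; 245; 35; 205;
431; 41; 67; 23; 47; 233; 113; 383; 255; 506; 59; 114; 101; 249; 165; 261; 353; 107; 79; 876; 0; 88;
107; 41; 66; 233; 116; 251; 569; 47; 461; 61; 313; 53; 71; 127; 275; 613; 370; 92; 139; 647; 191;
69; 311; 465; 575; 87; 167; 103; 173; 315; 215; 69; 47; 79; 103; 370; 344; 310; 885; 29; 73; 346;
69; 101; 59; 211; 46; 90; 83; 127; 143; 113; 229; 221; 83; 131; 157; 89; 188; 37; 223; 85; 151; 449;
78; 97; 44; 61; 88; 690; 483; 506; 70; 31; 177; 37; 171; 61; 163; 492; 479; 257; 145; 131; 61; 0;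
107; 35; 176; 229; 257; 637; 139; 293; 835; 35; 104; 35; 97; 541; 118; 47; 71; 43; 69; 313; 223;
279; 73; 506; 107; 43; 253; 167; 397; 271; 619; 1283; 59; 106; 83; 89; 47; 78; 43; 157; 53; 113;
118; 992; 223; 118; 223; 166; 164; 127; 344; 460; 154; 71; 0; 124; 45; 47; 61; 258; 133; 137; 412;
101; 208; 53; 89; 205; 375; 212; 149; 424; 67; 215; 53; 145; 0; 83; 133; 213; 505; 172; 10; 58; 67;
52; 269; 533; 197; 241; 658; 240; 53; 0; 97; 271; 41; 157; 159; 53; 463; 73; 70; 0; 59; 47; 541; 73;
79; 523; 523; 279; 80; 61; 213; 79; 369; 163; 299; 53; 89; 181; 142; 527; 0; 0; 0; 133; 20; 46; 356;
397; 111; 43; 0; 114; 358; 79; 249; 0; 43; 71; 37; 95; 103; 837; 47; 271; 237; 287; 251; 426; 0; 19;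
131; 47; 113; 355; 92; 67; 195; 295; 53; 151; 176; 157; 179; 117; 43; 79; 623; 135; 59; 299; 139;
41; 119; 399; 43; 173; 389; 410; 639; 113; 45; 137; 390; 71; 46; 199; 137; 656; 135; 171; 97; 76;
43; 61; 176; 157; 41; 122; 22; 51; 527; 11; 142; 258; 715; 268; 164; 131; 165; 241; 131; 89; 286;
41; 79; 67; 53; 179; 117; 127; 221; 87; 109; 355; 129; 73; 74; 0; 119; 33; 258; 97; 299; 163; 263;
310; 109; 115; 268; 111; 41; 149; 321; 47; 61; 35; 688; 258; 83; 251; 227; 89; 59; 113; 69; 73; 177;
659; 46; 232; 71; 73; 173; 191; 211; 670; 401; 190; 43; 41; 311; 881; 163; 199; 89; 59; 317; 452;
544; 214; 281; 389; 313; 20; 94; 157; 381; 109; 41; 173; 257; 67; 293; 480; 197; 302; 151; 11; 170;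
34; 167; 47; 227; 135; 250; 280; 73; 251; 395; 283; 47; 233; 277; 45; 305; 43; 502; 35; 181; 359;
107; 396; 97; 244; 82; 73; 149; 83; 367; 365; 871; 101; 61; 97; 116; 193; 47; 195; 340; 126; 269;
255; 89; 163; 235; 45; 137; 223; 381; 257; 59; 67; 874; 223; 249; 376; 55; 47; 593; 47; 83; 62; 221;
269; 349; 431; 283; 0; 47; 188; 207; 77; 80; 164; 157; 0; 21; 191; 211; 69; 389; 383; 76; 557; 43;
79; 101; 80; 260; 91; 211; 394; 131; 510; 191; 157; 83; 59; 353; 152; 129; 107; 112; 86; 61; 388;
241; 191; 90; 0; 104; 19; 139; 38; 287; 46; 422; 202; 70; 82; 53; 74; 307; 61; 67; 190; 579; 464;
103; 141; 43; 181; 59; 71; 254; 19; 55; 156; 47; 533; 173; 31; 157; 41; 139; 181; 71; 227; 71; 83;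
82; 13; 20; 310; 377; 107; 97; 53; 67; 113; 475; 61; 137; 40; 233; 339; 270; 0; 170; 30; 47; 109;
73; 119; 39; 127; 103; 167; 158; 205; 73; 131; 281; 73; 119; 197; 183; 199; 41; 20; 208; 34; 61;
156; 80; 82; 71; 71; 41; 163; 179; 230; 472; 265; 102; 46; 79; 145; 251; 113; 59; 290; 87; 0; 13;
53; 204; 724; 240; 179; 193; 73; 103; 258; 41; 229; 79; 317; 179; 71; 167; 59; 0; 280; 47; 510; 235;
53; 145; 63; 0; 79; 89; 61; 124; 28; 389; 71; 143; 380; 539; 163; 127; 137; 80; 160; 562; 82; 271;
149; 34; 179; 0; 0; 344; 71; 214; 0; 124; 135; 41; 69; 393; 47; 43; 87; 92; 41; 172; 152; 505; 0;
127; 149; 1094; 139; 223; 319; 71; 59; 10; 135; 11; 340; 88; 61; 748; 15; 115; 333; 0; 251; 277; 65;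
131; 58; 63; 43; 575; 197; 41; 107; 139; 42; 113; 287; 14; 165; 71; 101; 269; 53; 152; 73; 146; 91;
113; 71; 109; 229; 0; 47; 523; 35; 61; 107; 193; 41; 241; 55; 101; 19; 223; 168; 83; 460; 247; 10;
368; 271; 263; 190; 193; 87; 259; 167; 59; 0; 47; 167; 65; 73; 13; 59; 345; 118; 37; 126; 127; 175;
401; 41; 143; 40; 59; 109; 265; 603; 356; 263; 11; 61; 149; 112; 80; 60; 21; 151; 263; 127; 71; 86;
287; 89; 61; 40; 257; 199; 28; 635; 187; 115; 73; 67; 53; 53; 233; 103; 197; 335; 113; 28; 83; 41;
62; 332; 67; 109; 193; 166; 109; 101; 267; 127; 452; 0; 0; 41; 42; 47; 67; 74; 61; 47; 77; 28; 58;
159; 101; 11; 215; 80; 359; 43; 61; 14; 97; 101; 251; 59; 0; 43; 127; 113; 416; 74; 109; 239; 59;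
41; 103; 370; 723; 89; 251; 134; 151; 33; 277; 305; 257; 67; 86; 234; 203; 0; 138; 202; 0; 124; 28;
168; 124; 109; 67; 217; 101; 105; 151; 41; 59; 187; 141; 244; 73; 127; 21; 201; 71; 20; 53; 43; 198;
159; 493; 0; 83; 233; 63; 223; 43; 139; 148; 186; 43; 157; 59; 314; 51; 84; 181; 161; 191; 572; 83;
117; 13; 40; 21; 71; 63; 0; 228; 313; 44; 161; 59; 467; 41; 181; 78; 88; 328; 151; 59; 73; 307; 239;
47; 277; 246; 190; 283; 59; 175; 13; 71; 47; 79; 33; 53; 505; 197; 66; 45; 114; 271; 61; 86; 222;
10; 0; 52; 164; 101; 76; 157; 19; 58; 132; 22; 88; 52; 43; 131; 261; 38; 104; 373; 0; 68; 221; 42;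
228; 211; 283; 107; 130; 53; 83; 58; 47; 218; 53; 93; 240; 139; 101; 185; 158; 154; 208; 10; 244;
82; 0; 155; 13; 252; 0; 138; 57; 104; 319; 0; 71; 198; 13; 423; 139; 71; 31; 10; 263; 208; 23; 41;
47; 46; 45; 33; 41; 0; 0; 33; 0; 0; 0; 0; 133; 73; 15; 298; 15; 85; 30; 31; 15; 14; 247; 104; 47;
45; 205; 135; 456; 51; 182; 202; 41; 45; 47; 79; 312; 53; 140; 57; 60; 43; 59; 185; 61; 174; 59; 43;
62; 40; 65; 47; 40; 113; 79; 44; 39; 111; 53; 67; 38; 29; 41; 33; 38; 109; 89; 20; 261; 41; 118; 83;
306; 202; 42; 223; 103; 106; 134; 89; 212; 154; 228; 94; 87; 93; 90; 15; 29; 61; 107; 73; 43; 65;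
133; 59; 83; 264; 39; 31; 13; 53; 367; 143; 329; 165; 91; 199; 69; 42; 30; 67; 373; 111; 164; 73;
79; 126; 33; 123; 109; 10; 649; 71; 13; 86; 33; 109; 244; 143; 101; 45; 15; 47; 59; 67; 53; 264;
358; 61; 79; 43; 20; 408; 221; 122; 43; 61; 89; 177; 83; 97; 131; 296; 220; 79; 447; 92; 85; 61; 41;
53; 206; 89; 88; 182; 370; 149; 21; 14; 101; 113; 43; 659; 107; 56; 53; 101; 65; 130; 58; 159; 103;
20; 78; 136; 79; 110; 82; 149; 177; 101; 43; 73; 151; 420; 62; 280; 226; 132; 30; 10; 193; 172; 73;
43; 44; 173; 67; 953; 211; 173; 73; 259; 82; 401; 190; 41; 86; 446; 271; 67; 12; 227; 65; 157; 321;
297; 43; 454; 281; 61; 78; 41; 229; 179; 260; 53; 303; 173; 52; 130; 113; 330; 168; 459; 42; 67; 23;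
172; 103; 509; 208; 170; 199; 259; 561; 61; 439; 47; 30; 199; 47; 249; 83; 89; 79; 139; 77; 22; 123;
88; 190; 191; 61; 369; 41; 269; 59; 577; 292; 241; 43; 131; 158; 37; 149; 62; 277; 244; 210; 97;
466; 113; 103; 62; 94; 301; 43; 421; 97; 151; 67; 94; 167; 210; 411; 197; 216; 83; 41; 43; 370; 47;
22; 279; 73; 267; 104; 105; 109; 79; 238; 21; 96; 145; 108; 23; 29; 75; 206; 538; 73; 150; 191; 79;
157; 108; 151; 67; 43; 43; 67; 52; 21; 216; 274; 53; 59; 60; 163; 61; 103; 39; 30; 21; 47; 13; 135;
181; 130; 93; 244; 181; 271; 83; 211; 337; 165; 330; 87; 14; 67; 60; 70; 28; 63; 131; 59; 66; 47; 0;
47; 132; 333; 146; 137; 191; 34; 59; 79; 12; 43; 282; 107; 251; 219; 41; 31; 35; 55; 35; 53; 84; 71;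
59; 31; 205; 116; 157; 147; 134; 31; 14; 27; 53; 48; 11; 54; 57; 228; 61; 43; 174; 67; 0; 0; 34; 0;
103; 270; 52; 14; 55; 26; 110; 34; 46; 67; 28; 165; 0; 30; 148; 59; 22; 14; 28; 43; 47; 37; 71; 97;
26; 238; 39; 24; 84; 6; 147; 71; 78; 103; 55; 43; 93; 180; 27; 27; 87; 101; 0; 39; 43; 59; 24; 10;
228; 13; 84; 59; 0; 76; 11; 103; 5; 13; 41; 88; 44; 12; 45; 43; 73; 10; 10; 48; 71; 47; 39; 44; 187;
41; 12; 24; 5; 97; 30; 68; 15; 90; 106; 59; 53; 35; 29; 43; 5; 14; 62; 95; 118; 61; 0; 0; 84; 19;
145; 14; 85; 112; 35; 38; 6; 37; 66; 20; 63; 75; 119; 44; 42; 5; 24; 67; 4177; 181; 1451; 2443;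
1091; 53; 2647; 1497; 2318; 167; 89; 43; 1292; 465; 542; 98; 58; 632; 1032; 378; 163; 337; 857;
1630; 345; 358; 41; 461; 966; 1643; 43; 487; 421; 47; 1064; 263; 518; 142; 193; 120; 61; 571; 59;
271; 691; 337; 57; 481; 113; 73; 761; 861; 445; 151; 78; 207; 1607; 159; 163; 1783; 206; 71; 137;
53; 424; 1069; 376; 701; 115; 47; 228; 43; 546; 107; 41; 1063; 1750; 353; 1068; 127; 349; 179; 229;
41; 43; 743; 833; 127; 619; 284; 329; 607; 453; 210; 593; 622; 79; 149; 601; 999; 369; 757; 701;
927; 812; 89; 157; 241; 190; 83; 61; 499; 209; 479; 166; 57; 224; 83; 181; 43; 148; 24; 79; 610;
217; 101; 199; 188; 257; 88; 429; 103; 486; 43; 331; 251; 118; 179; 113; 427; 415; 584; 582; 408;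
607; 260; 239; 271; 50; 959; 541; 42; 337; 457; 739; 47; 761; 637; 97; 401; 89; 853; 367; 67; 43;
661; 347; 384; 233; 587; 550; 151; 109; 280; 929; 71; 193; 137; 311; 232; 277; 85; 53; 317; 43; 465;
393; 832; 367; 926; 1795; 263; 397; 802; 392; 122; 67; 285; 241; 59; 2548; 167; 2209; 550; 41; 227;
673; 1201; 53; 631; 371; 1687; 1097; 148; 635; 743; 612; 313; 449; 1694; 1129; 382; 862; 109; 204;
73; 199; 43; 59; 630; 419; 210; 127; 524; 61; 53; 70; 799; 139; 523; 158; 22; 101; 47; 952; 360;
350; 541; 59; 520; 523; 61; 713; 41; 71; 54; 736; 151; 562; 601; 194; 139; 197; 229; 683; 807; 107;
1103; 341; 83; 1693; 447; 206; 163; 179; 67; 67; 825; 726; 109; 229; 43; 79; 107; 373; 722; 43; 833;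
157; 798; 1485; 872; 973; 909; 193; 41; 359; 73; 308; 132; 213; 61; 71; 359; 107; 162; 283; 352; 43;
102; 113; 558; 564; 496; 331; 41; 295; 317; 302; 167; 47; 810; 2027; 619; 1367; 40; 857; 263; 179;
23; 73; 212; 79; 235; 41; 70; 67; 103; 53; 414; 781; 337; 246; 491; 573; 647; 56; 787; 43; 401;
1548; 436; 1127; 178; 223; 502; 1297; 10; 414; 83; 428; 358; 479; 200; 139; 817; 379; 191; 597; 652;
991; 101; 443; 227; 995; 386; 880; 67; 417; 1907; 97; 421; 997; 83; 1303; 151; 179; 52; 22; 348; 76;
389; 269; 67; 83; 741; 73; 271; 585; 47; 247; 168; 229; 672; 233; 172; 815; 162; 457; 163; 1068;
242; 298; 43; 469; 884; 79; 186; 211; 199; 233; 727; 107; 317; 728; 223; 257; 103; 487; 1233; 313;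
43; 13; 61; 53; 941; 70; 90; 97; 59; 377; 158; 281; 331; 173; 43; 154; 277; 983; 1026; 89; 344; 549;
152; 103; 761; 104; 70; 503; 97; 351; 932; 502; 577; 109; 173; 126; 1456; 53; 1582; 323; 490; 883;
71; 202; 47; 397; 43; 152; 1355; 383; 79; 83; 59; 273; 661; 639; 101; 66; 1229; 97; 473; 73; 227;
47; 43; 457; 347; 199; 799; 179; 70; 454; 71; 41; 79; 283; 146; 1028; 53; 61; 1094; 59; 43; 127;
521; 123; 41; 968; 30; 329; 1111; 406; 681; 235; 358; 734; 563; 554; 124; 214; 762; 47; 792; 443;
59; 66; 835; 1350; 71; 419; 673; 414; 218; 660; 43; 1217; 10; 178; 229; 854; 181; 382; 307; 241; 59;
323; 383; 211; 479; 149; 271; 43; 151; 83; 233; 163; 452; 114; 496; 73; 859; 61; 251; 293; 46; 864;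
89; 308; 257; 39; 78; 471; 72; 61; 41; 113; 42; 102; 47; 107; 534; 473; 71; 131; 59; 219; 131; 325;
41; 478; 318; 79; 30; 280; 223; 229; 1102; 204; 101; 163; 103; 103; 97; 30; 137; 59; 229; 67; 14;
376; 281; 153; 47; 200; 462; 127; 43; 760; 107; 437; 109; 323; 53; 188; 233; 614; 211; 168; 17; 59;
205; 695; 173; 1050; 131; 83; 19; 41; 132; 613; 251; 283; 53; 89; 380; 151; 157; 47; 43; 197; 498;
367; 139; 281; 67; 137; 134; 120; 1810; 113; 71; 163; 1049; 127; 83; 41; 62; 107; 618; 680; 976;
353; 59; 185; 101; 89; 263; 339; 463; 288; 79; 53; 313; 101; 686; 349; 736; 439; 1358; 351; 227;
364; 56; 229; 151; 59; 148; 173; 41; 317; 67; 779; 311; 151; 211; 313; 157; 78; 260; 587; 137; 67;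
79; 104; 43; 297; 475; 47; 43; 13; 442; 1117; 792; 792; 227; 328; 307; 190; 402; 141; 971; 79; 1157;
53; 1068; 312; 516; 71; 179; 877; 823; 59; 523; 137; 597; 491; 223; 347; 521; 379; 823; 455; 61;
431; 265; 47; 286; 162; 71; 611; 377; 423; 150; 41; 156; 178; 83; 40; 172; 290; 59; 103; 383; 673;
373; 66; 72; 547; 73; 137; 323; 149; 151; 573; 460; 90; 70; 109; 352; 163; 67; 131; 293; 232; 19;
53; 304; 71; 271; 308; 17; 101; 67; 43; 195; 167; 59; 193; 455; 87; 73; 157; 162; 53; 61; 1152; 264;
109; 40; 734; 43; 382; 83; 549; 519; 227; 197; 67; 269; 231; 474; 380; 47; 41; 105; 53; 209; 61; 43;
921; 233; 352; 376; 112; 383; 378; 89; 191; 149; 52; 47; 215; 173; 271; 130; 43; 239; 37; 1438; 170;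
89; 703; 131; 250; 53; 979; 23; 96; 43; 118; 173; 339; 83; 469; 90; 97; 107; 271; 255; 128; 421;
479; 47; 409; 24; 270; 629; 469; 200; 152; 61; 387; 311; 101; 89; 6; 101; 79; 50; 436; 563; 175;
104; 37; 445; 109; 151; 207; 252; 44; 349; 113; 47; 473; 59; 67; 659; 220; 401; 167; 269; 295; 55;
53; 933; 199; 1055; 41; 298; 429; 485; 288; 130; 142; 54; 103; 197; 191; 18; 43; 35; 61; 269; 163;
71; 176; 79; 281; 131; 47; 359; 94; 157; 403; 1583; 158; 164; 570; 59; 187; 43; 93; 197; 132; 113;
391; 174; 241; 97; 760; 223; 313; 272; 149; 199; 98; 47; 11; 41; 67; 493; 127; 314; 242; 179; 349;
206; 586; 126; 708; 331; 101; 263; 19; 307; 417; 273; 423; 43; 41; 231; 54; 73; 275; 84; 73; 101;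
371; 118; 71; 11; 82; 286; 206; 519; 253; 47; 83; 41; 30; 11; 155; 668; 569; 166; 151; 97; 39; 559;
58; 241; 199; 18; 59; 0; 0; 18; 314; 454; 238; 98; 140; 54; 70; 520; 54; 88; 293; 413; 224; 128; 40;
1272; 79; 73; 418; 336; 1686; 248; 53; 266; 212; 83; 67; 353; 43; 17; 358; 35; 154; 13; 111; 403;
41; 103; 24; 73; 558; 47; 43; 59; 757; 174; 264; 234; 137; 188; 131; 141; 149; 69; 96; 139; 59; 67;
41; 398; 339; 79; 23; 157; 43; 151; 47; 53; 28; 10; 128; 62; 89; 76; 59; 113; 127; 61; 97; 30; 669;
884; 239; 41; 50; 141; 50; 79; 286; 137; 107; 76; 286; 905; 181; 109; 10; 90; 77; 89; 53; 321; 90;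
28; 18; 291; 41; 282; 99; 103; 79; 104; 174; 266; 374; 603; 53; 701; 422; 41; 59; 293; 229; 553;
101; 73; 587; 17; 163; 109; 131; 239; 233; 97; 53; 103; 47; 111; 349; 61; 127; 506; 179; 219; 137;
181; 52; 738; 913; 20; 271; 155; 442; 47; 994; 193; 89; 239; 277; 792; 94; 521; 457; 62; 239; 311;
220; 151; 145; 62; 177; 97; 72; 53; 24; 73; 254; 233; 41; 53; 137; 47; 173; 179; 43; 133; 176; 14;
109; 115; 18; 70; 38; 34; 41; 241; 53; 283; 32; 483; 40; 71; 404; 219; 411; 140; 140; 275; 61; 47;
235; 88; 43; 101; 113; 154; 56; 35; 95; 6; 94; 203; 61; 5; 67; 41; 476; 78; 99; 89; 298; 239; 47;
265; 102; 15; 302; 115; 140; 23; 42; 73; 5; 70; 13; 19; 119; 43; 163; 180; 66; 59; 409; 109; 52;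
151; 110; 101; 41; 174; 66; 103; 53; 124; 139; 146; 67; 41; 177; 421; 162; 61; 15; 13; 6; 197; 11;
510; 425; 61; 223; 173; 98; 449; 74; 318; 43; 240; 115; 113; 59; 103; 54; 294; 162; 59; 79; 20; 47;
307; 71; 380; 29; 150; 83; 183; 72; 302; 5; 386; 22; 90; 140; 77; 67; 364; 302; 72; 330; 85; 59;
139; 111; 41; 103; 104; 73; 109; 79; 18; 5; 133; 131; 41; 181; 73; 55; 78; 43; 43; 55; 94; 47; 189;
288; 120; 101; 40; 5; 395; 219; 107; 229; 118; 59; 28; 137; 53; 6; 83; 99; 73; 298; 239; 45; 22; 61;
322; 43; 165; 303; 53; 71; 239; 67; 258; 173; 83; 391; 386; 113; 139; 342; 47; 396; 30; 282; 14;
104; 184; 83; 47; 195; 67; 6; 6; 43; 50; 67; 57; 113; 127; 333; 10; 41; 61; 126; 132; 90; 22; 188;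
79; 468; 84; 54; 42; 352; 47; 61; 61; 41; 101; 43; 94; 89; 18; 79; 17; 271; 0; 20; 0; 22; 62; 87;
142; 262; 152; 6; 45; 162; 10; 41; 0; 128; 23; 88; 5; 72; 15; 11; 146; 151; 43; 240; 41; 384; 38;
52; 59; 6; 200; 53; 110; 65; 98; 47; 53; 28; 201; 172; 33; 32; 71; 53; 136; 41; 6; 251; 173; 43;
103; 39; 41; 23; 150; 393; 71; 130; 113; 53; 41; 353; 223; 76; 413; 79; 183; 347; 40; 34; 230; 41;
47; 71; 113; 55; 167; 15; 62; 43; 89; 107; 193; 47; 56; 191; 247; 40; 173; 162; 114; 98; 41; 41;
123; 79; 71; 40; 186; 229; 59; 97; 29; 22; 3; 50; 14; 113; 82; 98; 83; 3; 8; 103; 7; 82; 17; 10; 85;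
29; 43; 99; 42; 3; 83; 3; 18; 2; 19; 0; 11; 3; 43; 12; 7; 2; 78; 26; 37; 2; 0; 0; 15; 7; 29; 2; 29;
37; 35; 32; 347; 3209; 43; 463; 139; 59; 6; 197; 51; 76; 421; 199; 41; 28; 76; 239; 15; 67; 12; 293;
183; 263; 14; 87; 173; 18; 251; 47; 104; 751; 89; 389; 401; 3; 235; 3; 79; 101; 317; 69; 173; 15;
131; 421; 41; 29; 53; 71; 198; 228; 126; 103; 106; 246; 139; 75; 97; 433; 233; 127; 53; 232; 99;
191; 7; 73; 7; 179; 713; 41; 82; 109; 7; 83; 218; 147; 71; 229; 73; 56; 73; 57; 28; 7; 491; 47; 186;
67; 311; 127; 57; 167; 293; 110; 359; 397; 107; 3; 61; 283; 601; 565; 521; 163; 119; 43; 306; 181;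
131; 593; 823; 29; 47; 54; 26; 89; 193; 613; 689; 95; 61; 167; 191; 137; 73; 31; 113; 419; 30; 3;
31; 112; 26; 242; 131; 41; 30; 83; 173; 89; 43; 78; 257; 11; 241; 293; 101; 192; 251; 347; 109; 44;
3; 103; 67; 337; 19; 15; 47; 43; 28; 73; 367; 53; 479; 163; 233; 443; 61; 67; 35; 67; 59; 77; 3;
157; 313; 197; 3; 62; 117; 67; 108; 137; 149; 41; 308; 197; 58; 86; 109; 163; 120; 7; 47; 139; 199;
488; 198; 188; 199; 96; 41; 223; 337; 78; 53; 19; 127; 97; 71; 65; 47; 106; 251; 359; 173; 35; 273;
43; 65; 76; 42; 43; 92; 302; 73; 54; 43; 24; 140; 53; 352; 194; 127; 22; 92; 190; 281; 7; 89; 59;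
37; 307; 141; 119; 43; 199; 135; 79; 89; 157; 3; 304; 208; 109; 3; 3; 15; 48; 51; 59; 53; 31; 79;
85; 41; 352; 71; 101; 31; 7; 47; 220; 97; 3; 69; 97; 7; 173; 149; 40; 126; 503; 54; 3; 183; 109; 6;
26; 47; 3; 26; 31; 194; 52; 3; 62; 73; 41; 163; 186; 7; 167; 71; 53; 278; 280; 47; 159; 3; 74; 103;
6; 41; 44; 12; 241; 137; 236; 3; 43; 127; 54; 201; 3; 133; 83; 94; 10; 328; 67; 151; 145; 263; 98;
15; 43; 14; 211; 31; 113; 109; 67; 331; 109; 79; 40; 61; 182; 41; 43; 3; 48; 3; 163; 29; 127; 101;
14; 131; 203; 50; 188; 61; 55; 107; 70; 52; 269; 15; 97; 3; 96; 204; 75; 56; 66; 195; 124; 13; 3;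
136; 41; 13; 26; 7; 107; 47; 3; 31; 89; 26; 75; 19; 109; 129; 92; 44; 197; 137; 204; 109; 108; 42;
207; 114; 47; 131; 3; 3; 210; 174; 93; 62; 94; 15; 11; 107; 279; 93; 92; 40; 3; 71; 109; 119; 103;
211; 34; 24; 77; 77; 48; 31; 21; 41; 47; 97; 113; 46; 15; 57; 53; 31; 43; 51; 262; 47; 3; 354; 12;
3; 79; 61; 41; 48; 127; 73; 3; 181; 77; 17; 48; 21; 24; 44; 23; 11; 109; 58; 12; 23; 24; 12; 6; 12;
15; 7; 75; 47; 31; 24; 41; 34; 10; 159; 31; 3; 54; 43; 42; 14; 67; 56; 47; 41; 43; 75; 13; 112; 19;
134; 31; 42; 71; 41; 13; 109; 47; 73; 21; 3; 59; 53; 192; 53; 61; 73; 28; 97; 65; 22; 68; 97; 204;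
10; 3; 47; 6; 83; 106; 43; 53; 83; 82; 22; 21; 177; 244; 24; 11; 2; 145; 114; 71; 275; 79; 6; 70;
172; 47; 61; 38; 11; 43; 78; 20; 162; 19; 199; 44; 89; 61; 53; 43; 170; 61; 31; 98; 61; 50; 97; 69;
19; 5; 7; 147; 0; 39; 42; 2; 10; 18; 5; 2; 28; 200; 2; 2; 63; 34; 47; 12; 3; 44; 26; 32; 56; 28; 41;
73; 48; 54; 71; 13; 57; 29; 15; 69; 38; 3; 12; 93; 149; 67; 71; 52; 40; 131; 53; 2; 39; 58; 44; 7;
45; 97; 11; 6; 43; 61; 55; 280; 59; 10; 83; 20; 43; 10; 75; 41; 10; 7; 39; 2; 29; 53; 31; 6; 29; 28;
172; 48; 47; 41; 6; 26; 14; 0; 43; 2; 12; 5; 18; 26; 14; 0; 0; 3; 7; 79; 75; 97; 31; 17; 2; 21; 59;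
14; 3; 2; 38; 7; 11; 39; 14; 26; 13; 79; 20; 82; 5; 13; 17; 33; 3; 38; 66; 2; 87; 41; 35; 15; 51; 7;
15; 47; 2; 379; 53; 89; 44; 43; 137; 131; 23; 74; 29; 94; 21; 101; 0; 21; 42; 19; 61; 76; 29; 6; 33;
83; 110; 40; 33; 22; 61; 8; 43; 43; 5; 10; 43; 22; 17; 11; 5; 0; 0; 19; 10; 15; 5]%num.

Lemma odd_primes_smallP j : (0 < j <= 1500)%N ->
  map N.to_nat (odd_primes_small (N.of_nat j)) = [seq l <- primes j | odd l].
Proof.
have /allP tab : all (fun j => map N.to_nat (odd_primes_small (N.of_nat j)) ==
    [seq l <- primes j | odd l]) (iota 1 1500) by vm_cast_no_check (erefl true).
by move=> j1500; apply/eqP/tab; rewrite mem_iota.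
Qed.

Lemma entries_valid : all entry_test entries.
Proof. vm_cast_no_check (erefl true). Qed.

(** A leaf ends by meeting a row beyond [J], which is at most 1500, and running out of rows counts
    as failure; the 1502 rows therefore suffice. The fuel 1000 bounds the number of values of [p]
    along a branch. *)
Lemma run_certificates : run 1502 1000 (map entry_card entries) certificates.
Proof. vm_cast_no_check (erefl true). Qed.

(** Makes the two cases of the conclusion fit: a field outside the entries, where both curves have a
    primitive point, is not an exception for either curve. *)
Lemma exceptions_in_entries :
  all (fun q => N.of_nat q \in map entry_card entries)
    ([:: 3; 7; 13; 17; 25; 49; 121] ++ [:: 5; 9; 17; 41; 49])%N.
Proof. by vm_compute. Qed.

Theorem theorem1p1 (F : finFieldType) (Hodd : odd #|F|) :
  (has_primitive_point (-1 : F) <->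
     #|F| \notin [:: 3; 7; 13; 17; 25; 49; 121]%N) /\
  (has_primitive_point (1 : F) <->
     #|F| \notin [:: 5; 9; 17; 41; 49]%N).
Proof.
have q0 := finField_card_gt0 F.
have n_even : ~~ odd #|F|.-1 by rewrite -(prednK q0) /= in Hodd.
have := runP odd_primes_smallP run_certificates (card_pred_gt0 F) n_even.
rewrite /settled prednK //.
have [/mapP[e ee qE] _|notin [both|//]] := boolP (N.of_nat #|F| \in map entry_card entries).
  by apply: (entry_testP Hodd (allP entries_valid e ee)); rewrite -qE Nat2N.id.
have [point1 pointN1] := both F (erefl _).
have out s : {subset s <= [:: 3; 7; 13; 17; 25; 49; 121] ++ [:: 5; 9; 17; 41; 49]}%N -> #|F| \notin s.
  by move=> sub; apply: contra notin => /sub; apply: (allP exceptions_in_entries).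
by split; split=> // _; apply: out => q qs; rewrite mem_cat qs ?orbT.
Qed.
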